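(* Every locally projective abstract polytope of rank $4$ is finite.
   Context: An abstract polytope is section regular if the isomorphism type of each section $F/G$ depends only on the ranks of $F$ and $G$. A rank-3 section regular polytope is spherical if it is one of the Platonic solids $\{3,3\},\{4,3\},\{3,4\},\{5,3\},\{3,5\}$ (or a degenerate spherical polytope such as $\{p,2\}$, $\{2,p\}$), and projective if it is one of $\{4,3\}_3$ (hemicube), $\{3,4\}_3$ (hemi-octahedron), $\{5,3\}_5$ (hemidodecahedron), $\{3,5\}_5$ (hemi-icosahedron), the quotients of the cube, octahedron, dodecahedron and icosahedron by their central inversion. A rank-4 polytope is locally projective if it is section regular, each of its facets and vertex figures is spherical or projective, and at least one of them (facets or vertex figures) is projective. *)

(* Defs.v *)
From Stdlib Require Import List.
From mathcomp Require Import all_boot.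

Set Implicit Arguments.
Unset Strict Implicit.
Unset Printing Implicit Defensive.

Definition order_iso (A B : Type) (la : A -> A -> Prop) (lb : B -> B -> Prop) :=
  exists f : A -> B, bijective f /\ forall x y, la x y <-> lb (f x) (f y).

Definition dual_rel (A : Type) (la : A -> A -> Prop) : A -> A -> Prop :=
  fun x y => la y x.

Definition has_card (T : Type) (P : T -> Prop) (n : nat) :=
  exists s : list T, List.NoDup s /\ length s = n /\ forall x, P x <-> List.In x s.

Definition is_partial_order (T : Type) (le : T -> T -> Prop) :=
  [/\ (forall x, le x x),
      (forall x y, le x y -> le y x -> x = y) &
      (forall x y z, le x y -> le y z -> le x z)].

Definition ltp (T : Type) (le : T -> T -> Prop) (x y : T) := le x y /\ x <> y.

Definition is_least (T : Type) (le : T -> T -> Prop) (b : T) := forall x, le b x.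
Definition is_greatest (T : Type) (le : T -> T -> Prop) (t : T) := forall x, le x t.

Definition is_chain (T : Type) (le : T -> T -> Prop) (C : T -> Prop) :=
  forall x y, C x -> C y -> le x y \/ le y x.

Definition is_flag (T : Type) (le : T -> T -> Prop) (C : T -> Prop) :=
  is_chain le C /\
  forall D, is_chain le D -> (forall x, C x -> D x) -> forall x, D x -> C x.

Definition adjacent_flags (T : Type) (C D : T -> Prop) :=
  exists x y, [/\ C x, ~ D x, D y, ~ C y &
    forall z, z <> x -> z <> y -> (C z <-> D z)].

Definition strongly_flag_connected (T : Type) (le : T -> T -> Prop) :=
  forall C D, is_flag le C -> is_flag le D ->
  exists (k : nat) (Ph : nat -> T -> Prop),
    [/\ (forall x, Ph 0 x <-> C x),
        (forall x, Ph k x <-> D x),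
        (forall i, i < k -> adjacent_flags (Ph i) (Ph i.+1)) &
        (forall i, i <= k ->
           is_flag le (Ph i) /\ forall x, C x -> D x -> Ph i x)].

(* has_level F k  <->  rank F = k - 1  (k = number of faces strictly below F
   in a flag through F; in a polytope this does not depend on the flag) *)
Definition has_level (T : Type) (le : T -> T -> Prop) (F : T) (k : nat) :=
  exists C, [/\ is_flag le C, C F & has_card (fun G => C G /\ ltp le G F) k].

Definition abstract_polytope (T : Type) (le : T -> T -> Prop) (n : nat) :=
  [/\ is_partial_order le,
      (exists b, is_least le b) /\ (exists t, is_greatest le t),
      (forall C, is_flag le C -> has_card C n.+2),
      strongly_flag_connected le &
      (forall F G a, has_level le F a -> has_level le G a.+2 -> ltp le F G ->
         has_card (fun H => ltp le F H /\ ltp le H G) 2)].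

Definition section_car (T : Type) (le : T -> T -> Prop) (F G : T) :=
  {H : T | le G H /\ le H F}.

Definition section_rel (T : Type) (le : T -> T -> Prop) (F G : T) :
  section_car le F G -> section_car le F G -> Prop :=
  fun x y => le (proj1_sig x) (proj1_sig y).

Arguments section_rel {T} le F G _ _.

Definition section_regular (T : Type) (le : T -> T -> Prop) :=
  forall F G F' G' a b, le G F -> le G' F' ->
    has_level le F a -> has_level le F' a ->
    has_level le G b -> has_level le G' b ->
    order_iso (section_rel le F G) (section_rel le F' G').

(* face lattice given by the vertex sets of the faces, ordered by inclusion *)
Definition vfaces_car (V : finType) (face : pred {set V}) := {A : {set V} | face A}.
Definition vfaces_rel (V : finType) (face : pred {set V}) :
  vfaces_car face -> vfaces_car face -> Prop :=
  fun A B => val A \subset val B.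

Arguments vfaces_rel {V} face _ _.

(* quotient by a central inversion sigma (acting on vertices):
   faces are the classes {A, sigma A}, and [A] <= [B] iff A <= B or A <= sigma B *)
Definition hemi_car (V : finType) (face : pred {set V}) (sigma : V -> V) :=
  {X : {set {set V}} | [exists A, face A && (X == [set A; sigma @: A])]}.
Definition hemi_rel (V : finType) (face : pred {set V}) (sigma : V -> V) :
  hemi_car face sigma -> hemi_car face sigma -> Prop :=
  fun X Y => [exists A in val X, exists B in val Y, A \subset B].

Arguments hemi_rel {V} face sigma _ _.

Definition tet_face : pred {set 'I_4} := fun _ => true.

(* octahedron {3,4}: vertices +-e_i, faces = antipodal-free sets and the whole *)
Definition oct_V := ('I_3 * bool)%type.
Definition oct_face : pred {set oct_V} := fun A =>
  (A == setT) || [forall i : 'I_3, ~~ (((i, true) \in A) && ((i, false) \in A))].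
Definition oct_anti (v : oct_V) : oct_V := (v.1, ~~ v.2).

(* icosahedron {3,5}: vertex 0 (top), 1..5 (upper ring), 6..10 (lower ring),
   11 (bottom); lower vertex 6+i lies between upper vertices 1+i and 1+(i+1). *)
Definition ico_tri (a b c : nat) : {set 'I_12} := [set inord a; inord b; inord c].
Definition ico_tris : seq {set 'I_12} :=
  flatten [seq [:: ico_tri 0 (1 + i) (1 + (i.+1 %% 5));
                   ico_tri 11 (6 + i) (6 + (i.+1 %% 5));
                   ico_tri (1 + i) (1 + (i.+1 %% 5)) (6 + i);
                   ico_tri (6 + i) (6 + (i.+1 %% 5)) (1 + (i.+1 %% 5))]
          | i <- iota 0 5].
Definition ico_face : pred {set 'I_12} := fun A =>
  (A == setT) || has (fun t : {set 'I_12} => A \subset t) ico_tris.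
Definition ico_anti_nat (n : nat) : nat :=
  if n == 0 then 11 else if n == 11 then 0
  else if n <= 5 then 6 + ((n - 1 + 2) %% 5)
  else 1 + ((n - 6 + 3) %% 5).
Definition ico_anti (v : 'I_12) : 'I_12 := inord (ico_anti_nat v).

(* degenerate dihedron {p,2}: p vertices, p edges (edge i = {i, i+1 mod p}),
   two p-gonal 2-faces *)
Inductive dih_face (p : nat) : Type :=
| DBot | DV of 'I_p | DE of 'I_p | DF of bool | DTop.
Arguments DBot {p}. Arguments DTop {p}.

Definition dih_rel (p : nat) (x y : dih_face p) : Prop :=
  match x, y with
  | DBot, _ => True
  | _, DTop => True
  | DV i, DV j => i = j
  | DV i, DE j => nat_of_ord i = nat_of_ord j \/ nat_of_ord i = (j.+1 %% p)
  | DV _, DF _ => True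
  | DE i, DE j => i = j
  | DE _, DF _ => True
  | DF a, DF b => a = b
  | _, _ => False
  end.

Definition is_spherical3 (A : Type) (la : A -> A -> Prop) :=
  order_iso la (vfaces_rel tet_face) \/
  order_iso la (dual_rel (vfaces_rel oct_face)) \/
  order_iso la (vfaces_rel oct_face) \/
  order_iso la (dual_rel (vfaces_rel ico_face)) \/
  order_iso la (vfaces_rel ico_face) \/
  (exists p, 2 <= p /\
     (order_iso la (@dih_rel p) \/ order_iso la (dual_rel (@dih_rel p)))).

Definition is_projective3 (A : Type) (la : A -> A -> Prop) :=
  [\/ order_iso la (dual_rel (hemi_rel oct_face oct_anti)),
      order_iso la (hemi_rel oct_face oct_anti),
      order_iso la (dual_rel (hemi_rel ico_face ico_anti))
    | order_iso la (hemi_rel ico_face ico_anti)].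

Definition sph_or_proj3 (A : Type) (la : A -> A -> Prop) :=
  is_spherical3 la \/ is_projective3 la.

(* locally projective (for a rank-4 polytope): facets = sections F/F_{-1}
   with rank F = 3 (level 4), vertex figures = sections F_4/v with rank v = 0
   (level 1) *)
Definition locally_projective4 (T : Type) (le : T -> T -> Prop) :=
  section_regular le /\
  forall bot top, is_least le bot -> is_greatest le top ->
  [/\ (forall F, has_level le F 4 -> sph_or_proj3 (section_rel le F bot)),
      (forall v, has_level le v 1 -> sph_or_proj3 (section_rel le top v)) &
      (exists F, has_level le F 4 /\ is_projective3 (section_rel le F bot)) \/
      (exists v, has_level le v 1 /\ is_projective3 (section_rel le top v))].

Definition finite_type (T : Type) := exists s : list T, forall x, List.In x s.

(* Main.v *)
(** Exchanging the [i]-face of a flag defines four fixed-point-free involutions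
    [r0], ..., [r3] of the set of flags, which they permute transitively.  By
    section regularity the relations among [r0], [r1], [r2] (resp. [r1], [r2],
    [r3]) seen on one facet (resp. one vertex figure) hold on all flags, so the
    flags form a transitive set for a Coxeter group [[p,q,s]] with the additional
    relation [(r1 r2 r3)^h = 1] (after dualizing, the vertex figures are
    projective), and it is enough to show that such sets are finite.

    For most types a short Todd-Coxeter enumeration does it.  The exception is
    [{{5,3},{3,5}_5}], whose group J1 x L2(19) has order 600415200.  Let
    [z = (r0 r1 r2)^5] be the central inversion of a facet.  A few thousand
    relators show that [z] commutes with [r3 z r3 z r3]; over a subgroup of the
    centralizer of [z] the enumeration then stops at 1463 cosets, so [z] has
    finitely many conjugates.  By Dietzmann's lemma these involutions generate a
    finite normal subgroup, modulo which the facets become projective and the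
    enumeration closes at the 57 vertices of the 57-cell, whose stabilizers are
    finite. *)

Require Import Defs.
From mathcomp Require Import all_boot.
From mathcomp Require Import boolp.
From mathcomp Require classical_sets.
From mathcomp Require Import zify.
From Stdlib Require Import ListDec PArith FMapPositive String Ascii.

Set Implicit Arguments.
Unset Strict Implicit.
Unset Printing Implicit Defensive.

(** * Coset enumeration *)

(** No group is ever formed. Everything is a set with four involutions, and the enumeration is run
    in whichever set suits: the flags, the subsets of a set (a coset is a translate of an orbit),
    the self-maps under conjugation (the conjugates of [z]), the subsets invariant under a normal
    subgroup (the quotient by it). A table is a list of true equations between points. Hence a
    finished table bounds an orbit from above, and an unfinished one still proves every relation
    that closes up in it. The obstacle in type [5,3,5] is size: with vertex stabilizers of order 60
    there would be 10006920 vertices. The detour through [z] is short because [z] dies in L2(19),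
    the group of the 57-cell, and so lies in the factor J1; there all involutions are conjugate with
    centralizers of order 120, which leaves 175560 / 120 = 1463 conjugates. The facet group is only
    part of the centralizer of [z], and the commutation with [r3 z r3 z r3] supplies an element
    outside it. The rank 3 models enter only through relations among their flips, found by
    exhaustive search on codes of faces. *)

Inductive gen := r0 | r1 | r2 | r3.
Definition gens := [:: r0; r1; r2; r3].
Definition word := seq gen.

Definition power (w : word) (k : nat) : word := flatten (nseq k w).

Inductive row := Row of option positive & option positive
                      & option positive & option positive.

Definition entry (x : row) (g : gen) :=
  let: Row a b c d := x in
  match g with r0 => a | r1 => b | r2 => c | r3 => d end.

Definition upd (x : row) (g : gen) (e : option positive) :=
  let: Row a b c d := x in
  match g with
  | r0 => Row e b c d | r1 => Row a e c d
  | r2 => Row a b e d | r3 => Row a b c e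
  end.

Definition norow := Row None None None None.

Definition table := PositiveMap.t row.

Definition look (t : table) (c : positive) (g : gen) : option positive :=
  if PositiveMap.find c t is Some x then entry x g else None.

Definition put (t : table) (c : positive) (g : gen) (d : positive) : table :=
  PositiveMap.add c
    (upd (if PositiveMap.find c t is Some x then x else norow) g (Some d)) t.

(** The generators are involutions, so an edge is entered in both directions. For the same reason
    [rev w] is the inverse of [w], and the backward scan uses the same table. *)
Definition join (t : table) c g d := put (put t c g d) d g c.

Fixpoint walk (t : table) (c : positive) (w : word) : positive * word :=
  if w is g :: w' then
    if look t c g is Some d then walk t d w' else (c, w)
  else (c, [::]).

Definition merge_edge (row : row) (s : positive -> positive) (a : positive)
    (tq : table * seq (positive * positive)) (g : gen) :=
  let: (t, q) := tq in
  if entry row g is Some d then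
    (join t a g (s d),
     if look t a g is Some e then (s d, s e) :: q else q)
  else tq.

Definition merge_edges row s a tq := foldl (merge_edge row s a) tq gens.
Arguments merge_edges : simpl never.

(* A table only records equations between points, so an entry may be overwritten
   and one of two conflicting entries queued as a coincidence. *)
Fixpoint merge (k : nat) (t : table) (q : seq (positive * positive)) : table :=
  match k, q with
  | k'.+1, (x, y) :: q' =>
    if (x =? y)%positive then merge k' t q' else
    let a := Pos.min x y in let b := Pos.max x y in
    let s z := if (z =? b)%positive then a else z in
    let row := if PositiveMap.find b t is Some row then row else norow in
    let: (t', q'') := merge_edges row s a
       (PositiveMap.remove b t, [seq (s p.1, s p.2) | p <- q']) in
    merge k' t' q''
  | _, _ => t
  end.

(** Running out of fuel drops pending coincidences; the entries that remain are still true
    equations, so soundness is not affected. *)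
Definition merge_fuel := 10 ^ 4.

(** Closes the gap between [f] and [b] by a path labelled [w] through fresh points [n], [n + 1],
    ...; an empty gap is a coincidence. In [fill] the scan stops at [b] for lack of the last edge,
    so that edge is present only if the path itself began at [b] with the same letter. *)
Fixpoint bridge (t : table) (n f : positive) (w : word) (b : positive) :=
  match w with
  | [::] => (merge merge_fuel t [:: (f, b)], n)
  | [:: g] => (if look t b g is Some e
               then merge merge_fuel (put t f g b) [:: (e, f)]
               else join t f g b, n)
  | g :: w' => bridge (join t f g n) (Pos.succ n) n w' b
  end.

Definition state := (table * positive)%type.

(** The relation is scanned from both ends, as in the Todd-Coxeter procedure. The guard skips cosets
    that were never created or have been merged away. *)
Definition fill (st : state) (c : positive) (w : word) : state :=
  let: (t, n) := st in
  if (c <? n)%positive && PositiveMap.mem c t then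
    let: (f, u) := walk t c w in
    let: (b, v) := walk t c (rev u) in
    bridge t n f (rev v) b
  else st.

(* The Haselgrove-Leech-Trotter strategy: apply all relators to each coset, in
   order of creation. *)
Fixpoint hlt (rels : seq word) (k : nat) (c : positive) (st : state) : state :=
  if k is k'.+1 then
    if (c <? st.2)%positive
    then hlt rels k' (Pos.succ c) (foldl (fun st w => fill st c w) st rels)
    else st
  else st.

Definition relator := (word * nat)%type.
Definition relword (R : relator) : word := power R.1 R.2.
Definition rotations (R : relator) : seq word :=
  [seq power (rot i w) R.2 | w <- [:: R.1; rev R.1], i <- iota 0 (size R.1)].

Definition involutions : seq relator := [seq ([:: g], 2) | g <- gens].

(** Six bits are enough for the index of a word: the seven relators of [locproj] and the four
    involutions have 38 rotations in all. *)
Fixpoint low_bits (k : nat) (p : positive) : nat * positive :=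
  match k, p with
  | k'.+1, xO p' => let: (m, c) := low_bits k' p' in (m.*2, c)
  | k'.+1, xI p' => let: (m, c) := low_bits k' p' in (m.*2.+1, c)
  | _, _ => (0, p)
  end.

(* A step is encoded as 64 * c + i: apply the i-th word of ws to coset c. *)
Definition do_step (ws : seq word) (st : state) (p : positive) :=
  let: (i, c) := low_bits 6 p in fill st c (nth [::] ws i).

Definition start (S : seq word) : state :=
  foldl (fun st w => fill st xH w)
    (PositiveMap.add xH norow (PositiveMap.empty row), 2%positive) S.

Definition enumerate (R : seq relator) (S : seq word) (steps : seq positive)
    (k : nat) : table :=
  (hlt (map relword R) k xH
    (foldl (do_step (flatten (map rotations (R ++ involutions))))
       (start S) steps)).1.

(** Targets are tested for membership because overwriting may leave an edge to a point that has been
    merged away. *)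
Definition closed_under (J : gen -> bool) (t : table) : bool :=
  PositiveMap.mem xH t &&
  all (fun cx => all (fun g => J g ==>
         if entry cx.2 g is Some d then PositiveMap.mem d t else false) gens)
      (PositiveMap.elements t).

Definition fixes_one (t : table) (w : word) : bool :=
  let: (c, u) := walk t xH w in (c =? 1)%positive && nilp u.

Definition letter (c : Ascii.ascii) : gen :=
  match c with "0" => r0 | "1" => r1 | "2" => r2 | _ => r3 end%char.
Fixpoint wd (s : string) : word :=
  if s is String c s' then letter c :: wd s' else [::].
Arguments wd s%_string.

(** * Soundness of the enumeration *)

Section Words.
Variables (Om : Type) (r : gen -> Om -> Om).

Definition wact (w : word) (x : Om) : Om := foldl (fun y g => r g y) x w.
Definition holds (w : word) := forall x, wact w x = x.
Definition satisfies (R : seq relator) :=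
  forall u, List.In u R -> holds (relword u).

Lemma wact_cat u v x : wact (u ++ v) x = wact v (wact u x).
Proof. exact: foldl_cat. Qed.

Hypothesis rK : forall g, involutive (r g).

Lemma wact_revK w : cancel (wact w) (wact (rev w)).
Proof.
elim: w => [|g w IH] x //=.
by rewrite rev_cons -cats1 wact_cat IH /= rK.
Qed.

Lemma wactK_rev w : cancel (wact (rev w)) (wact w).
Proof. by move=> x; rewrite -{1}(revK w) wact_revK. Qed.

Lemma wact_inj w : injective (wact w).
Proof. exact: can_inj (wact_revK w). Qed.

Lemma holds_rev w : holds w -> holds (rev w).
Proof. by move=> h x; rewrite -{1}(h x) wact_revK. Qed.

Lemma power_cat u v k : u ++ power (v ++ u) k = power (u ++ v) k ++ u.
Proof.
rewrite /power; elim: k => [|k IH] /=; first by rewrite cats0.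
by rewrite -!catA IH.
Qed.

Lemma holds_power_rot i w k : holds (power w k) -> holds (power (rot i w) k).
Proof.
rewrite -{1}(cat_take_drop i w) /rot => h x.
have := power_cat (take i w) (drop i w) k.
move/(congr1 (fun v => wact v (wact (rev (take i w)) x))).
by rewrite !wact_cat wactK_rev h wactK_rev.
Qed.

Lemma power_rev w k : power (rev w) k = rev (power w k).
Proof.
have powerC j : w ++ power w j = power w j ++ w.
  by have := power_cat w [::] j; rewrite cats0.
rewrite /power; elim: k => [|k IH] //=.
by rewrite IH -rev_cat -powerC.
Qed.

Lemma holds_rotations R : holds (relword R) ->
  forall w, List.In w (rotations R) -> holds w.
Proof.
move=> h; have h' : holds (power (rev R.1) R.2) by rewrite power_rev; exact: holds_rev.
suff H v : holds (power v R.2) -> forall w s,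
    List.In w [seq power (rot i v) R.2 | i <- s] -> holds w.
  move=> w; rewrite /rotations /= cats0 => /List.in_app_iff [] H'; exact: H H'.
move=> hv w; elim=> //= i s IH [<-|]; last exact: IH.
exact: holds_power_rot.
Qed.

End Words.

Opaque merge_fuel.

Section Soundness.
Variables (Om : Type) (r : gen -> Om -> Om).
Hypothesis rK : forall g, involutive (r g).
Variable x0 : Om.
Implicit Types (val : positive -> Om) (t : table) (n c d f b : positive).

Local Notation wact := (wact r).
Local Notation holds := (holds r).

(* Cosets are interpreted as points; nothing requires distinct cosets to be
   distinct points, so no invariant on coincidences is needed. *)
Definition models val t n := forall c g d, look t c g = Some d ->
  [/\ val d = r g (val c), (c < n)%positive & (d < n)%positive].

Lemma entry_upd x g h e :
  entry (upd x g e) h =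
  match g, h with
  | r0, r0 | r1, r1 | r2, r2 | r3, r3 => e
  | _, _ => entry x h
  end.
Proof. by case: x; case: g; case: h. Qed.

Lemma look_put t c g d c' g' d' : look (put t c g d) c' g' = Some d' ->
  (c' = c /\ g' = g /\ d' = d) \/ look t c' g' = Some d'.
Proof.
rewrite /look /put; have [<-|ne] := Pos.eq_dec c c'; last first.
  by rewrite PositiveMap.gso; [right | exact/nesym].
rewrite PositiveMap.gss entry_upd.
case: (PositiveMap.find c t) => [x|]; case: g; case: g' => /=; auto;
  by case=> ->; left.
Qed.

Lemma models_put val t n c g d : models val t n ->
  (c < n)%positive -> (d < n)%positive -> val d = r g (val c) ->
  models val (put t c g d) n.
Proof.
by move=> h cn dn e c' g' d' /look_put [[-> [-> ->]]|/h].
Qed.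

Lemma models_join val t n c g d : models val t n ->
  (c < n)%positive -> (d < n)%positive -> val d = r g (val c) ->
  models val (join t c g d) n.
Proof.
move=> h cn dn e; apply: models_put => //; first exact: models_put.
by rewrite e rK.
Qed.

Lemma models_remove val t n b : models val t n -> models val (PositiveMap.remove b t) n.
Proof.
move=> h c g d; rewrite /look; have [<-|ne] := Pos.eq_dec b c.
  by rewrite PositiveMap.grs.
by rewrite PositiveMap.gro; [exact: h | exact/nesym].
Qed.

Definition equated val n (p : positive * positive) :=
  [/\ val p.1 = val p.2, (p.1 < n)%positive & (p.2 < n)%positive].

Lemma merge_models k val t n q : models val t n -> List.Forall (equated val n) q ->
  models val (merge k t q) n.
Proof.
elim: k t q => [|k IH] t [|[x y] q] //= ht hq.
have [[/= exy xn yn] {}hq] : equated val n (x, y) /\ List.Forall (equated val n) q.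
  by inversion hq.
case: (x =? y)%positive; first exact: IH.
set a := Pos.min x y; set b := Pos.max x y; set s := fun z => _.
have an : (a < n)%positive by rewrite /a; case: (Pos.min_spec x y) => -[_ ->].
have bn : (b < n)%positive by rewrite /b; case: (Pos.max_spec x y) => -[_ ->].
have vab : val a = val b.
  rewrite /a /b; case: (Pos.lt_total x y) => [lt|[<-|lt]].
  - by rewrite Pos.min_l ?Pos.max_r //; exact: Pos.lt_le_incl.
  - by rewrite Pos.min_id Pos.max_id.
  - by rewrite Pos.min_r ?Pos.max_l //; exact: Pos.lt_le_incl.
have sn z : (z < n)%positive -> (s z < n)%positive by rewrite /s; case: ifP.
have vs z : val (s z) = val z.
  by rewrite /s; case: (Pos.eqb_spec z b) => [->|].
set row := (if PositiveMap.find b t is Some row then row else norow).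
have hrow g d : entry row g = Some d -> val d = r g (val a) /\ (d < n)%positive.
  rewrite /row; have := ht b g d; rewrite /look.
  case: (PositiveMap.find b t) => [x'|] h; last by case: (g).
  by move/h => [-> _ ?]; rewrite vab.
have hs p : equated val n p -> equated val n (s p.1, s p.2).
  by case=> e /sn h1 /sn h2; split=> //=; rewrite !vs.
have : models val (PositiveMap.remove b t) n /\
       List.Forall (equated val n) [seq (s p.1, s p.2) | p <- q].
  split; first exact: models_remove.
  by elim: hq => //= p q' /hs ? _ ?; constructor.
move: (PositiveMap.remove b t) (map _ q) => t1 q1.
rewrite /merge_edges; elim: gens t1 q1 => [|g gs IHg] t1 q1 [h1 h2] /=; first exact: IH.
case er : (entry row g) => [d|]; last exact: IHg.
have [ed dn] := hrow _ _ er.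
apply: IHg; split; first by apply: models_join => //; [exact: sn | rewrite vs].
case el : (look t1 a g) => [e|] //; constructor => //.
have [ee _ en] := h1 _ _ _ el.
by apply: (hs (d, e)); split=> //=; rewrite ed ee.
Qed.

Lemma walk_models val t n c w : models val t n -> (c < n)%positive ->
  let: (f, u) := walk t c w in
  (f < n)%positive /\ exists v, w = v ++ u /\ val f = wact v (val c).
Proof.
move=> h; elim: w c => [|g w IH] c cn /=; first by split=> //; exists [::].
case e: (look t c g) => [d|]; last by split=> //; exists [::].
have [ed _ dn] := h _ _ _ e.
have := IH _ dn; case: (walk t d w) => f u [fn [v [-> ef]]].
by split=> //; exists (g :: v); rewrite /= -ed.
Qed.

Definition modelled (st : state) := exists val,
  [/\ val xH = x0, models val st.1 st.2 & (1 < st.2)%positive].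

Lemma bridge_models val t n f w b : val xH = x0 -> models val t n -> (1 < n)%positive ->
  (f < n)%positive -> (b < n)%positive -> val b = wact w (val f) ->
  modelled (bridge t n f w b).
Proof.
elim: w val t n f => [|g [|h w] IH] val t n f v1 ht n1 fn bn /= e.
- exists val; split=> //=; apply: merge_models => //.
  by constructor=> //; split.
- exists val; split=> //=.
  case el: (look t b g) => [d|]; last exact: models_join.
  have [ed _ dn] := ht _ _ _ el.
  apply: merge_models; first exact: models_put.
  by constructor=> //; split=> //=; rewrite ed e rK.
(* The fresh name denotes the point that the new edge forces. Names below [n] keep their values, so
   the old entries stay valid. *)
- pose val' c := if (c =? n)%positive then r g (val f) else val c.
  have old c : (c < n)%positive -> val' c = val c.
    by rewrite /val'; case: Pos.eqb_spec => // -> /Pos.lt_irrefl.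
  have new : val' n = r g (val f) by rewrite /val' Pos.eqb_refl.
  have lt_succ c : (c < n)%positive -> (c < Pos.succ n)%positive.
    by move=> cn; apply: Pos.lt_trans cn (Pos.lt_succ_diag_r n).
  apply: (IH val').
  + by rewrite old.
  + apply: models_join; first by
      move=> c g' d /ht [ed cn dn]; rewrite !old //; split=> //; exact: lt_succ.
    * exact: lt_succ.
    * exact: Pos.lt_succ_diag_r.
    * by rewrite new old.
  + exact: lt_succ.
  + exact: Pos.lt_succ_diag_r.
  + exact: lt_succ.
  + by rewrite new old.
Qed.

(** Only the point [val c] has to be fixed by [w]. This covers both the relators, which hold at
    every point, and the subgroup generators, which are applied at [x0] alone. *)
Lemma fill_models val st c w : val xH = x0 -> models val st.1 st.2 -> (1 < st.2)%positive ->
  wact w (val c) = val c -> modelled (fill st c w).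
Proof.
case: st => t n /= v1 ht n1 hw; have mst : modelled (t, n) by exists val.
rewrite /fill; case: ifP => // /andP[/Pos.ltb_lt cn _].
have := walk_models w ht cn; case: (walk t c w) => f u [fn [v [ew ef]]].
have := walk_models (rev u) ht cn; case: (walk t c (rev u)) => b u' [bn [v' [eu eb]]].
apply: (bridge_models v1 ht n1 fn bn).
rewrite ef; apply: (wact_inj rK (w := rev v')).
rewrite eb (wact_revK rK) -!wact_cat -rev_cat -eu revK.
by rewrite -ew hw.
Qed.

Lemma fill_modelled st c w : holds w -> modelled st -> modelled (fill st c w).
Proof. by move=> hw [val [v1 ht n1]]; exact: fill_models v1 ht n1 (hw _). Qed.

Lemma hlt_modelled rels k c st : (forall w, List.In w rels -> holds w) -> modelled st ->
  modelled (hlt rels k c st).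
Proof.
move=> h; elim: k c st => //= k IH c st hst; case: ifP => // _; apply: IH.
elim: rels h st hst => //= w rels IHr h st hst.
by apply: IHr => [w' ?|]; [apply: h; right | apply: fill_modelled => //; apply: h; left].
Qed.

Variables (R : seq relator) (S : seq word).
Hypothesis holdsR : satisfies r R.
Hypothesis fixS : forall w, List.In w S -> wact w x0 = x0.

Lemma start_modelled : modelled (start S).
Proof.
have : exists val, [/\ val xH = x0, models val (PositiveMap.add xH norow (PositiveMap.empty row)) 2
   & (1 < 2)%positive].
  exists (fun _ => x0); split=> // c g d; rewrite /look.
  have [->|ne] := Pos.eq_dec c 1; first by rewrite PositiveMap.gss; case: g.
  by rewrite PositiveMap.gso // PositiveMap.gempty.
rewrite -/(modelled (_, _)) /start; move: (_, _) => st.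
elim: S fixS st => //= w S' IH hS st [val [v1 ht n1]].
apply: IH => [w' ?|]; first by apply: hS; right.
by apply: (fill_models v1 ht n1); rewrite v1; apply: hS; left.
Qed.

Lemma enumerate_models steps k : exists n val,
  val xH = x0 /\ models val (enumerate R S steps k) n.
Proof.
suff [val [v1 h _]] : modelled (hlt (map relword R) k xH
    (foldl (do_step (flatten (map rotations (R ++ involutions)))) (start S) steps)).
  by eexists _, val; split; last exact: h.
apply: hlt_modelled => [w /List.in_map_iff[u [<- /holdsR]]//|].
set ws := flatten _.
have hws w : List.In w ws -> holds w.
  rewrite /ws; have : forall u, List.In u (R ++ involutions) -> holds (relword u).
    move=> u /List.in_app_iff [/holdsR//|].
    rewrite /involutions /= => H; have [g ->] : exists g, u = ([:: g], 2).
      by case: H => [<-|[<-|[<-|[<-|]]]] //; eexists.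
    by move=> x /=; rewrite rK.
  elim: (R ++ involutions) => //= u s IH h /List.in_app_iff [].
    by apply: holds_rotations => //; apply: h; left.
  by apply: IH => u' ?; apply: h; right.
elim: steps (start S) start_modelled => //= p steps IH st hst; apply: IH.
rewrite /do_step; case: (low_bits 6 p) => i c; apply: fill_modelled => //.
(* An index beyond the list selects the empty word, which holds trivially. *)
have [lt|le] := ltnP i (size ws); last by rewrite nth_default.
apply: hws; elim: (ws) i lt => [|w s IHs] [|i] //= lt; first by left.
by right; apply: IHs.
Qed.

(** Every edge is a true equation, so a trace that returns to coset 1 is an identity at [x0],
    however incomplete the table is. *)
Lemma enumerate_fixes steps k w :
  fixes_one (enumerate R S steps k) w -> wact w x0 = x0.
Proof.
have [n [val [v1 h]]] := enumerate_models steps k; move: (enumerate _ _ _ _) h => t h.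
(* The bound is raised to exceed 1, where the trace starts. *)
have {}h : models val t (Pos.succ n).
  move=> c g d /h [? cn dn]; split=> //; by apply: Pos.lt_trans (Pos.lt_succ_diag_r n).
have := walk_models (c := 1) w h (Pos.lt_1_succ n).
rewrite /fixes_one; case: (walk t 1 w) => f u [_ [v [-> ef]]] /andP[/Pos.eqb_eq f1 /nilP ->].
by rewrite cats0 -v1 -ef f1.
Qed.

Definition finite_orbit (J : gen -> bool) :=
  exists l : list Om, forall w, all J w -> List.In (wact w x0) l.

(** The values of the rows include [x0] and are stable under the generators in [J]. Several rows may
    denote one point, so this is only an upper bound for the orbit. *)
Lemma enumerate_finite J steps k :
  closed_under J (enumerate R S steps k) -> finite_orbit J.
Proof.
have [n [val [v1 h]]] := enumerate_models steps k; move: (enumerate _ _ _ _) h => t h.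
case/andP=> t1 ht; exists [seq val cx.1 | cx <- PositiveMap.elements t] => w.
suff H c : PositiveMap.mem c t -> all J w ->
    List.In (wact w (val c)) [seq val cx.1 | cx <- PositiveMap.elements t].
  by rewrite -v1; exact: H.
elim: w c => [|g w IH] c; rewrite PositiveMap.mem_find.
  case e: (PositiveMap.find c t) => [x|] // _ _ /=.
  exact: (List.in_map (fun cx => val cx.1) _ (c, x) (PositiveMap.elements_correct _ _ e)).
case e: (PositiveMap.find c t) => [x|] //= _ /andP[Jg Jw].
have {}ht : all (fun g => J g ==>
         if entry x g is Some d then PositiveMap.mem d t else false) gens.
  have := PositiveMap.elements_correct _ _ e.
  elim: (PositiveMap.elements t) ht => // cx s IHs /andP[h1 h2] [E|].
    by rewrite E in h1.
  exact: IHs.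
have: J g ==> (if entry x g is Some d then PositiveMap.mem d t else false).
  by case: (g) ht; case/and5P.
rewrite Jg /=; case ex: (entry x g) => [d|] // dt.
have [<- _ _] : [/\ val d = r g (val c), (c < n)%positive & (d < n)%positive].
  by apply: h; rewrite /look e.
exact: IH.
Qed.

End Soundness.

Transparent merge_fuel.

(** * Blocks and conjugacy classes *)

Section Blocks.
Variables (Om : Type) (r : gen -> Om -> Om).
Hypothesis rK : forall g, involutive (r g).

Definition finite_pred (T : Type) (A : T -> Prop) := exists l, forall y, A y -> List.In y l.

(** Since [r g] is an involution, this preimage is also the image of [A]: the generators act on
    subsets by translation. *)
Definition preact (g : gen) (A : Om -> Prop) : Om -> Prop := fun y => A (r g y).

Lemma preactK g : involutive (preact g).
Proof. by move=> A; apply: funext => y; rewrite /preact rK. Qed.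

Lemma wact_preact w A : wact preact w A = fun y => A (wact r (rev w) y).
Proof.
elim: w A => //= g w IH A; rewrite IH; apply: funext => y.
by rewrite rev_cons -cats1 wact_cat.
Qed.

Lemma preact_holds w : holds r w -> holds preact w.
Proof.
move=> h A; rewrite wact_preact; apply: funext => y.
by rewrite (holds_rev rK h).
Qed.

(** The translates of [A] cover the orbit of [x0], and each is finite, being the image of [A] under
    a bijection. *)
Lemma finite_blocks x0 (A : Om -> Prop) (l : list (Om -> Prop)) :
  A x0 -> finite_pred A -> (forall w, List.In (wact preact w A) l) ->
  finite_orbit r x0 predT.
Proof.
move=> Ax0 [m hm] hl.
(* The list [l] may contain infinite sets besides the translates; excluded middle sorts them out. *)
have [n hn] : exists n, forall B, List.In B l -> finite_pred B -> forall y, B y -> List.In y n.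
  elim: l {hl} => [|B l [n hn]]; first by exists [::].
  have [[k hk]|nB] := pselect (finite_pred B).
    exists (k ++ n) => B' [<-|lB'] fB' y By; apply: List.in_or_app.
      by left; apply: hk.
    by right; apply: hn By.
  by exists n => B' [<-|lB'] // fB'; apply: hn.
exists n => w _; apply: (hn _ (hl w)); last by rewrite wact_preact wact_revK.
exists (List.map (wact r w) m) => y; rewrite wact_preact => /hm /(List.in_map (wact r w)).
by rewrite wactK_rev.
Qed.

(* Cosets are the translates of the orbit of x0 under the generators in J, so
   the enumeration takes place in the power set. *)
Lemma finite_cosets (J : gen -> bool) (R : seq relator) steps k x0 :
  satisfies r R ->
  finite_orbit r x0 J ->
  closed_under predT (enumerate R [seq [:: g] | g <- gens & J g] steps k) ->
  finite_orbit r x0 predT.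
Proof.
move=> hR [m hm] hc.
pose A y := exists2 u, all J u & y = wact r u x0.
have fixA w : List.In w [seq [:: g] | g <- gens & J g] -> wact preact w A = A.
  have stab g y : J g -> A y -> A (r g y).
    move=> Jg [u Ju ->]; exists (rcons u g); first by rewrite all_rcons Jg.
    by rewrite -cats1 wact_cat.
  move/List.in_map_iff => [g [<- hg]]; have {hg} Jg : J g.
    by elim: gens hg => //= h s IH; case: ifP => [Jh [<-|/IH]|_ /IH].
  apply: funext => y; apply: propext; rewrite /= /preact; split; last exact: stab.
  by move/(stab _ _ Jg); rewrite rK.
have [l hl] := enumerate_finite (@preactK) (x0 := A) (R := R)
   (fun u hu => preact_holds (hR u hu)) fixA hc.
apply: (@finite_blocks x0 A l) => [|| w]; [by exists [::]| | exact: hl (all_predT w)].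
by exists m => y [u Ju ->]; apply: hm.
Qed.

End Blocks.

Section InvolutionClass.
Variables (Om : Type) (C : (Om -> Om) -> Prop).
Hypothesis CK : forall f, C f -> involutive f.
Hypothesis CJ : forall f g, C f -> C g -> C (f \o g \o f).
Hypothesis Cfin : finite_pred C.

Definition compose (s : seq (Om -> Om)) (x : Om) : Om := foldr (fun f y => f y) x s.

Lemma compose_cat s1 s2 x : compose (s1 ++ s2) x = compose s1 (compose s2 x).
Proof. exact: foldr_cat. Qed.

(* Dietzmann's lemma for involutions: a repeated factor f ... f is absorbed by
   conjugating the factors in between. *)
Lemma compose_shorten : exists n, forall s, List.Forall C s ->
  exists2 s', List.Forall C s' /\ size s' <= n & compose s =1 compose s'.
Proof.
have [l hl] := Cfin; exists (size l) => s.
have [k] := ubnP (size s); elim: k s => // k IH s; rewrite ltnS => sk hs.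
have [le|lt] := leqP (size s) (size l); first by exists s.
have : ~ List.NoDup s.
  move=> nd; have incl : List.incl s l.
    by move=> f fs; apply: hl; move/List.Forall_forall: hs; apply.
  have := List.NoDup_incl_length nd incl.
  by move/leP; rewrite leqNgt => /negP; apply.
have dec : ListDec.decidable_eq (Om -> Om) by move=> f g; exact: EM.
case/(ListDec.not_NoDup dec) => f [s1 [s2 [s3 es]]].
move: hs sk; rewrite es.
case/List.Forall_app => h1 /List.Forall_cons_iff[Cf /List.Forall_app[h2]].
case/List.Forall_cons_iff => _ h3 sk.
pose s2' := [seq f \o g \o f | g <- s2].
have e2 x : compose (f :: s2 ++ f :: s3) x = compose (s2' ++ s3) x.
  rewrite /= !compose_cat /= /s2'; move: (compose s3 x) => y.
  elim: s2 {es h2 sk s2'} => /= [|g s2 <-]; first by rewrite (CK Cf).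
  by rewrite (CK Cf).
have [||s' hs' e'] := IH (s1 ++ s2' ++ s3).
- apply: leq_trans sk; rewrite !size_cat /= size_cat /= size_map.
  by rewrite ltn_add2l addnS ltnS leqnSn.
- apply/List.Forall_app; split=> //; apply/List.Forall_app; split=> //.
  rewrite /s2'; elim: {es e2 s2' sk} s2 h2 => // g s2 IHs /List.Forall_cons_iff[Cg /IHs h].
  by constructor=> //; apply: CJ.
exists s' => // x; rewrite -e' !(compose_cat s1); congr compose; exact: e2.
Qed.

Lemma finite_compose x :
  finite_pred (fun y => exists2 s, List.Forall C s & y = compose s x).
Proof.
have [n hn] := compose_shorten; have [l hl] := Cfin.
have [m hm] : exists m, forall s, List.Forall C s -> size s <= n ->
    List.In (compose s x) m.
  elim: {hn} n => [|n [m hm]].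
    by exists [:: x] => -[|//] _ _; left.
  exists (m ++ List.flat_map (fun f => List.map f m) l) => s hs sn.
  apply/List.in_app_iff.
  case: s hs sn => [|f s] hs sn; first by left; apply: hm.
  case/List.Forall_cons_iff: hs => Cf hs; right; apply/List.in_flat_map.
  exists f; split; first exact: hl.
  by apply: List.in_map; apply: hm.
by exists m => y [s /hn[s' [hs' n'] e] ->]; rewrite e; apply: hm.
Qed.

End InvolutionClass.

(** * Presentations, and the certificates for type [5,3,5] *)

Definition coxeter (p q r : nat) : seq relator :=
  [:: (wd "13", 2); (wd "03", 2); (wd "02", 2);
      (wd "23", r); (wd "12", q); (wd "01", p)].
Definition locproj (p q r h : nat) : seq relator :=
  rcons (coxeter p q r) (wd "123", h).

(* zw is the central inversion of the facet, and cw equals r3 zw r3 zw r3 in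
   [5,3,5].  The word dw also commutes with zw; adding it to the subgroup makes
   the enumeration of the 1463 cosets almost free of coincidences. *)
Definition zw : word := power (wd "012") 5.
Definition cw : word := wd "32101021012321012010123".
Definition dw : word := wd "321010321010210123210102101232101232".

(* Both certificates were obtained by tracing back which steps of a large
   enumeration are needed for the word in question to close up. *)
Definition commutation_steps : seq positive := [::
94; 160; 222; 288; 354; 416; 478; 544; 610; 676; 738; 800; 862; 928; 990; 
1058; 1120; 1182; 1248; 1314; 1380; 1442; 1504; 1540; 1673; 1813; 584; 164; 
2594; 2656; 2718; 2784; 2846; 2914; 2976; 3038; 3104; 3170; 3236; 3298; 3360; 
3422; 3488; 3524; 3657; 3797; 4097; 4433; 4616; 4896; 4932; 5065; 2528; 5316; 
5449; 5589; 5905; 6280; 6496; 6626; 6692; 6754; 6820; 6882; 6944; 7006; 7040; 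
7185; 7368; 7568; 7745; 7953; 8136; 2210; 8449; 8529; 8776; 2501; 9088; 9097; 
9168; 9224; 9280; 9425; 9608; 9808; 9985; 10193; 10376; 10576; 328; 11029; 
3457; 11345; 11464; 11552; 11589; 11657; 11845; 11977; 4865; 12241; 96; 
12510; 12561; 12680; 12960; 13086; 13154; 13216; 13278; 13344; 13410; 13476; 
13538; 13600; 13662; 13728; 13790; 13858; 13920; 13982; 14048; 14114; 14180; 
14242; 14304; 14366; 14432; 14498; 14558; 14628; 14690; 14752; 14814; 14880; 
14942; 15010; 15072; 15134; 15204; 15266; 15328; 15390; 15456; 15518; 15588; 
15650; 15712; 15774; 15844; 15906; 15968; 16030; 16064; 16209; 3529; 16672; 
16734; 16800; 16866; 16932; 16994; 17056; 17093; 17161; 17365; 17665; 9364; 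
18129; 18276; 18338; 18400; 18462; 18528; 18590; 18660; 18722; 18784; 18846; 
18912; 18974; 19044; 19106; 19168; 19230; 19296; 19358; 19428; 19490; 19552; 
19614; 19684; 19746; 19808; 19870; 19936; 20004; 20066; 20096; 12884; 20361; 
20432; 20488; 20565; 20689; 20964; 21154; 21185; 21265; 7108; 21769; 193; 
21905; 22024; 2177; 22161; 14436; 22562; 22624; 22686; 22752; 22820; 22882; 
22944; 23006; 23072; 23134; 23204; 23266; 23328; 23390; 23456; 23518; 23586; 
23616; 23761; 12489; 24144; 24200; 24405; 24593; 24712; 24784; 24897; 24977; 
25096; 22112; 25246; 25314; 25376; 25438; 25504; 25570; 25636; 25698; 25760; 
25822; 25888; 25954; 26014; 26080; 26142; 26208; 26274; 26340; 26402; 26464; 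
26526; 26592; 26658; 26724; 26786; 26848; 26910; 26944; 27089; 20613; 27465; 
20545; 27729; 27848; 27984; 28161; 28369; 19589; 28745; 28805; 12580; 29026; 
29088; 29150; 29216; 29278; 29346; 29408; 29470; 29536; 29602; 29668; 29730; 
29796; 29858; 29920; 29982; 30048; 30110; 30178; 30240; 30308; 30370; 30432; 
30494; 30528; 21856; 30814; 30884; 30946; 31008; 31070; 31140; 31202; 31264; 
31326; 31392; 31460; 31522; 31552; 31697; 31880; 31104; 32273; 32392; 20936; 
32517; 32649; 32709; 32777; 17797; 32896; 32528; 33089; 33297; 33480; 33744; 
33857; 34065; 11209; 34437; 34569; 34709; 20388; 35362; 35424; 35486; 35552; 
35614; 35682; 35713; 35793; 36040; 14533; 36361; 36437; 6308; 36770; 36832; 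
36894; 36960; 37022; 37090; 37152; 37220; 37282; 37344; 37406; 37441; 37521; 
37768; 37968; 12485; 38345; 38421; 38673; 38792; 30209; 38929; 39048; 7688; 
39237; 39305; 39360; 19905; 6469; 39689; 33800; 22788; 40009; 40085; 6560; 
40420; 40482; 40544; 40606; 40672; 40740; 40802; 40864; 40926; 40992; 41054; 
41124; 41186; 41248; 41310; 41376; 41438; 41508; 41570; 41632; 41694; 41760; 
41797; 35108; 42082; 42144; 42206; 42272; 42334; 42404; 42466; 42528; 42590; 
42656; 42724; 42786; 42848; 42910; 42976; 43017; 43077; 43273; 43413; 24480; 
44062; 44130; 44192; 44254; 44320; 44386; 44452; 44514; 44576; 44638; 44704; 
44766; 44834; 44896; 44958; 45024; 45090; 45156; 45218; 45280; 45342; 45408; 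
45444; 45577; 45728; 45854; 45888; 9024; 46242; 46368; 46430; 46496; 46564; 
46626; 46688; 46750; 46816; 46878; 46946; 47008; 47076; 47138; 47169; 36320; 
47454; 47524; 47586; 47648; 47710; 47776; 47812; 47945; 42309; 48201; 32449; 
48337; 48584; 19521; 22657; 48977; 49160; 46148; 49545; 46548; 49669; 49984; 
49993; 50128; 23497; 50373; 50441; 8992; 50596; 50658; 50688; 17925; 50953; 
51029; 51345; 51720; 51909; 52041; 23109; 52297; 52373; 52553; 52677; 52809; 
52949; 53249; 17280; 53777; 53896; 39765; 54213; 54281; 54405; 32913; 54728; 
54816; 54882; 54948; 55010; 55072; 55134; 55169; 3397; 55433; 55509; 4229; 
55808; 55817; 55952; 56008; 273; 56392; 54856; 5216; 56645; 56713; 38880; 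
57060; 57122; 57184; 57246; 57312; 57374; 57442; 57472; 57617; 57800; 51968; 
36708; 58338; 58400; 58468; 58530; 58592; 58654; 58720; 58757; 56608; 59012; 
59145; 59072; 59473; 59592; 4832; 59849; 59909; 60105; 60245; 60609; 60881; 
61064; 61264; 61441; 48160; 61765; 61824; 61833; 62096; 62216; 56213; 62601; 
45972; 45961; 63109; 28308; 63361; 63697; 37121; 64081; 64200; 11077; 64329; 
64453; 64610; 64736; 64798; 64864; 64905; 41029; 65152; 65161; 65296; 65352; 
65557; 18177; 65809; 65928; 13860; 66082; 66144; 66180; 66313; 18949; 66569; 
66645; 66881; 66961; 261; 67136; 67145; 18565; 67337; 40708; 67529; 67605; 
67874; 67936; 68004; 68066; 68128; 68190; 68256; 68296; 68421; 68553; 61952; 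
68881; 15109; 69129; 69205; 69441; 69521; 69640; 52752; 69761; 69841; 69960; 
31620; 70153; 58914; 70304; 70366; 70432; 70500; 70562; 70624; 70686; 70752; 
70814; 70882; 70912; 71057; 5408; 71460; 71522; 71584; 71646; 71712; 71774; 
71842; 71904; 71966; 72032; 72098; 72164; 72226; 72292; 72354; 72416; 72478; 
72544; 72606; 72676; 72738; 72800; 72862; 72928; 72996; 73058; 73120; 73182; 
73216; 73361; 56480; 73758; 73826; 73888; 73950; 73985; 74065; 74312; 73925; 
74633; 74709; 74961; 75208; 46857; 19205; 18248; 34512; 75784; 75856; 75969; 
62688; 76228; 76361; 76485; 76617; 76757; 77073; 77448; 50833; 77832; 41601; 
78161; 41316; 78562; 78624; 78686; 78752; 78789; 78857; 41413; 79177; 79253; 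
18881; 79569; 79688; 25184; 79817; 13777; 80072; 79957; 14152; 80325; 14280; 
76576; 80542; 80608; 80676; 80738; 80800; 80862; 80896; 47745; 81169; 81288; 
67280; 81416; 81621; 81809; 81928; 62593; 82065; 82184; 65762; 82304; 78408; 
72674; 82720; 82782; 82852; 82914; 82980; 83042; 83104; 83166; 83232; 83294; 
83362; 83424; 83486; 83556; 83618; 83649; 69; 83904; 83913; 83984; 84040; 
84117; 84241; 84360; 67080; 84516; 84578; 84609; 84689; 84936; 26148; 85282; 
85313; 85393; 85640; 54537; 85965; 85952; 86404; 86549; 77648; 39877; 87296; 
87305; 87504; 87560; 6025; 87877; 87945; 20164; 27294; 88352; 88396; 75717; 
89024; 89033; 89232; 89288; 89493; 89665; 89745; 89864; 59776; 90065; 90248; 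
90464; 90590; 90658; 90724; 90786; 90848; 90885; 90953; 82466; 91296; 91358; 
91392; 26181; 91657; 62884; 91810; 91872; 91908; 92041; 69728; 92324; 92386; 
92448; 92510; 92576; 92612; 92745; 92684; 93248; 35265; 87428; 93769; 45449; 
62785; 94033; 94152; 2249; 94277; 94345; 201; 94485; 94737; 94856; 94928; 
95105; 95185; 95368; 59360; 95684; 95808; 95817; 48288; 96222; 96256; 96401; 
96584; 63966; 96896; 97041; 97224; 2825; 35141; 97609; 28612; 97801; 58016; 
98052; 98185; 52609; 98449; 98625; 98833; 99016; 40401; 21730; 99393; 99473; 
99720; 27336; 20737; 100113; 100232; 35908; 100425; 56853; 100617; 100869; 
101001; 79522; 101280; 101317; 101385; 99984; 56581; 101952; 101961; 102032; 
102088; 93728; 102242; 102308; 102370; 102432; 102494; 102564; 102626; 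
102657; 102737; 102984; 94209; 62882; 103488; 103633; 103816; 90817; 42625; 
104209; 104328; 104400; 81376; 104606; 104652; 104960; 53984; 105421; 63369; 
104581; 106121; 69697; 106257; 106376; 98632; 60681; 30848; 106833; 106952; 
72901; 107072; 107081; 107216; 107336; 107424; 107492; 107554; 107584; 
107729; 10120; 4037; 108224; 108233; 108368; 108424; 108629; 40321; 108881; 
109000; 106688; 106501; 109312; 100501; 109705; 109765; 109897; 47685; 
110153; 103330; 110273; 100677; 53005; 110720; 110788; 53505; 110929; 111048; 
137; 111189; 111441; 111560; 111632; 111745; 111825; 111944; 97685; 112261; 
112320; 112329; 112464; 112584; 112661; 87681; 84417; 113233; 105412; 113737; 
91841; 106053; 113920; 113929; 114128; 58257; 73630; 114656; 114696; 114821; 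
56992; 115102; 115168; 115236; 115298; 115360; 115422; 115488; 115556; 
115618; 115649; 1060; 115938; 116000; 116068; 116130; 116192; 116254; 116320; 
116361; 70793; 83273; 58369; 116748; 116816; 117185; 117192; 117317; 117312; 
63941; 117577; 58436; 117769; 117845; 118081; 118161; 118280; 112709; 118409; 
83461; 118665; 83860; 23041; 108834; 119332; 119394; 119424; 38849; 106772; 
119753; 119813; 119945; 48069; 120192; 73544; 120400; 57540; 120649; 120725; 
120961; 121041; 121160; 121281; 82000; 121665; 121745; 121864; 121936; 42708; 
122117; 122249; 122325; 92933; 59653; 101697; 122769; 23185; 123208; 123405; 
73473; 124121; 42885; 124233; 19333; 124480; 124489; 63880; 124613; 124681; 
25928; 116485; 124992; 125001; 125264; 7685; 125577; 122181; 125824; 125833; 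
125904; 125960; 126037; 126161; 126408; 91968; 12360; 54081; 35042; 126976; 
127121; 127304; 14921; 126818; 127712; 127748; 127881; 33541; 128137; 32704; 
128465; 107296; 128734; 128800; 128841; 128901; 129097; 64649; 129365; 
129545; 17809; 129793; 12869; 129920; 129929; 130000; 114953; 114816; 130321; 
130440; 115137; 130705; 130824; 108688; 107976; 32085; 131345; 82757; 131913; 
131973; 132041; 132117; 132369; 132488; 107040; 132644; 132706; 132737; 
100324; 133026; 133057; 130056; 133333; 133457; 133576; 67413; 109410; 
133984; 134046; 134080; 134225; 134401; 46465; 134737; 134856; 66914; 135012; 
135074; 135136; 135198; 135264; 135301; 135369; 135557; 135680; 135689; 
135952; 130912; 136292; 136354; 136384; 136529; 136712; 134976; 109321; 
137168; 137224; 72994; 137380; 137442; 137504; 137566; 137600; 108741; 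
137865; 137989; 138121; 138261; 89952; 138916; 138978; 139044; 139106; 
139168; 139230; 139296; 139337; 92960; 139614; 139649; 114184; 101504; 80577; 
140177; 140296; 124608; 140497; 140616; 101648; 118529; 141073; 141320; 
87776; 141641; 141701; 141897; 142021; 6209; 62661; 142336; 142345; 142480; 
142600; 142688; 142724; 142857; 142981; 14592; 143313; 143432; 97504; 143588; 
143650; 143681; 102560; 143970; 144036; 144098; 144160; 144222; 144256; 
144401; 144584; 144784; 144961; 129868; 143761; 145672; 126853; 145993; 
146133; 45377; 146769; 137312; 146949; 63458; 147232; 147300; 147362; 147424; 
147486; 147521; 147601; 147848; 87840; 148196; 148258; 148320; 148382; 
148448; 148489; 35205; 148736; 97444; 148834; 148896; 148958; 149024; 149086; 
149154; 149216; 149252; 66528; 149534; 149600; 149640; 149765; 149760; 61313; 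
121376; 150277; 150345; 22725; 150656; 150665; 150736; 150792; 150880; 
150948; 151010; 151040; 151185; 151368; 43152; 151688; 150242; 152032; 
152094; 152164; 152226; 152257; 12289; 82944; 52229; 152777; 47429; 152960; 
152969; 153104; 153224; 58080; 153508; 153570; 153600; 92417; 41105; 127489; 
154129; 154376; 154576; 154753; 154978; 155072; 151685; 155328; 155337; 
155472; 99364; 155682; 155713; 155793; 156040; 6593; 156369; 156488; 119697; 
156680; 151872; 22366; 156960; 157028; 157090; 157156; 157218; 157280; 
157342; 157408; 157449; 157509; 62496; 157833; 146532; 158114; 158176; 
158244; 158306; 158336; 147201; 158609; 120085; 159010; 159296; 142549; 
159745; 29760; 159953; 156673; 155592; 153429; 46289; 160520; 122952; 160656; 
89568; 161032; 161157; 161289; 102176; 161540; 161673; 64512; 92240; 162056; 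
113566; 162400; 162462; 162530; 162596; 162658; 162689; 112032; 162974; 
163042; 163104; 163166; 163232; 163298; 163364; 163426; 163488; 163550; 
163616; 163682; 163742; 163808; 163876; 163938; 163968; 164113; 164296; 
164496; 164673; 114440; 164997; 165129; 123712; 163656; 155536; 55778; 
165796; 165858; 165920; 165982; 166048; 166088; 22408; 166341; 166409; 
166560; 166686; 166752; 166814; 166882; 166948; 167010; 167072; 167134; 
167168; 101761; 165598; 167584; 167625; 167685; 167881; 106592; 168164; 
168226; 168288; 168324; 168457; 57353; 168709; 168777; 110112; 168926; 
168992; 169033; 156225; 122633; 106464; 169572; 169634; 169696; 169732; 
169865; 110229; 170313; 170373; 170505; 153809; 170824; 100352; 171217; 
146888; 37649; 171464; 171457; 171793; 171976; 104096; 172324; 172386; 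
172416; 172561; 104000; 173009; 108165; 173376; 173385; 173584; 139969; 
158728; 174048; 174085; 174153; 174341; 162441; 161124; 174690; 174720; 
174865; 175048; 175248; 20625; 175624; 75924; 33096; 76100; 33416; 175617; 
175761; 175880; 63184; 176001; 63313; 69474; 176384; 176529; 176712; 47617; 
177041; 177160; 177232; 6529; 177425; 140736; 166793; 177797; 177865; 177941; 
90577; 178312; 178309; 178496; 178505; 178640; 178760; 178896; 103813; 
179273; 4194; 179424; 179486; 179556; 179618; 179684; 179746; 179808; 179870; 
179936; 179998; 180066; 180096; 180241; 180424; 2245; 180745; 18057; 180885; 
96080; 6052; 181410; 181476; 181538; 181600; 181662; 181728; 181769; 91537; 
35556; 182306; 182337; 178245; 137105; 182728; 50196; 54400; 183121; 183240; 
183328; 183368; 150161; 183688; 4945; 183809; 183889; 184008; 168085; 184329; 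
184645; 115457; 184913; 59744; 185092; 185225; 106181; 185472; 185481; 
185680; 132576; 185932; 186240; 174336; 147909; 186825; 183493; 176960; 
97749; 187457; 113797; 187776; 187785; 55689; 188037; 188105; 188181; 160272; 
116992; 188753; 188872; 131784; 173662; 189152; 189193; 82513; 158921; 
189573; 37001; 189701; 189769; 88164; 189922; 189984; 190046; 190112; 190174; 
190242; 190273; 190353; 148745; 190800; 190920; 145169; 20809; 13073; 191368; 
33236; 13448; 33348; 13576; 39829; 13969; 93705; 14160; 102336; 14353; 
102537; 14544; 49293; 144064; 102977; 36497; 49413; 144265; 66693; 191424; 
191433; 191621; 58769; 191873; 85534; 192160; 192228; 192290; 192352; 192414; 
192480; 192542; 192610; 192672; 192734; 192804; 192866; 192897; 107205; 
165088; 193310; 193378; 193408; 193553; 145872; 171653; 194176; 194185; 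
194384; 15045; 194624; 106561; 194769; 194888; 194945; 195025; 80480; 195486; 
195552; 195593; 195725; 196032; 196356; 51556; 196642; 196673; 194633; 
196944; 197064; 73857; 197201; 197320; 73745; 197448; 71444; 95112; 74116; 
76164; 71560; 95304; 74581; 197525; 71953; 197969; 198088; 198344; 72144; 
198608; 198913; 199121; 199304; 199504; 197445; 199808; 199817; 199888; 
199944; 200021; 200145; 200392; 140832; 200740; 200802; 200864; 200901; 
200969; 201173; 63497; 201797; 201865; 41217; 202001; 202120; 23460; 202274; 
202305; 69385; 128032; 202628; 110537; 202885; 203017; 88069; 203264; 203273; 
203469; 203456; 203524; 23944; 194440; 126848; 203985; 204104; 89605; 204233; 
195589; 204361; 204421; 204489; 204565; 204809; 204997; 201941; 202565; 
182692; 205602; 205664; 205726; 205792; 205833; 96581; 96004; 206281; 109072; 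
115397; 206528; 112129; 206673; 206792; 165697; 39633; 132958; 207200; 
207268; 207330; 207392; 207454; 207520; 207560; 203584; 207812; 207893; 
99221; 159076; 208098; 208160; 208228; 208290; 208352; 208414; 208448; 
174481; 30609; 137028; 209225; 209285; 209353; 209429; 35593; 209733; 209801; 
209877; 34953; 210309; 210377; 210453; 37188; 210953; 211029; 119249; 211400; 
6784; 211601; 211720; 136912; 134021; 212096; 212105; 104513; 212305; 212424; 
210245; 212553; 188500; 78048; 212894; 212962; 212992; 92549; 213248; 213257; 
213328; 213448; 123269; 213577; 213637; 213632; 51473; 213896; 59412; 58180; 
59528; 193365; 213889; 69957; 11904; 214225; 214344; 214480; 214657; 214792; 
215045; 199636; 215369; 215685; 192977; 100304; 216257; 80977; 216385; 
207173; 216704; 216721; 216840; 203744; 216964; 47364; 217216; 173905; 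
217544; 217541; 160418; 217985; 171153; 109201; 218504; 103377; 218888; 
218885; 219072; 128093; 219336; 219397; 158212; 219584; 219593; 148640; 
219870; 219940; 220002; 220032; 220177; 67905; 220561; 41865; 81696; 220894; 
220962; 221024; 221086; 221152; 221218; 221284; 221346; 221408; 221470; 
221536; 221576; 181156; 221858; 221920; 221956; 222089; 222229; 147017; 
181256; 118597; 223104; 223113; 42245; 223360; 223369; 223504; 223624; 18497; 
223761; 223880; 87813; 224000; 169665; 224081; 224200; 205377; 60561; 170368; 
224785; 66464; 225054; 225120; 225188; 225250; 225312; 225374; 225440; 
225502; 225572; 225634; 225696; 225758; 225828; 225890; 225920; 142289; 
226248; 219845; 226377; 1473; 226513; 226632; 226704; 226817; 49376; 226953; 
15749; 227209; 116613; 227337; 227424; 227486; 227552; 227589; 151968; 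
227874; 227940; 228002; 228032; 118789; 172292; 228425; 228485; 228553; 
197152; 228676; 228809; 228933; 224017; 98389; 229513; 160897; 229713; 15808; 
230161; 230280; 148613; 230400; 132297; 214025; 146565; 230729; 60485; 
230857; 210786; 231012; 231074; 231104; 182784; 231441; 231624; 141668; 
231970; 232000; 134408; 232272; 201570; 232640; 141536; 232905; 141584; 
61125; 233280; 233289; 233424; 233480; 233680; 119628; 91744; 234142; 234208; 
234245; 234304; 234313; 28004; 234722; 234752; 219040; 235020; 69022; 235680; 
235742; 235810; 235872; 235908; 219477; 236233; 236432; 109452; 167305; 
237189; 237248; 219665; 114245; 237705; 181893; 10629; 63241; 202385; 238216; 
238416; 238593; 197024; 238916; 195661; 239360; 200833; 239505; 239624; 
156288; 89473; 89285; 156429; 152069; 240201; 240261; 113361; 121992; 41733; 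
240576; 240585; 78469; 208129; 240849; 240968; 118849; 90004; 241157; 241216; 
241225; 241296; 241352; 241493; 67972; 241801; 241877; 18961; 242177; 75665; 
242504; 207112; 211300; 242850; 242912; 242974; 243008; 243153; 243336; 
243333; 181137; 243848; 207685; 243968; 93984; 244254; 244320; 244386; 
244452; 244514; 244576; 244613; 244681; 77193; 9361; 245064; 40404; 89092; 
40520; 161109; 245061; 245120; 245129; 245200; 245268; 54725; 245632; 194501; 
245769; 65681; 246024; 246021; 246208; 246217; 208001; 91141; 131085; 195904; 
246929; 220680; 247136; 247204; 247266; 247297; 59968; 247633; 247752; 
242949; 247872; 247881; 248016; 248072; 171397; 248393; 248517; 239428; 
112913; 248840; 248833; 249105; 67490; 249508; 249570; 249632; 249694; 
249760; 249801; 249861; 250057; 250181; 92864; 79105; 160329; 250757; 220832; 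
250884; 251008; 251017; 251269; 196753; 166213; 251776; 251785; 98065; 
252168; 229317; 205385; 69064; 252629; 240656; 252929; 97408; 56272; 253313; 
163870; 253472; 253538; 253604; 253666; 253728; 253790; 253856; 253922; 
253988; 254050; 254112; 254174; 254240; 254302; 254370; 254401; 254481; 
229256; 24065; 100864; 93666; 255264; 255326; 255392; 255432; 101573; 255680; 
255689; 127681; 256081; 256200; 187589; 256329; 256389; 256521; 252293; 
256768; 256777; 257040; 257160; 235392; 23365; 167744; 74889; 68357; 257856; 
222853; 215040; 258257; 154020; 258594; 258625; 258700; 258896; 258945; 
107009; 259153; 259272; 109760; 259473; 259592; 121489; 253393; 249029; 
260224; 260233; 260432; 226320; 260737; 12117; 261073; 156545; 261265; 
261512; 261712; 17605; 262080; 227072; 262289; 262472; 156485; 262784; 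
262793; 34693; 262912; 262921; 263056; 263124; 263441; 197577; 249472; 
114369; 213505; 143040; 237072; 264257; 216094; 264480; 264520; 148180; 
264773; 265088; 265097; 265237; 265489; 265608; 189512; 120201; 265808; 
126289; 266056; 266049; 197125; 266377; 187984; 266632; 159233; 91072; 90660; 
267234; 267265; 267340; 191680; 79489; 19664; 267912; 267909; 268224; 268233; 
268432; 15681; 268748; 39248; 241122; 269312; 186432; 269649; 10945; 269841; 
269960; 270032; 270145; 270225; 270344; 216912; 270529; 162001; 244929; 
50756; 271049; 271125; 40265; 232785; 50517; 231824; 272065; 272008; 272453; 
225172; 149185; 177698; 272736; 272798; 272864; 272932; 272994; 273056; 
273093; 92176; 273352; 273440; 273502; 273570; 273600; 201489; 26596; 274018; 
274048; 274193; 274376; 153873; 92300; 275136; 243605; 275337; 275525; 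
172744; 275792; 253022; 276192; 276228; 276361; 203400; 276613; 276681; 
41349; 276864; 276873; 276944; 277000; 277077; 240385; 277265; 277384; 
277456; 277588; 277833; 277893; 125701; 278025; 257413; 278281; 106629; 
278537; 85920; 278686; 278754; 278816; 278852; 278985; 279104; 173192; 
279440; 184577; 184517; 249920; 280081; 280200; 14789; 280457; 99781; 280704; 
245604; 280866; 280897; 280972; 281168; 281608; 281744; 80517; 282112; 
273481; 282181; 153360; 282369; 51273; 58049; 210825; 282629; 282697; 282757; 
174597; 282889; 282949; 3329; 283089; 283208; 283280; 283393; 223317; 68416; 
283874; 283936; 283998; 284032; 215817; 4805; 284425; 284549; 166336; 284881; 
285000; 253201; 285192; 160261; 285321; 143185; 107393; 77445; 285897; 87041; 
66833; 286216; 286213; 286400; 286409; 286544; 286600; 286805; 286977; 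
135632; 258952; 287301; 287312; 287489; 80837; 287817; 177544; 128960; 
288145; 261889; 288465; 288584; 288784; 64448; 289233; 40713; 289413; 189641; 
223185; 289736; 146377; 289861; 289993; 9221; 290249; 103949; 184457; 246656; 
78993; 161857; 258376; 177745; 291400; 154629; 291529; 102145; 149410; 
291872; 291934; 292000; 292062; 292130; 292196; 292258; 292320; 292356; 
113480; 191176; 213445; 267793; 292936; 222848; 267076; 126657; 293329; 
293576; 176200; 57985; 294033; 294152; 294224; 271624; 294480; 294600; 
247109; 294912; 83397; 295040; 295049; 295184; 295304; 89169; 295432; 293860; 
295522; 295552; 48645; 295817; 48832; 296145; 207493; 296393; 228689; 296641; 
245513; 296773; 296841; 296901; 275465; 208034; 297153; 207953; 297416; 
297413; 297600; 297609; 90468; 297890; 297921; 254792; 263369; 171424; 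
298402; 298468; 298530; 298592; 298654; 298688; 185736; 54021; 299072; 
156817; 299201; 206924; 146817; 53381; 299682; 299712; 152001; 299980; 34260; 
300425; 300496; 192212; 300741; 300800; 300809; 300885; 301137; 301256; 
253445; 7113; 301445; 279173; 290910; 301632; 183744; 101152; 302110; 302176; 
302213; 302281; 261001; 261125; 126089; 91333; 302857; 271745; 100229; 
303113; 165640; 303248; 8416; 303433; 303493; 303689; 286112; 303940; 304073; 
304197; 70593; 104832; 251220; 304713; 303237; 304905; 83520; 162261; 14341; 
305353; 305429; 252770; 305760; 305822; 305856; 306001; 306184; 235721; 
101205; 175952; 280713; 98765; 307072; 307204; 188425; 307472; 261573; 
307657; 228297; 113409; 204881; 80968; 232145; 308552; 128001; 30089; 308933; 
309001; 218757; 309129; 180640; 309384; 179461; 309641; 309701; 309769; 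
234064; 309889; 133701; 310089; 88192; 82276; 310498; 310529; 38280; 165760; 
310993; 311112; 94421; 21524; 94149; 94081; 276481; 156752; 312321; 312401; 
312520; 150529; 312785; 313032; 252881; 313352; 272001; 80769; 287898; 
285700; 60741; 212677; 313856; 313865; 314128; 103873; 16740; 314530; 314561; 
314641; 86673; 315080; 223584; 315230; 315296; 315337; 315397; 301065; 36545; 
289096; 315968; 289029; 288961; 185349; 316352; 316361; 316629; 271881; 
303361; 171336; 317456; 317569; 317649; 317768; 235845; 317888; 294921; 
211472; 318209; 175877; 306757; 318464; 318473; 318597; 318729; 252936; 
318981; 149905; 268816; 319361; 319368; 319557; 126533; 319753; 36617; 
195521; 320017; 99614; 320288; 320354; 320420; 320482; 320544; 320581; 
320649; 242316; 146309; 321225; 321349; 321481; 100684; 310353; 204937; 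
178177; 322321; 311168; 8837; 322697; 171717; 322816; 187393; 206465; 223968; 
323042; 323108; 323170; 323201; 53441; 319941; 323529; 318434; 323648; 87204; 
323938; 323968; 237576; 156123; 324356; 126921; 239825; 54592; 324497; 98693; 
324672; 324681; 324752; 309696; 279429; 325001; 198025; 95632; 325384; 
198804; 325577; 199108; 325833; 120389; 18437; 326025; 47500; 270341; 270273; 
256384; 326737; 220801; 251480; 139589; 327104; 224283; 327176; 327237; 
70401; 153157; 149449; 322961; 292992; 327761; 282825; 328141; 143572; 
264264; 328837; 259912; 109092; 329186; 329217; 157120; 329553; 329672; 
329744; 327313; 329992; 330064; 330177; 330257; 330376; 252689; 330504; 
330497; 203136; 330628; 330752; 330900; 70725; 331328; 307973; 316233; 
292624; 171585; 100745; 331973; 230409; 332112; 193289; 62929; 332424; 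
332421; 332480; 332489; 332560; 332616; 266837; 73157; 333120; 235989; 
333253; 333312; 333321; 333392; 140613; 333632; 333641; 302469; 151648; 
333961; 334085; 131841; 177989; 334464; 244164; 334729; 249669; 249601; 
147461; 335113; 58953; 324808; 93120; 165380; 322513; 288705; 330594; 335840; 
335877; 335936; 152657; 179220; 213969; 336456; 332693; 238997; 326272; 
221889; 336972; 337040; 337345; 337352; 337477; 48800; 337636; 337698; 
337760; 337822; 337888; 337924; 227269; 246352; 338312; 218340; 338658; 
338724; 338786; 338848; 338910; 338976; 339017; 339077; 115077; 56961; 55380; 
122697; 223712; 339684; 339746; 339777; 257408; 304965; 257873; 260168; 
69889; 230618; 335301; 323468; 230656; 44745; 177345; 318289; 341128; 176709; 
341276; 341384; 319425; 341445; 319692; 319616; 50248; 341765; 341833; 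
149961; 169548; 340424; 193736; 342597; 319680; 252361; 218960; 343169; 
46981; 343296; 203648; 969; 200081; 343688; 303429; 343753; 343877; 344009; 
260488; 159113; 323589; 286853; 139461; 8069; 69381; 229129; 142080; 174400; 
220100; 345417; 150932; 19845; 345600; 345609; 136268; 171024; 148112; 
184449; 247185; 344521; 346701; 244049; 344389; 144197; 347337; 306625; 
305665; 347537; 241557; 285189; 347977; 32389; 348233; 327624; 203777; 
228236; 245385; 52485; 349065; 46545; 349320; 349313; 349509; 349696; 218057; 
205441; 199560; 183012; 350178; 350208; 350353; 47321; 328928; 350793; 
204196; 351074; 351105; 133841; 351368; 351361; 188485; 351552; 351561; 
75593; 138048; 351953; 264901; 352137; 41484; 34312; 352656; 322825; 352848; 
352904; 75089; 353032; 198740; 293953; 259905; 320768; 349904; 189509; 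
189441; 309845; 272837; 354240; 354249; 203717; 188997; 212421; 296257; 
243265; 264965; 354944; 290753; 355089; 325961; 131205; 296716; 289920; 
283973; 274760; 138697; 112965; 356169; 173704; 265728; 352576; 356612; 
356672; 234640; 194885; 356928; 166613; 230621; 357316; 195092; 357385; 
71316; 106949; 357769; 2309; 357888; 314952; 304773; 358144; 358153; 358416; 
339236; 358754; 358784; 358929; 359112; 359312; 359489; 72769; 359825; 
359944; 360016; 360129; 210497; 343441; 216337; 360584; 46405; 150597; 
360768; 360777; 336264; 361040; 339921; 361288; 361488; 181065; 338688; 
354384; 362056; 315593; 127301; 362313; 10900; 362441; 263825; 362632; 71240; 
306384; 362888; 210565; 363209; 161413; 161408; 190864; 298629; 298561; 
241681; 363905; 346784; 364190; 364256; 364297; 364357; 345376; 364706; 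
364772; 364834; 364865; 280336; 269249; 365393; 328960; 6981; 365696; 151568; 
294597; 365888; 29257; 68688; 366152; 216008; 366288; 366401; 293637; 366601; 
366661; 315073; 302149; 366848; 115848; 366981; 259797; 340868; 367305; 
200724; 120513; 65345; 365512; 328384; 368145; 368264; 143113; 107333; 
368576; 251148; 327248; 368961; 368968; 5185; 195393; 123904; 311689; 205253; 
369801; 313115; 254281; 370053; 370121; 244997; 18001; 370440; 91717; 370569; 
143504; 370753; 316497; 370952; 89617; 257609; 371141; 65541; 357633; 285072; 
371521; 264645; 79045; 371721; 36869; 371913; 11840; 372241; 372360; 292613; 
337861; 372544; 372553; 210113; 162961; 372872; 45076; 163336; 45188; 163464; 
45525; 163857; 165505; 244297; 45841; 253584; 373000; 244480; 63120; 253777; 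
373185; 244809; 238096; 253968; 373569; 254161; 373768; 256272; 374017; 
235200; 251592; 82256; 374529; 374609; 208529; 273161; 152128; 186632; 63012; 
375394; 375425; 321744; 186564; 311109; 322633; 208776; 114305; 237786; 
328709; 217601; 328581; 217792; 143620; 376201; 143748; 17413; 376384; 
376393; 376528; 376648; 342400; 331081; 222665; 236361; 240533; 377289; 
377349; 377417; 254081; 377625; 65665; 373904; 377985; 56901; 305605; 378185; 
217744; 88576; 136731; 378568; 378629; 211781; 11009; 337536; 344905; 58825; 
5988; 379170; 379201; 379276; 119312; 169378; 379616; 379653; 148357; 220293; 
218625; 271813; 170053; 380288; 169488; 380361; 260097; 34305; 311817; 
137541; 41033; 380997; 38601; 227013; 242709; 381317; 381376; 279617; 205513; 
381712; 152529; 381960; 376329; 325920; 382174; 382240; 382280; 382357; 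
382416; 215305; 382608; 215808; 382801; 382984; 383120; 324616; 36993; 32160; 
383560; 314312; 383824; 286721; 249352; 371273; 9669; 384512; 384521; 276829; 
384836; 384849; 384905; 105152; 284997; 385097; 285121; 348122; 145925; 
348368; 146433; 266338; 385600; 335237; 385856; 339525; 386048; 153492; 
229569; 229637; 386505; 289481; 301513; 361153; 68225; 362001; 300240; 
292688; 387336; 387333; 332937; 254928; 387969; 388049; 159441; 388360; 
296260; 388608; 294337; 122513; 388936; 126613; 348868; 389065; 348740; 
389193; 348693; 352272; 389832; 232261; 389961; 152452; 390217; 241665; 
184005; 388817; 306881; 117136; 35461; 390985; 149073; 391112; 217164; 
217097; 391749; 391817; 300048; 273801; 270801; 392264; 392336; 392513; 
382081; 233800; 389641; 306241; 338057; 346468; 393570; 393600; 256448; 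
134928; 86865; 394120; 301385; 394373; 394441; 123236; 394594; 394660; 
394722; 394784; 394846; 394912; 394953; 395013; 48705; 295962; 32069; 296321; 
387016; 386709; 286848; 283657; 143524; 396002; 396032; 173121; 325210; 
275781; 325120; 27845; 232965; 293697; 250513; 249409; 394368; 27777; 310609; 
397192; 118209; 378065; 190153; 301841; 299536; 212881; 398216; 124964; 
398434; 398464; 177473; 398809; 142156; 257929; 8897; 322778; 357125; 160513; 
357253; 126469; 399040; 317961; 399120; 308421; 236105; 133393; 399432; 
29588; 218312; 29700; 338696; 29828; 338824; 30165; 358720; 399505; 342793; 
272657; 399880; 273857; 320193; 16005; 400320; 211792; 400449; 388421; 
400576; 288837; 136136; 358405; 352645; 401033; 312656; 18369; 326106; 
116293; 223873; 116549; 392128; 301908; 401669; 401737; 379472; 401921; 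
401928; 402117; 402112; 402257; 339401; 182917; 402569; 402629; 402697; 
246341; 336453; 402880; 343305; 403088; 403208; 389009; 403329; 403468; 
290448; 403777; 403780; 391109; 404032; 340560; 347656; 290824; 404421; 
404489; 210057; 210633; 360656; 149531; 405000; 229189; 149633; 254917; 
272577; 387908; 225288; 219925; 225600; 220113; 225801; 158789; 405056; 
393025; 191632; 212736; 81737; 155025; 305040; 275204; 405888; 289089; 
348317; 406216; 216773; 406272; 340549; 406400; 315141; 406528; 406537; 
219392; 374108; 257553; 53201; 406920; 298960; 241605; 365060; 321856; 
234117; 407744; 17477; 407808; 247377; 340688; 265417; 254213; 408256; 
278673; 408392; 265677; 408768; 327369; 296896; 293137; 390106; 53730; 
409444; 409506; 409568; 409605; 403584; 75777; 308752; 395397; 345984; 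
410436; 410496; 358529; 407176; 410757; 370512; 97221; 411081; 333786; 
411204; 368000; 125760; 259653; 411657; 368640; 320292; 412066; 412096; 
235653; 412361; 49424; 412673; 243977; 34004; 160769; 160072; 244869; 244864; 
331713; 397829; 413641; 213705; 413773; 259728; 341760; 413328; 414209; 
121157; 414345; 44041; 305541; 414528; 193665; 399706; 371013; 245641; 
190917; 414848; 376772; 374401; 286081; 304408; 324177; 304329; 182725; 
415616; 336321; 385041; 196929; 266586; 188933; 276624; 329029; 416073; 
313285; 308161; 389449; 385865; 416464; 348514; 416768; 268673; 154497; 
291738; 368389; 185100; 405065; 52224; 326920; 378624; 341716; 285640; 65040; 
365713; 418312; 261844; 7816; 288388; 8264; 315925; 303568; 404041; 415644; 
418504; 20052; 28881; 272136; 205769; 20292; 345680; 84877; 417113; 205825; 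
85125; 167109; 418624; 398213; 418752; 356037; 352072; 419024; 419137; 
395920; 219781; 187401; 211276; 419840; 411601; 420040; 420176; 420353; 
362757; 282140; 420808; 115284; 378129; 216456; 77257; 206596; 402512; 
397133; 87252; 77185; 345736; 397381; 323908; 345864; 324164; 345992; 144129; 
347418; 49349; 144641; 227141; 145089; 150980; 145032; 151236; 191240; 
334165; 387536; 79433; 284233; 396741; 351429; 421440; 421449; 402305; 
388898; 421888; 403537; 102209; 93512; 326416; 422401; 422404; 421648; 71297; 
413965; 217473; 406340; 423573; 270465; 337668; 270536; 338005; 334720; 
411345; 57861; 178885; 423808; 288005; 424000; 378697; 194561; 245914; 
248261; 245952; 275397; 237637; 424384; 313424; 14472; 424597; 143249; 
371657; 336585; 298769; 8336; 406033; 237321; 28673; 424912; 145472; 339668; 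
282466; 425921; 326473; 98369; 343002; 171077; 343040; 346139; 132421; 
232596; 183937; 412305; 243536; 230277; 427164; 427272; 274817; 427397; 
405900; 425281; 427524; 356096; 374657; 427929; 156741; 427968; 293893; 
428105; 403848; 365649; 424320; 203921; 327697; 158145; 304960; 159753; 
428869; 364130; 429056; 318345; 333129; 407944; 348160; 342929; 407697; 
429832; 138505; 300096; 105856; 352981; 430341; 409737; 294405; 166928; 
277137; 430984; 140052; 301764; 141000; 130208; 431045; 431104; 131168; 
431369; 431429; 255952; 78721; 284544; 354121; 332041; 432133; 432201; 
432269; 28552; 432336; 190664; 367970; 432672; 432734; 432800; 432841; 
418889; 413385; 296328; 433285; 168257; 168666; 328901; 195213; 168576; 
350981; 433536; 232581; 433609; 305105; 412962; 433952; 434014; 434080; 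
434146; 434212; 434274; 434336; 434398; 434464; 434504; 199752; 101121; 
10497; 317001; 434949; 212353; 296784; 31045; 435392; 420929; 109505; 435609; 
104720; 366865; 68929; 412570; 299013; 20865; 414097; 425089; 290113; 391744; 
260549; 436672; 289755; 436872; 436933; 131200; 437009; 431644; 431177; 
387845; 374728; 437317; 370313; 40641; 437452; 437520; 437569; 348433; 
254785; 422472; 418057; 311945; 179357; 438084; 291793; 296969; 26241; 
376720; 112513; 45829; 413317; 414785; 322245; 355393; 284929; 385242; 
329733; 82576; 375248; 439496; 320976; 207361; 371136; 24529; 440200; 44372; 
24904; 44484; 25032; 95252; 44821; 111880; 80145; 325525; 45001; 163153; 
80336; 325641; 45184; 163344; 195473; 325824; 45385; 163537; 382217; 163728; 
382676; 253576; 382788; 253704; 189328; 189317; 440384; 261633; 307802; 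
383429; 307840; 404368; 217289; 332357; 440905; 273025; 299596; 441104; 
441281; 248732; 248777; 375500; 205072; 363737; 205129; 82848; 441570; 
441636; 441698; 441729; 10689; 268616; 317317; 442240; 430409; 286929; 
442632; 213317; 442816; 427605; 264009; 381065; 443077; 443145; 443213; 
311369; 309896; 443397; 421712; 349968; 289306; 289345; 182404; 64841; 
142217; 146625; 60417; 43785; 315456; 396620; 253505; 397017; 433232; 164820; 
392520; 164932; 392713; 118341; 444480; 444489; 444049; 315788; 445008; 
445057; 263948; 159825; 176129; 428314; 428357; 353164; 439949; 57041; 
438748; 427977; 312603; 38981; 312653; 386241; 445888; 39109; 386113; 209092; 
153608; 209029; 170760; 191173; 266885; 109573; 446464; 410313; 376080; 
233665; 220881; 446984; 121620; 221256; 121732; 221384; 240469; 221712; 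
377225; 447120; 377408; 447313; 447496; 447632; 236421; 447936; 257544; 
448069; 432005; 362704; 448385; 379721; 354761; 148289; 397453; 448768; 
318672; 448961; 371209; 200597; 449169; 449224; 424145; 395483; 99653; 
395585; 99909; 249985; 167500; 442560; 182481; 64987; 426245; 225808; 449921; 
89217; 240025; 357897; 204304; 157012; 138948; 157128; 139076; 157256; 
139541; 398532; 450185; 381666; 450368; 450521; 307920; 262089; 342469; 
128320; 298181; 338576; 442117; 336713; 435401; 347209; 331938; 451840; 
413825; 416400; 100048; 60289; 313817; 127824; 342592; 233861; 452864; 
428609; 130576; 84177; 453384; 57044; 113284; 57160; 162517; 57553; 226905; 
453504; 363473; 311305; 175181; 311361; 175301; 311489; 175556; 50696; 
175493; 77960; 364187; 453768; 262597; 453760; 262741; 364289; 117513; 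
262725; 453957; 454089; 73601; 353105; 454408; 444688; 346369; 369156; 
332809; 231621; 455040; 344464; 311041; 375962; 214469; 36801; 372058; 
402181; 341584; 412873; 455568; 341636; 321408; 299392; 340252; 389385; 
428817; 140929; 58689; 272705; 354458; 201349; 362049; 201477; 219013; 
456256; 279764; 235528; 381636; 235400; 363601; 415040; 228928; 437576; 
456645; 384477; 344849; 8129; 432777; 432717; 384389; 39505; 278221; 278144; 
338395; 417562; 432833; 287444; 303877; 344141; 432965; 420229; 420424; 
338509; 451201; 402816; 287684; 344192; 456852; 451396; 356553; 114629; 
372432; 59329; 96154; 222725; 438157; 181185; 222597; 223040; 439873; 429851; 
457672; 435781; 429888; 146113; 237505; 91216; 457985; 417872; 189845; 
422785; 458905; 398085; 459072; 444096; 387657; 232449; 400085; 424520; 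
313737; 443461; 263195; 459848; 234948; 263305; 234897; 98010; 263493; 
397376; 286045; 318853; 276549; 196993; 46089; 57921; 67393; 310234; 281733; 
281549; 125261; 310272; 125312; 282049; 282011; 252125; 460744; 258501; 
460736; 460800; 291269; 349577; 305233; 461192; 431752; 279369; 334921; 
260817; 421785; 458509; 190533; 458625; 432581; 458753; 461956; 331849; 
462085; 206089; 409537; 56197; 457553; 432528; 390409; 462864; 161168; 
461658; 443333; 362701; 175361; 453725; 306437; 463305; 448666; 334800; 
344336; 207889; 366672; 389785; 295753; 393168; 270400; 411993; 464320; 
464593; 464653; 464704; 65729; 240728; 302913; 82565; 353868; 182145; 389904; 
318608; 157584; 465409; 387213; 445441; 368400; 412480; 410908; 336009; 
25233; 466440; 3156; 25608; 3268; 25736; 3605; 26129; 398400; 16777; 314829; 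
3921; 450330; 26320; 85633; 450121; 358021; 407769; 16960; 358085; 108557; 
376592; 262153; 26513; 278657; 408532; 234576; 17289; 108677; 438472; 26704; 
274509; 278933; 409472; 376641; 52032; 26897; 430618; 274629; 279249; 409801; 
274565; 51213; 27329; 51333; 287169; 399049; 341125; 341057; 395408; 467009; 
339289; 136155; 467208; 467269; 291397; 467328; 467413; 149121; 399963; 
375045; 400013; 419908; 437645; 304705; 386185; 119057; 467848; 462537; 
385409; 462032; 308571; 468424; 308621; 468485; 319109; 342080; 410049; 
410241; 420173; 289565; 307328; 468817; 230917; 469001; 241473; 248336; 
458697; 37381; 469440; 145296; 430032; 262672; 469761; 204176; 310785; 
356432; 230992; 356872; 455624; 470421; 470481; 470536; 434196; 199044; 
434312; 434773; 434640; 215497; 470672; 215872; 470865; 388097; 471193; 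
319245; 369680; 247824; 190874; 363649; 471684; 384644; 414933; 255369; 
108097; 384720; 173723; 276826; 356293; 255557; 470081; 276736; 440476; 
432475; 348929; 419525; 435329; 409116; 256720; 125396; 458376; 201921; 
147969; 186970; 376069; 187008; 446747; 93825; 355033; 414537; 352208; 
440724; 465224; 123477; 408576; 369553; 380060; 335497; 226124; 335568; 
365017; 360713; 9805; 472832; 181840; 238041; 237833; 442060; 10843; 469317; 
287689; 470984; 155457; 285530; 473412; 285440; 408265; 392389; 397723; 
186112; 326875; 474184; 474245; 458241; 414736; 69325; 474432; 379088; 
192092; 381851; 92308; 355664; 454157; 70532; 381764; 92424; 70869; 93008; 
456465; 183259; 474824; 37701; 172059; 86604; 183361; 406725; 37957; 55937; 
468122; 372421; 468160; 302748; 406409; 429020; 461001; 466060; 414747; 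
475076; 333001; 438865; 251533; 402905; 332929; 437193; 374341; 55244; 
415185; 394139; 475332; 400777; 400585; 474140; 331473; 375753; 401872; 4545; 
284760; 354001; 284681; 432016; 354061; 390489; 381953; 448265; 354181; 
443852; 230800; 61588; 180378; 219652; 469057; 152008; 180613; 457860; 
224589; 233537; 180672; 309445; 462236; 178817; 200273; 476616; 454548; 
449288; 72148; 6724; 72264; 6852; 72392; 21717; 82769; 306970; 72704; 320265; 
280780; 128773; 193216; 30801; 441616; 83085; 132161; 123009; 160980; 476753; 
72905; 320448; 426817; 476740; 360220; 129029; 107592; 193161; 119888; 
357853; 435468; 441937; 441881; 336269; 132289; 250384; 229700; 477073; 
137408; 454340; 230544; 320777; 320901; 288340; 129217; 108040; 266969; 
159249; 259349; 31444; 477264; 477595; 398280; 280389; 426572; 137609; 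
114689; 186500; 295173; 288261; 413260; 288321; 137801; 344400; 477381; 
31560; 451741; 451713; 130459; 186372; 295365; 296517; 32008; 240909; 451776; 
453121; 439765; 119041; 467867; 383696; 241029; 475525; 388493; 118913; 
374916; 269320; 374853; 269513; 452673; 131281; 478728; 393088; 436097; 
402624; 452417; 378521; 152912; 88768; 152837; 479308; 479296; 165328; 21658; 
21569; 133124; 311561; 133201; 369882; 369669; 378369; 392921; 384261; 
440393; 462811; 479872; 462161; 480008; 476436; 463877; 187081; 339337; 
317829; 359245; 401371; 169025; 169157; 359365; 30732; 367233; 446173; 
359620; 423368; 359748; 423240; 480260; 418433; 480473; 463492; 475649; 
416347; 480836; 279945; 283905; 421210; 481028; 53641; 427009; 131009; 
464209; 432157; 481536; 321680; 330964; 331265; 481605; 321605; 331212; 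
205957; 451465; 85197; 153089; 408922; 383813; 408960; 384091; 38017; 378961; 
423753; 425700; 482530; 482561; 482636; 291648; 466267; 385280; 157724; 
334537; 178121; 220609; 318106; 287365; 68765; 386892; 468676; 79056; 366229; 
398913; 388496; 371802; 478621; 429509; 355213; 43665; 329024; 33601; 128282; 
128580; 451081; 380816; 401178; 380869; 401088; 404955; 300545; 252549; 
300609; 345180; 59265; 471553; 335441; 422873; 421260; 420681; 85120; 144781; 
484608; 364368; 45697; 460378; 164485; 373467; 397700; 373384; 298261; 
353297; 478292; 465040; 165008; 485313; 483585; 429209; 485568; 351249; 
127233; 362394; 315269; 154369; 315525; 362189; 368461; 154689; 328128; 
444929; 339716; 405709; 154760; 339844; 155080; 52353; 349274; 151557; 
349184; 334300; 466825; 147393; 335194; 367685; 147841; 367557; 346497; 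
200772; 346440; 239492; 393608; 387137; 465752; 152329; 486288; 486285; 
486464; 125445; 461392; 443533; 392904; 443524; 193940; 422728; 480580; 
458952; 480516; 242645; 459601; 381321; 292176; 268288; 292369; 486856; 
371856; 486977; 14721; 280602; 247044; 487305; 196556; 396177; 239129; 
416201; 424859; 451589; 425537; 42817; 124378; 141573; 124416; 396508; 
354697; 279197; 487680; 246800; 461569; 138437; 165339; 430021; 440989; 
419021; 278621; 487748; 218773; 452753; 470357; 488017; 488072; 301333; 
174545; 488136; 319188; 446728; 471300; 393736; 388228; 239701; 332296; 
251280; 430785; 219357; 488452; 488465; 308873; 488656; 401561; 192784; 
339610; 264453; 90305; 264581; 55579; 489028; 372489; 282973; 489216; 283025; 
188297; 162833; 482394; 307461; 257117; 460868; 257365; 291216; 326160; 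
201425; 489544; 364692; 232712; 364804; 271496; 407509; 390144; 394320; 
172248; 331600; 348564; 242689; 381465; 430665; 292572; 365961; 111067; 
490120; 490181; 99213; 297689; 490304; 391504; 297729; 476241; 309595; 
309253; 446860; 453020; 316881; 452937; 434960; 375744; 347137; 490905; 
404549; 175809; 429338; 270724; 323849; 129680; 363354; 129733; 363264; 
404635; 404805; 404672; 231260; 314192; 444948; 384072; 485892; 426056; 
405700; 443592; 361812; 353672; 361733; 463681; 407041; 467584; 110017; 
411802; 437893; 452172; 423069; 491840; 423184; 224980; 170689; 346120; 
491908; 224901; 304668; 224961; 422024; 492177; 415821; 415812; 421961; 
492432; 386645; 410768; 492481; 336088; 360976; 399240; 313237; 257281; 
278490; 492932; 368541; 329109; 313680; 216668; 492753; 399305; 399376; 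
115604; 333448; 366997; 363088; 267600; 387457; 191233; 446233; 364617; 
493452; 459357; 187220; 454208; 459397; 406939; 493889; 187268; 493832; 
455493; 407104; 429723; 299908; 455689; 367451; 16325; 367360; 425243; 
369412; 427657; 350875; 442949; 465281; 321088; 191772; 139273; 267729; 
344665; 344713; 442651; 483141; 466636; 353729; 491417; 442960; 494465; 
474779; 433797; 454857; 459532; 46337; 472666; 78021; 349660; 430925; 134849; 
477961; 398337; 212933; 418780; 393985; 167369; 213137; 237312; 425370; 
495428; 136029; 403285; 400848; 272348; 350532; 495689; 495760; 463821; 
38171; 395856; 38209; 395909; 310848; 483483; 449732; 43721; 449681; 243673; 
188613; 243721; 275740; 473928; 379585; 448538; 86917; 448576; 86789; 496512; 
172173; 496640; 331653; 451355; 497025; 348484; 496968; 416964; 457033; 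
297051; 457093; 297088; 439323; 496333; 182084; 473865; 497232; 351765; 
257753; 460160; 184145; 312073; 184720; 497409; 184857; 336769; 456601; 
482832; 345025; 497668; 416596; 276040; 416645; 450504; 497797; 365185; 
498009; 229965; 494916; 229896; 461072; 431573; 349777; 431680; 431256; 
436244; 453256; 478980; 490888; 498309; 479132; 498385; 498504; 412821; 
272521; 334864; 310420; 123329; 213849; 449104; 472404; 394817; 238600; 
238149; 472580; 394892; 394945; 238793; 329361; 238405; 303001; 395273; 
468300; 442332; 489673; 442385; 365952; 292440; 391888; 442197; 297797; 
481920; 297297; 258136; 205968; 409352; 322196; 409224; 322117; 390016; 
88284; 369232; 463624; 380373; 372688; 422357; 390721; 371404; 357660; 
354569; 90001; 417373; 499648; 417488; 424769; 317125; 297996; 435024; 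
423897; 435081; 179163; 480772; 336329; 390363; 458120; 390277; 266880; 
96513; 462298; 361477; 462336; 491356; 385736; 265924; 385673; 500112; 
319829; 157968; 293781; 305937; 393179; 463365; 452289; 290525; 362881; 
290565; 493185; 184656; 500417; 184793; 500552; 358596; 212040; 410628; 
415573; 304216; 304024; 256021; 456089; 333833; 397915; 330956; 439049; 
487131; 376901; 497821; 497856; 454612; 500809; 469953; 436441; 250632; 
436484; 342549; 355793; 158489; 481096; 424469; 478529; 439579; 457924; 
478356; 375177; 485073; 390153; 189008; 227740; 246473; 462875; 330373; 
347739; 304521; 347781; 454683; 462664; 500869; 236699; 376965; 202780; 
291016; 488837; 161792; 401617; 475272; 392069; 461403; 454981; 461249; 
499857; 446361; 437769; 254365; 53844; 254024; 53700; 253896; 26708; 383240; 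
447892; 383368; 447764]%positive.

Definition stabilizer_steps : seq positive := [::
68; 64; 137; 145; 213; 264; 465; 584; 656; 484; 1570; 1632; 1694; 1760; 1822; 
1890; 1952; 2014; 2080; 2146; 2212; 418; 2340; 2402; 2464; 2526; 2592; 2658; 
2718; 2784; 2846; 2912; 2978; 449; 1553; 1672; 393; 401; 2305; 2385; 2504; 
2576; 228; 197; 292; 257; 356; 325; 420; 385; 389; 548; 517; 612; 577; 676; 
645; 740; 705; 1630; 1608; 1636; 1700; 1665; 1764; 1733; 1826; 1801; 1809; 
3860; 2120; 2180; 1888; 1892; 1956; 2018; 2020; 1985; 2082; 2057; 2208; 2272; 
2240; 2274; 2249; 2462; 2440; 2468; 2532; 2497; 2596; 2565; 2654; 2632; 2660; 
2625; 2724; 2788; 2757; 2850; 2852; 2817; 2914; 2889; 2916; 2885; 2980; 2945; 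
3040; 3106; 3081; 3170; 3234; 3209; 3426; 3490; 3465; 3554; 3616; 3620; 3589; 
3682; 3746; 3810; 3785; 3876; 3841; 3845; 3934; 3938; 3921; 3940; 3905; 4002; 
4066; 4132; 4194; 4256; 4240; 4260; 4229; 4318; 4382; 4356; 4386; 4448; 4452; 
4512; 4578; 4642; 4706; 4681; 4768; 4772; 4898; 4962; 4937; 5024; 5008; 5028; 
5152; 5136; 5156; 5125; 5342; 5408; 5472; 5456; 5469; 5536; 5520; 5540; 5509; 
5600; 5584; 5604; 5664; 5668; 5637; 5728; 5712; 5790; 5780; 5858; 5833; 5836; 
5920; 5984; 5968; 5988; 6048; 6052; 6021; 6114; 6089; 6178; 6153; 6180; 6149; 
6244; 6209; 6306; 6368; 6372; 6432; 6498; 6560; 6544; 6564; 6622; 6600; 6628; 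
6593; 6690; 6665; 6816; 6818; 6793; 6880; 6864; 6942; 6948; 6913; 7010; 7070; 
7136; 7200; 7184; 7204; 7264; 7268; 7237; 7326; 7316; 7332; 7297; 7394; 7456; 
7582; 7560; 7588; 7553; 7650; 7710; 7688; 7716; 7681; 7778; 7753; 7840; 7902; 
7880; 8030; 8008; 8036; 8001; 8158; 8136; 8164; 8129; 8226; 8286; 8292; 8257; 
8283; 8354; 8329; 8337; 8414; 8392; 8544; 8512; 8606; 8670; 8648; 8676; 8641; 
8667; 8738; 8721; 8804; 8769; 8866; 8841; 8928; 8932; 8992; 8996; 8965; 9058; 
9033; 9122; 9184; 9168; 9188; 9246; 9252; 9217; 9314; 9374; 9440; 9444; 9502; 
9480; 9508; 9473; 9570; 9632; 9636; 9760; 9764; 9826; 9888; 9892; 9950; 9928; 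
10016; 10020; 9989; 10082; 10144; 10270; 10334; 10312; 10340; 10305; 10331; 
10402; 10385; 10468; 10433; 10530; 10505; 14548; 14544; 14492; 10658; 10720; 
10848; 10852; 10821; 10914; 10976; 10980; 10957; 11040; 11044; 11013; 11168; 
11172; 11230; 11234; 11360; 11344; 11364; 11333; 11488; 11472; 11492; 11461; 
11680; 11684; 11653; 15752; 11872; 11876; 11934; 11908; 12000; 12064; 12068; 
12037; 16136; 12258; 12320; 12309; 12382; 12388; 12353; 12510; 12516; 12481; 
12578; 12553; 12640; 12644; 12613; 12704; 12688; 12708; 12766; 12744; 12772; 
12737; 12834; 12896; 12900; 12869; 12962; 13024; 13088; 13150; 13156; 13121; 
13218; 13196; 13280; 13284; 13253; 13346; 13408; 13470; 13460; 13476; 13441; 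
13538; 13598; 13604; 13569; 13728; 13712; 13790; 13796; 13761; 13858; 13920; 
13982; 13972; 13986; 13988; 13953; 14050; 14025; 14112; 14096; 14174; 14240; 
14304; 14308; 14277; 19016; 14624; 14608; 14628; 14686; 14750; 14756; 14721; 
14818; 14793; 14880; 14864; 14942; 14948; 14913; 15070; 15060; 15074; 15057; 
15076; 15041; 15198; 15204; 15169; 15330; 15305; 15454; 15432; 15444; 15582; 
15560; 15588; 15553; 15710; 15700; 15714; 15716; 15681; 15838; 15842; 15825; 
15844; 15809; 15906; 15884; 15968; 15936; 16030; 16034; 16098; 16081; 16224; 
16208; 20937; 16356; 16325; 16418; 16409; 21061; 21064; 12372; 13072; 16484; 
16546; 16608; 16612; 16676; 16641; 16738; 16713; 16798; 16776; 16804; 16769; 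
16866; 16844; 16928; 16932; 16901; 16994; 17056; 17124; 17089; 17186; 17161; 
17248; 17232; 17252; 17310; 17440; 17444; 17413; 17506; 17500; 17497; 17568; 
17536; 17636; 17601; 17698; 17673; 17760; 17744; 17757; 17764; 17755; 17890; 
17873; 22784; 17892; 17857; 17861; 17954; 18016; 18020; 18080; 18084; 18053; 
18146; 18137; 18206; 18184; 18212; 18272; 18338; 18400; 18404; 18381; 18462; 
18466; 18449; 18468; 18532; 18497; 18501; 18596; 18658; 18720; 18782; 18760; 
18848; 18910; 18914; 18978; 18961; 19102; 19080; 19108; 19073; 19232; 19236; 
19300; 19269; 19424; 19486; 19464; 19492; 19483; 19552; 19556; 19525; 19618; 
19601; 19682; 19657; 19684; 19649; 19653; 19872; 19876; 19845; 20000; 20258; 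
20233; 20241; 20260; 20229; 20324; 20386; 20369; 20450; 20425; 20516; 20481; 
20578; 20640; 20608; 20702; 20676; 20692; 20770; 20745; 20836; 20900; 20865; 
21216; 21200; 21278; 21284; 21249; 21346; 21324; 21410; 21472; 21536; 21732; 
21697; 21794; 21769; 21918; 21986; 22048; 22052; 22021; 22110; 22088; 22240; 
22302; 22306; 22308; 22273; 22370; 22345; 27396; 22624; 22628; 22597; 27528; 
22686; 22660; 22882; 22857; 22944; 22928; 22948; 23134; 23124; 23140; 23105; 
23202; 23177; 27972; 23328; 23332; 23301; 23394; 23454; 23444; 23458; 23520; 
23504; 23524; 23588; 23553; 23716; 23685; 23780; 23745; 23842; 23906; 23881; 
23970; 24032; 24016; 24036; 24094; 24160; 24222; 24226; 24290; 24265; 24356; 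
24347; 24480; 24484; 24453; 24610; 24612; 24577; 24674; 24738; 24798; 24804; 
24795; 24864; 24868; 24837; 29960; 24990; 24996; 24961; 25058; 25033; 25036; 
25188; 25250; 25310; 25300; 25316; 25281; 25438; 25428; 25508; 25473; 25477; 
25570; 25545; 25634; 25700; 25665; 25888; 25872; 25892; 25950; 26018; 26080; 
26084; 26053; 26270; 26248; 26336; 26340; 26309; 26464; 26432; 26528; 26512; 
26525; 31429; 26590; 26568; 26654; 26658; 26641; 26660; 26722; 26784; 26848; 
26912; 26896; 26974; 26980; 26945; 27104; 27170; 27236; 27205; 27362; 27424; 
27392; 27486; 27492; 27457; 27616; 27584; 27748; 27713; 27876; 27841; 27845; 
27938; 28000; 27968; 28066; 28049; 28130; 28105; 28196; 28258; 28233; 28260; 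
28225; 28324; 28450; 28578; 28553; 28642; 28708; 28768; 28752; 28832; 28836; 
28894; 28872; 28900; 28865; 28962; 29024; 29086; 29090; 29073; 29154; 29129; 
29284; 29253; 34184; 29410; 29393; 29412; 29377; 29602; 29664; 29728; 29732; 
29792; 29796; 29765; 34696; 29918; 29924; 29889; 30052; 30021; 30114; 30176; 
30144; 30242; 30304; 30288; 30308; 30372; 30337; 30341; 30434; 30562; 30537; 
30628; 30597; 30692; 30754; 30814; 30792; 30820; 30785; 30882; 30876; 30944; 
31008; 30992; 31012; 31076; 31041; 31200; 31204; 31181; 31262; 31252; 31266; 
31390; 31364; 36379; 31520; 31488; 36429; 31586; 31561; 31652; 31714; 31776; 
31760; 31780; 31838; 31902; 31906; 31966; 31944; 31972; 32032; 32036; 32005; 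
32158; 32162; 32145; 32228; 32290; 32265; 32352; 32336; 32414; 32388; 32480; 
32484; 32453; 32546; 32529; 32540; 32606; 32580; 32738; 32713; 32800; 32784; 
32862; 32836; 32932; 32897; 32992; 32996; 32965; 33124; 33093; 33186; 33250; 
33376; 33380; 33349; 33440; 33424; 33444; 33506; 33566; 33544; 33698; 33676; 
33760; 33764; 33733; 33826; 33888; 33950; 33940; 33954; 34018; 33993; 34144; 
34276; 34338; 34400; 34384; 34462; 34526; 34532; 34497; 34654; 34644; 34658; 
34788; 34757; 34850; 34833; 34914; 34889; 34976; 34960; 34980; 35038; 35012; 
35104; 35108; 35166; 35144; 35172; 35137; 35234; 35298; 35273; 35424; 35408; 
35428; 35397; 35490; 35465; 35554; 35616; 35600; 35680; 35684; 35653; 35746; 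
35729; 35737; 35874; 36130; 36113; 36132; 36097; 36122; 36258; 36233; 36446; 
36424; 36436; 36512; 36516; 36485; 36578; 36644; 36702; 36680; 36708; 36673; 
36832; 36898; 36873; 37024; 37028; 36997; 37090; 37156; 37121; 37282; 37257; 
37348; 37313; 37410; 37472; 37534; 37512; 37600; 37589; 37662; 37652; 42688; 
37668; 37633; 37730; 37705; 42820; 37920; 37904; 37982; 37960; 38048; 38016; 
38180; 38145; 38306; 38281; 38368; 38352; 38372; 38436; 38562; 38537; 38628; 
38593; 38690; 38668; 38752; 38816; 38880; 38848; 38942; 38946; 38929; 39010; 
38985; 39072; 39056; 39076; 39067; 39202; 39177; 39268; 39328; 39332; 39390; 
39458; 39524; 39582; 39560; 39588; 39712; 39716; 39685; 39778; 39842; 39817; 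
44868; 39844; 39809; 39970; 39945; 40036; 40001; 40096; 40158; 40136; 40164; 
40129; 40226; 40288; 40277; 40418; 40396; 40480; 40484; 40453; 40546; 40608; 
40672; 40656; 40740; 40705; 40802; 40777; 40780; 40864; 40990; 40968; 41054; 
41058; 41041; 41060; 41025; 41122; 41097; 46276; 41252; 41440; 41424; 41634; 
41609; 41696; 41693; 41700; 41665; 41762; 41824; 41828; 41797; 41890; 41954; 
42016; 42000; 42008; 42084; 42049; 42146; 42121; 42208; 42205; 42274; 42336; 
42340; 42309; 42402; 42526; 42592; 42596; 42658; 42633; 42910; 42888; 42976; 
42980; 43042; 43236; 43201; 43298; 43276; 43424; 43614; 43678; 43668; 43682; 
43665; 43810; 43785; 43876; 43841; 43936; 43940; 43909; 48584; 44128; 44112; 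
44194; 44254; 44260; 44225; 44384; 44448; 44445; 44452; 44417; 44514; 44580; 
44549; 44642; 44706; 44770; 44745; 44836; 44896; 44864; 45024; 45028; 44997; 
45090; 45150; 45216; 45220; 45189; 45282; 45410; 45385; 45472; 45440; 45538; 
45521; 45602; 45577; 45664; 45648; 45668; 45659; 45790; 45768; 45858; 45852; 
45920; 45904; 45982; 46048; 46114; 46089; 46180; 46145; 46242; 46304; 46272; 
46370; 46496; 46500; 46469; 46626; 46604; 46609; 46688; 46656; 46754; 46737; 
46756; 46721; 46818; 46793; 46809; 51396; 47074; 47136; 47264; 47268; 47332; 
47297; 47394; 47369; 47520; 47582; 47586; 47569; 47650; 47716; 47685; 47776; 
47838; 47842; 47825; 47844; 47809; 48224; 48213; 48290; 48265; 48416; 48420; 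
48389; 48482; 48548; 48513; 48670; 48648; 48676; 48736; 48740; 48800; 48789; 
48804; 48773; 48866; 48930; 48932; 49058; 49036; 49041; 49120; 49088; 49186; 
49161; 49248; 49245; 49252; 49217; 49316; 49380; 49349; 49572; 49537; 49634; 
49609; 49760; 49822; 49826; 49809; 49890; 49865; 50020; 49989; 50148; 50113; 
50208; 50212; 50181; 54408; 50400; 50526; 50504; 50592; 50654; 50658; 50641; 
50720; 50724; 50693; 50786; 50848; 50832; 50852; 50910; 50976; 51044; 51009; 
51035; 51106; 51081; 51089; 51230; 51204; 51488; 51472; 51492; 51614; 51620; 
51585; 51682; 51746; 51808; 51870; 51860; 51874; 51938; 51913; 52004; 51969; 
52064; 52068; 52045; 52130; 52105; 52190; 52180; 52194; 52177; 52258; 52233; 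
52324; 52386; 52450; 52425; 52512; 52496; 52574; 52580; 52545; 52642; 52617; 
52704; 52688; 52770; 52753; 52832; 52836; 52805; 52898; 52958; 52964; 52929; 
53090; 53065; 53092; 53057; 53061; 53154; 53129; 53216; 53220; 53284; 53346; 
53470; 53444; 53540; 53509; 53517; 53730; 53982; 53972; 53986; 54050; 54025; 
54116; 54081; 54176; 54242; 54372; 54337; 54498; 54481; 54560; 54622; 54612; 
54626; 54690; 54665; 54756; 54721; 54820; 54785; 54882; 54857; 54944; 54928; 
54948; 55006; 54984; 55012; 54977; 55074; 55136; 55125; 55198; 55204; 55195; 
55392; 55360; 55460; 55425; 55584; 55588; 55557; 55650; 55712; 55776; 55760; 
55838; 55828; 55906; 55881; 56032; 56036; 56005; 56098; 56164; 56129; 56288; 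
56292; 56354; 56329; 56480; 56546; 56608; 56612; 56676; 56645; 56667; 56734; 
56712; 56740; 56800; 56789; 56804; 56773; 56866; 56928; 56990; 56968; 57124; 
57089; 57186; 57161; 57248; 57252; 57312; 57316; 57285; 61640; 59609; 59792; 
57444; 57413; 57506; 57481; 57568; 57572; 57541; 57636; 57601; 57762; 57828; 
57888; 57856; 58016; 58020; 58082; 58057; 58148; 58208; 58212; 58181; 58274; 
58400; 58404; 58466; 58449; 58532; 58497; 58658; 58633; 58724; 58784; 58788; 
58757; 58914; 58976; 58980; 58949; 59038; 59016; 59044; 59009; 59021; 59106; 
59084; 59089; 59424; 59428; 59397; 63624; 59554; 59678; 59684; 59649; 59746; 
59721; 59934; 59912; 59940; 60064; 60048; 60126; 60116; 60132; 60097; 60256; 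
60240; 60322; 60305; 60382; 60388; 60353; 60512; 60496; 60640; 60708; 60673; 
60770; 60896; 60885; 60900; 60869; 60962; 61028; 60993; 60997; 61090; 61065; 
61152; 61136; 61156; 61214; 61204; 61346; 61408; 61412; 61381; 61476; 61441; 
61467; 61538; 61521; 61730; 61705; 61792; 61776; 61796; 61765; 61854; 61860; 
61825; 61986; 61977; 62048; 62052; 62114; 62178; 62161; 62238; 62244; 62209; 
66333; 62368; 62352; 62372; 62341; 62500; 62465; 62562; 62537; 62624; 62608; 
62686; 62692; 62657; 62944; 62928; 62948; 62917; 63070; 63200; 63184; 63262; 
63392; 63586; 63588; 63553; 63716; 63707; 63780; 63749; 63972; 63941; 63963; 
64034; 64009; 64012; 67524; 64264; 61141; 65040; 64969; 61329; 61340; 61376; 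
65672; 64094; 64072; 64164; 64129; 64542; 64804; 64769; 64773; 64866; 64841; 
64932; 65442; 65417; 65828; 65797; 65805; 66014; 66020; 65985; 66272; 66276; 
66245; 68296; 66404; 66369; 66381; 66846; 66824; 66852; 66817; 66976; 66965; 
67038; 67016; 67044; 67104; 67166; 67170; 67153; 67616; 67744; 67733; 67810; 
67785; 67872; 68000; 67984; 68132; 68101; 68258; 68249; 68644; 68613; 68766; 
68756; 68834; 68809; 69088; 69072; 69085; 69573; 69588]%positive.

(** * Finiteness of the groups *)

Definition not_r0 (g : gen) : bool := if g is r0 then false else true.

(** A triple [(q, s, h)] stands for the hemi-polyhedron {q,s}_h. The exponent [h] is half the
    Coxeter number of [q,s] (6 for the cube, 10 for the icosahedron), so that [(r1 r2 r3)^h] is the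
    central inversion that becomes trivial. *)
Definition projective_types : seq (nat * nat * nat) :=
  [:: (4, 3, 3); (3, 4, 3); (5, 3, 5); (3, 5, 5)].

Definition vertex_relators (q s h : nat) : seq relator :=
  [:: (wd "13", 2); (wd "23", s); (wd "12", q); (wd "123", h)].

(** The groups are [4,3] and [5,3] modulo the central inversion, of orders 24 and 60, enumerated
    over the trivial subgroup; 200 is fuel. As [r0] does not occur in the relators, only words in
    the other generators can be traced. *)
Lemma vertex_figure_finite (Om : Type) (r : gen -> Om -> Om)
    (rK : forall g, involutive (r g)) q s h x0 :
  List.In (q, s, h) projective_types -> satisfies r (vertex_relators q s h) ->
  finite_orbit r x0 not_r0.
Proof.
move=> hq hr.
have c : closed_under not_r0 (enumerate (vertex_relators q s h) [::] [::] 200).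
  by case: hq => [|[|[|[|//]]]] [<- <- <-]; vm_compute.
by apply: (enumerate_finite rK hr _ c).
Qed.

Lemma vertex_relators_sub p q s h u :
  List.In u (vertex_relators q s h) -> List.In u (locproj p q s h).
Proof. by rewrite /=; tauto. Qed.

(** Enumerates the cosets of the subgroup generated by [r1], [r2], [r3], that is, vertices instead
    of flags. *)
Definition locproj_closes (p q s h : nat) : bool :=
  closed_under predT
    (enumerate (locproj p q s h) [seq [:: g] | g <- gens & not_r0 g] [::] 200).

Lemma locproj_finite_of_closed (Om : Type) (r : gen -> Om -> Om)
    (rK : forall g, involutive (r g)) p q s h x0 :
  List.In (q, s, h) projective_types -> satisfies r (locproj p q s h) ->
  locproj_closes p q s h -> finite_orbit r x0 predT.
Proof.
rewrite /locproj_closes => hq hr hc; apply: (finite_cosets rK hr _ hc).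
apply: (vertex_figure_finite rK x0 hq) => u /(vertex_relators_sub p); exact: hr.
Qed.

(** Both words are involutions, so this is their commutation; in terms of [z] it reads
    [(z r3)^6 = 1]. The word [cw] is short because [z = a v], with [a] of length 10 and [v] the
    longest element of the dihedral group of [r0], [r1]: as [v] commutes with [r3], [r3 z r3 z r3]
    reduces to [r3 a r3 a^-1 r3]. The fuel 0 means that the listed steps alone close the word. *)
Lemma cw_commutes_check :
  fixes_one (enumerate (locproj 5 3 5 5) [::] commutation_steps 0) (cw ++ zw ++ cw ++ zw).
Proof. by vm_compute. Qed.

(** Meant for the conjugation action with [z] as coset 1: the subgroup generators fix this coset
    because they commute with [z], and the closed trace shows the same for [dw]. *)
Lemma dw_stabilizes_check :
  fixes_one (enumerate (locproj 5 3 5 5) [:: wd "0"; wd "1"; wd "2"; cw] stabilizer_steps 0) dw.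
Proof. by vm_compute. Qed.

Lemma class_check :
  closed_under predT
    (enumerate (locproj 5 3 5 5) [:: wd "0"; wd "1"; wd "2"; cw; dw] [::] 5000).
Proof. by vm_compute. Qed.

(** A presentation of [5,3], of order 120. What concerns [z] inside a facet is proved in this finite
    group, over the trivial subgroup, without the relators of the infinite group [5,3,5]. *)
Definition facet_relators : seq relator := [:: (wd "02", 2); (wd "12", 3); (wd "01", 5)].

Lemma zw_involutive_check :
  fixes_one (enumerate facet_relators [::] [::] 200) (zw ++ zw).
Proof. by vm_compute. Qed.

Lemma zw_central_check g : g <> r3 ->
  fixes_one (enumerate facet_relators [::] [::] 200) (g :: zw ++ g :: zw).
Proof. by case: g => // _; vm_compute. Qed.

(** * The exceptional type {{5,3},{3,5}_5} *)

Section LocallyProjective535.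
Variables (Om : Type) (r : gen -> Om -> Om).
Hypothesis rK : forall g, involutive (r g).
Hypothesis relr : satisfies r (locproj 5 3 5 5).

Let z := wact r zw.

Lemma facet_relatorsP : satisfies r facet_relators.
Proof. by move=> u hu; apply: relr; move: hu => /=; tauto. Qed.

Lemma zK : involutive z.
Proof.
move=> x; rewrite /z -wact_cat.
by apply: (enumerate_fixes rK facet_relatorsP _ zw_involutive_check).
Qed.

Lemma zC g : g <> r3 -> r g \o z \o r g = z.
Proof.
move=> g3; apply: funext => x /=; apply: (can_inj zK); rewrite zK.
have : wact r (g :: zw ++ g :: zw) x = x.
  by apply: (enumerate_fixes rK facet_relatorsP _ (zw_central_check g3)).
by rewrite -cat1s wact_cat wact_cat -cat1s wact_cat.
Qed.

Definition conjact (g : gen) (f : Om -> Om) : Om -> Om := r g \o f \o r g.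

Lemma conjactK g : involutive (conjact g).
Proof. by move=> f; apply: funext => x; rewrite /conjact /= !rK. Qed.

Lemma wact_conjact w f : wact conjact w f = wact r w \o f \o wact r (rev w).
Proof.
elim: w f => //= g w IH f; rewrite IH; apply: funext => x.
by rewrite /= rev_cons -cats1 wact_cat.
Qed.

Lemma conjact_holds w : holds r w -> holds conjact w.
Proof.
move=> h f; rewrite wact_conjact; apply: funext => x /=.
by rewrite h (holds_rev rK h).
Qed.

Lemma conjact_fix w : List.In w [:: wd "0"; wd "1"; wd "2"; cw; dw] -> wact conjact w z = z.
Proof.
have fix4 v : List.In v [:: wd "0"; wd "1"; wd "2"; cw] -> wact conjact v z = z.
  case=> [<-|[<-|[<-|[<-|//]]]]; try exact: zC.
  rewrite wact_conjact; have -> : rev cw = cw by [].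
  apply: funext => x; apply: (can_inj zK); rewrite zK.
  have : wact r (cw ++ zw ++ cw ++ zw) x = x.
    by apply: (enumerate_fixes rK relr _ cw_commutes_check).
  by rewrite !wact_cat.
move=> hw; have [/fix4//|->] : List.In w [:: wd "0"; wd "1"; wd "2"; cw] \/ w = dw.
  by case: hw => [|[|[|[|[|//]]]]] <-; [left; left | left; right; left
    | left; right; right; left | left; right; right; right; left | right].
(* The enumeration takes place among self-maps under conjugation, with base point [z], so a word
   that closes up commutes with [z]. *)
exact: (enumerate_fixes conjactK (fun u hu => conjact_holds (relr hu)) fix4 dw_stabilizes_check).
Qed.

Definition zclass (f : Om -> Om) := exists w, f = wact conjact w z.

Lemma zclass_finite : finite_pred zclass.
Proof.
have relc : satisfies conjact (locproj 5 3 5 5).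
  by move=> u hu; apply: conjact_holds; exact: relr.
have [l hl] := enumerate_finite conjactK relc conjact_fix class_check.
by exists l => f [w ->]; apply: hl; exact: all_predT.
Qed.

Lemma zclassK f : zclass f -> involutive f.
Proof.
by case=> w -> x; rewrite !wact_conjact /= (wact_revK rK) zK (wactK_rev rK).
Qed.

Lemma zclass_conj w f : zclass f -> zclass (wact conjact w f).
Proof. by case=> u ->; exists (u ++ w); rewrite wact_cat. Qed.

(** A conjugate of [z] is itself the action of a word, so conjugation by it stays inside the class,
    as Dietzmann's lemma requires. *)
Lemma zclassJ f g : zclass f -> zclass g -> zclass (f \o g \o f).
Proof.
move=> Cf Cg; have fK := zclassK Cf; have [w ef] := Cf.
have ew : f = wact r (rev w ++ zw ++ w).
  by rewrite ef wact_conjact; apply: funext => x; rewrite !wact_cat.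
have -> : f \o g \o f = wact conjact (rev w ++ zw ++ w) g; last exact: zclass_conj.
rewrite wact_conjact -ew; apply: funext => x /=; congr (f (g _)).
by apply: (can_inj fK); rewrite fK ew wactK_rev.
Qed.

Definition zinvariant (A : Om -> Prop) := forall f, zclass f -> forall y, A y -> A (f y).
(* On these sets z acts trivially. *)
Definition zblocks := {A : Om -> Prop | zinvariant A}.

Lemma preact_zinvariant g A : zinvariant A -> zinvariant (preact r g A).
Proof.
move=> hA f /(zclass_conj [:: g]) /= Cf y /(hA _ Cf).
by rewrite /preact /conjact /= rK.
Qed.

Definition blockact (g : gen) (A : zblocks) : zblocks :=
  exist _ (preact r g (sval A)) (preact_zinvariant (svalP A)).

Lemma zblocks_inj (A B : zblocks) : sval A = sval B -> A = B.
Proof. by case: A B => [A hA] [B hB] /= e; subst; rewrite (Prop_irrelevance hA hB). Qed.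

Lemma blockactK g : involutive (blockact g).
Proof. by move=> A; apply: zblocks_inj; exact: preactK. Qed.

Lemma sval_blockact w A : sval (wact blockact w A) = wact (preact r) w (sval A).
Proof. by elim: w A => //= g w IH A; rewrite IH. Qed.

(** As [zw] is the fifth power of [r0 r1 r2], the triviality of [z] on invariant sets is exactly the
    relation that makes the facets projective too. *)
Lemma blockact_relators : satisfies blockact (rcons (locproj 5 3 5 5) (wd "012", 5)).
Proof.
move=> u hu A; apply: zblocks_inj; rewrite sval_blockact.
have [hu'|->] : List.In u (locproj 5 3 5 5) \/ u = (wd "012", 5).
  by move: hu => /=; intuition.
  by apply: preact_holds => //; exact: relr.
rewrite wact_preact; apply: funext => y; apply: propext.
have e : wact r (rev zw) y = z y.
  by apply: (wact_inj rK (w := zw)); rewrite wactK_rev // -/z zK.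
have Cz : zclass z by exists [::].
rewrite -/zw e; split; last exact: (svalP A).
by move/(svalP A _ Cz); rewrite zK.
Qed.

Lemma locproj_535_finite x0 : finite_orbit r x0 predT.
Proof.
(* The orbit of [x0] under the normal subgroup generated by the conjugates of [z]: a point of the
   quotient, and finite by Dietzmann's lemma. *)
pose A0 y := exists2 s, List.Forall zclass s & y = compose s x0.
have hA0 : zinvariant A0.
  by move=> f Cf y [s hs ->]; exists (f :: s) => //; constructor.
have hr : satisfies blockact (locproj 5 3 5 5).
  move=> u hu; apply: blockact_relators; move: hu => /=; tauto.
have [l hl] : finite_orbit blockact (exist _ A0 hA0) predT.
  apply: (finite_cosets (J := not_r0) (steps := [::]) (k := 200) blockactK blockact_relators).
    apply: (@vertex_figure_finite _ _ blockactK 3 5 5); first by do 3 right; left.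
    by move=> u /(vertex_relators_sub 5); exact: hr.
  by vm_compute.
apply: (@finite_blocks _ _ rK _ A0 [seq sval A | A <- l]).
- by exists [::].
- exact: (finite_compose zclassK zclassJ zclass_finite).
- move=> w; rewrite -(sval_blockact w (exist _ A0 hA0)).
  by apply: List.in_map; apply: hl; exact: all_predT.
Qed.

End LocallyProjective535.

(** * Which facets are compatible with a projective vertex figure *)

Definition spherical_types : seq (nat * nat) :=
  [:: (3, 3); (4, 3); (3, 4); (5, 3); (3, 5)].

Lemma all_In (T : Type) (P : T -> bool) s x : all P s -> List.In x s -> P x.
Proof. by elim: s => //= y s IH /andP[Py /IH h] [<-|]. Qed.

(** The first test treats facets {2,q}. For facets {p,2} the relation [(r1 r2)^2 = 1] gives
    [r1 = r2] if [q] is odd; if [q = 4], [r1] commutes with [r2] and [r3], so [(r1 r2 r3)^3 = 1] and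
    [(r2 r3)^3 = 1] force [r1 = 1]. A facet {p,q'} with [q'] different from [q] also gives
    [r1 = r2], because 3, 4 and 5 are pairwise coprime. *)
Definition type_check (t : nat * nat * nat) : bool :=
  let: (q, s, h) := t in
  [&& locproj_closes 2 q s h,
      fixes_one (enumerate ((wd "12", 2) :: vertex_relators q s h) [::] [::] 200)
        (if q == 4 then wd "1" else wd "12") &
      all (fun pq => if pq.2 == q
             then ((pq.1, q, s, h) == (5, 3, 5, 5)) || locproj_closes pq.1 q s h
             else fixes_one (enumerate [:: (wd "12", pq.2); (wd "12", q)] [::] [::] 200)
                    (wd "12"))
          spherical_types].

Lemma all_types_check : all type_check projective_types.
Proof. by vm_compute. Qed.

Section TypeAnalysis.
Variables (Om : Type) (r : gen -> Om -> Om).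
Hypothesis rK : forall g, involutive (r g).
Hypothesis r1_free : forall x, r r1 x <> x.
Hypothesis r12_free : forall x, r r1 x <> r r2 x.
Hypothesis commr : satisfies r [:: (wd "13", 2); (wd "03", 2); (wd "02", 2)].

Definition spherical_facet :=
  [\/ exists p q, List.In (p, q) spherical_types /\
        satisfies r [:: (wd "12", q); (wd "01", p)],
      holds r (relword (wd "12", 2)) | holds r (relword (wd "01", 2))].

Definition projective_vertex_figure := exists q s h,
  List.In (q, s, h) projective_types /\
  satisfies r [:: (wd "23", s); (wd "12", q); (wd "123", h)].


(** The types that do not fit together are refuted by the flips: [r1] fixes no flag and never agrees
    with [r2] on one. For the others the order of [r0 r1] completes the presentation
    [locproj p q s h]. *)
Theorem locproj_finite x0 :
  spherical_facet -> projective_vertex_figure -> finite_orbit r x0 predT.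
Proof.
move=> hf [q [s [h [hq hv]]]].
have locprojI p : holds r (relword (wd "01", p)) -> satisfies r (locproj p q s h).
  move=> hp u /=; case=> [<-|[<-|[<-|[<-|[<-|[<-|[<-|//]]]]]]] //;
    by [apply: commr; left | apply: commr; right; left | apply: commr; right; right; left
       | apply: hv; left | apply: hv; right; left | apply: hv; right; right; left].
have r12_trivial R : satisfies r R -> fixes_one (enumerate R [::] [::] 200) (wd "12") -> False.
  move=> hR c; apply: (r12_free (x := x0)).
  have e : wact r (wd "12") x0 = x0 by apply: (enumerate_fixes rK hR _ c).
  by rewrite -{2}e /= rK.
have := all_In all_types_check hq; rewrite {1}/type_check.
case/and3P => c2 c12 hall.
case: hf => [[p [q' [hp hf]]]|h12|h01]; last first.
- exact: (locproj_finite_of_closed rK x0 hq (locprojI 2 h01) c2).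
- have hR : satisfies r ((wd "12", 2) :: vertex_relators q s h).
    move=> u [<-//|[<-|hu]]; first by apply: commr; left.
    exact: hv.
  move: c12; case: ifP => _ c; last by case: (r12_trivial _ hR c).
  by case: (@r1_free x0); apply: (enumerate_fixes rK hR _ c).
- have := all_In hall hp; cbv beta; case: ifP => [/eqP eq|_]; last first.
    move=> c; case: (r12_trivial _ _ c) => u [<-|[<-|//]].
      by apply: hf; left.
    by apply: hv; right; left.
  have {}eq : q' = q := eq; subst q'.
  have hl := locprojI p (hf _ (or_intror (or_introl erefl))).
  case/orP => [/eqP[ep eq es eh]|]; last exact: (locproj_finite_of_closed rK x0 hq hl).
  by move: hl; rewrite ep eq es eh => hl; exact: locproj_535_finite.
Qed.

End TypeAnalysis.

(** * Duality *)

Lemma map_relword f u : map f (relword u) = relword (map f u.1, u.2).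
Proof. by rewrite /relword /power map_flatten map_nseq. Qed.

Definition mirror (g : gen) : gen :=
  match g with r0 => r3 | r1 => r2 | r2 => r1 | r3 => r0 end.

Lemma map_mirrorK : involutive (map mirror).
Proof. by elim=> //= -[] w ->. Qed.

Section Mirror.
Variables (Om : Type) (r : gen -> Om -> Om).
Hypothesis rK : forall g, involutive (r g).

Lemma wact_mirror w : wact (fun g => r (mirror g)) w =1 wact r (map mirror w).
Proof. by elim: w => //= g w IH x; exact: IH. Qed.

(** The reversal restores the increasing order of the letters: [r0 r1 r2] is mirrored to [r3 r2 r1],
    whose reverse [r1 r2 r3] is the form used in [locproj]. *)
Lemma holds_mirror w k : holds r (relword (w, k)) ->
  holds (fun g => r (mirror g)) (relword (rev (map mirror w), k)).
Proof.
move=> h x; rewrite wact_mirror map_relword /= map_rev map_mirrorK.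
by rewrite /relword /= power_rev (holds_rev rK h).
Qed.

Lemma finite_orbit_mirror x0 :
  finite_orbit (fun g => r (mirror g)) x0 predT -> finite_orbit r x0 predT.
Proof.
move=> [l hl]; exists l => w _; have := hl (map mirror w) (all_predT _).
by rewrite wact_mirror map_mirrorK.
Qed.

End Mirror.

(** * Codes of the rank 3 models *)

Definition strict (C : Type) (R : rel C) : rel C := fun a b => R a b && ~~ R b a.
(* The order of a model is antisymmetric, so this is equality of the coded
   faces. *)
Definition mutual (C : Type) (R : rel C) : rel C := fun a b => R a b && R b a.

Section ModelCheck.
Variables (C : eqType) (L : seq C) (R : rel C).

Definition proper_codes : seq C :=
  [seq a <- L | has (fun b => strict R b a) L && has (strict R a) L].

(** Lists every possible result of exchanging one face, instead of the unique one. Thus the diamond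
    property of the models is never proved: an actual flip is among the candidates, and [code_loop]
    requires all candidate paths to return to their start. *)
Definition code_steps (P : seq C) (g : gen) (t : C * C * C) : seq (C * C * C) :=
  let: (a, b, c) := t in
  match g with
  | r0 => [seq (x, b, c) | x <- P & strict R x b && ~~ mutual R x a]
  | r1 => [seq (a, x, c) | x <- P & [&& strict R a x, strict R x c & ~~ mutual R x b]]
  | _ => [seq (a, b, x) | x <- P & strict R b x && ~~ mutual R x c]
  end.

Definition code_ends (P : seq C) (w : word) (t : C * C * C) : seq (C * C * C) :=
  foldl (fun ts g => flatten [seq code_steps P g t | t <- ts]) [:: t] w.

Definition code_loop (P : seq C) (w : word) (t : C * C * C) : bool :=
  let: (a, b, c) := t in
  all (fun t' => let: (a', b', c') := t' in [&& mutual R a a', mutual R b b' & mutual R c c'])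
      (code_ends P w t).

Definition codes_satisfy (rels : seq relator) : bool :=
  let P := proper_codes in
  all (fun a => all (fun b => all (fun c =>
      all (fun u => code_loop P (relword u) (a, b, c)) rels)
    [seq c <- P | strict R b c]) [seq b <- P | strict R a b]) P.

End ModelCheck.

(** * Computable copies of the models: vertex sets as bit masks *)

Fixpoint submask (a b : bitseq) : bool :=
  match a, b with
  | x :: a', y :: b' => (x ==> y) && submask a' b'
  | _, _ => true
  end.

Fixpoint allmasks (n : nat) : seq bitseq :=
  if n is n'.+1
  then [seq false :: m | m <- allmasks n'] ++ [seq true :: m | m <- allmasks n']
  else [:: [::]].

Fixpoint submasks (m : bitseq) : seq bitseq :=
  if m is b :: m' then
    [seq false :: x | x <- submasks m'] ++
    (if b then [seq true :: x | x <- submasks m'] else [::])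
  else [:: [::]].

Fixpoint lexle (a b : bitseq) : bool :=
  match a, b with
  | x :: a', y :: b' => if x == y then lexle a' b' else y
  | _, _ => true
  end.

Definition permute (p : nat -> nat) (m : bitseq) : bitseq :=
  [seq nth false m (p i) | i <- iota 0 (size m)].

(* The code of the class {A, sigma A} is the smaller of the two masks. *)
Definition hemi_codes (p : nat -> nat) (L : seq bitseq) : seq bitseq :=
  [seq m <- L | lexle m (permute p m)].
Definition hemi_submask (p : nat -> nat) (a b : bitseq) : bool :=
  submask a b || submask a (permute p b).

Definition tet_codes := allmasks 4.

Definition oct_mask (m : bitseq) : bool :=
  all id m || all (fun i => ~~ (nth false m i.*2 && nth false m i.*2.+1)) (iota 0 3).
Definition oct_codes := [seq m <- allmasks 6 | oct_mask m].
Definition oct_perm (i : nat) : nat := if odd i then i.-1 else i.+1.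

Definition tri_mask (a b c : nat) : bitseq :=
  [seq [|| i == a, i == b | i == c] | i <- iota 0 12].
Definition ico_masks : seq bitseq :=
  flatten [seq [:: tri_mask 0 (1 + i) (1 + (i.+1 %% 5));
                   tri_mask 11 (6 + i) (6 + (i.+1 %% 5));
                   tri_mask (1 + i) (1 + (i.+1 %% 5)) (6 + i);
                   tri_mask (6 + i) (6 + (i.+1 %% 5)) (1 + (i.+1 %% 5))]
          | i <- iota 0 5].
(** Generated from the 20 triangles instead of filtered out of all 4096 masks. *)
Definition ico_codes : seq bitseq :=
  undup (nseq 12 true :: flatten [seq submasks m | m <- ico_masks]).

Definition opposite (C : Type) (R : rel C) : rel C := fun a b => R b a.

Definition face_rels (p q : nat) : seq relator := [:: (wd "01", p); (wd "12", q)].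
Definition petrie_rels (p q h : nat) : seq relator := (wd "012", h) :: face_rels p q.

Lemma tet_check : codes_satisfy tet_codes submask (face_rels 3 3).
Proof. by vm_compute. Qed.
Lemma oct_check : codes_satisfy oct_codes submask (face_rels 3 4).
Proof. by vm_compute. Qed.
Lemma cube_check : codes_satisfy oct_codes (opposite submask) (face_rels 4 3).
Proof. by vm_compute. Qed.
Lemma ico_check : codes_satisfy ico_codes submask (face_rels 3 5).
Proof. by vm_compute. Qed.
Lemma dod_check : codes_satisfy ico_codes (opposite submask) (face_rels 5 3).
Proof. by vm_compute. Qed.
Lemma hemioct_check :
  codes_satisfy (hemi_codes oct_perm oct_codes) (hemi_submask oct_perm) (petrie_rels 3 4 3).
Proof. by vm_compute. Qed.
Lemma hemicube_check :
  codes_satisfy (hemi_codes oct_perm oct_codes) (opposite (hemi_submask oct_perm))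
    (petrie_rels 4 3 3).
Proof. by vm_compute. Qed.
Lemma hemiico_check :
  codes_satisfy (hemi_codes ico_anti_nat ico_codes) (hemi_submask ico_anti_nat) (petrie_rels 3 5 5).
Proof. by vm_compute. Qed.
Lemma hemidod_check :
  codes_satisfy (hemi_codes ico_anti_nat ico_codes)
    (opposite (hemi_submask ico_anti_nat)) (petrie_rels 5 3 5).
Proof. by vm_compute. Qed.

Definition coded (A : Type) (la : A -> A -> Prop) (L : seq bitseq) (R : rel bitseq) :=
  exists code : A -> bitseq,
    (forall a, code a \in L) /\ (forall a b, la a b <-> R (code a) (code b)).

Lemma coded_iso (A B : Type) (la : A -> A -> Prop) (lb : B -> B -> Prop) L R :
  order_iso la lb -> coded lb L R -> coded la L R.
Proof.
move=> [f [_ hf]] [code [hL hR]]; exists (code \o f); split=> [a|a b] /=; first exact: hL.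
by rewrite hf hR.
Qed.

Lemma coded_dual (A : Type) (la : A -> A -> Prop) L R :
  coded la L R -> coded (dual_rel la) L (opposite R).
Proof. by move=> [code [hL hR]]; exists code; split=> // a b; rewrite /dual_rel hR. Qed.

Section Masks.
Variables (V : finType) (n : nat) (e : nat -> V).
Hypothesis eP : forall v, exists2 i, i < n & v = e i.
Implicit Types A B : {set V}.

Definition bits A : bitseq := [seq e i \in A | i <- iota 0 n].

Lemma size_bits A : size (bits A) = n.
Proof. by rewrite size_map size_iota. Qed.

Lemma nth_bits A i : i < n -> nth false (bits A) i = (e i \in A).
Proof. by move=> lt; rewrite (nth_map 0) ?size_iota // nth_iota. Qed.

Lemma submaskP a b : size a = size b ->
  reflect (forall i, i < size a -> nth false a i -> nth false b i) (submask a b).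
Proof.
elim: a b => [|x a IH] [|y b] //= => [_|[es]]; first by constructor.
apply: (iffP andP) => [[/implyP xy /(IH _ es) h] [|i]|h] //=; first exact: h.
by split; [apply/implyP; exact: (h 0) | apply/(IH _ es) => i; exact: (h i.+1)].
Qed.

Lemma submask_bits A B : (A \subset B) = submask (bits A) (bits B).
Proof.
apply/subsetP/(submaskP); rewrite ?size_bits // => h.
  by move=> i lt; rewrite !nth_bits //; exact: h.
by move=> v; have [i lt ->] := eP v; move: (h i lt); rewrite !nth_bits.
Qed.

Lemma bits_setT : bits [set: V] = nseq n true.
Proof.
apply: (@eq_from_nth _ false); rewrite size_bits ?size_nseq // => i lt.
by rewrite nth_bits // nth_nseq lt inE.
Qed.

Lemma mem_allmasks m : m \in allmasks (size m).
Proof.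
by elim: m => // -[] m IH /=; rewrite mem_cat map_f ?orbT.
Qed.

Lemma mem_submasks a m : size a = size m -> submask a m -> a \in submasks m.
Proof.
elim: a m => [|x a IH] [|y m] //= [es] /andP[xy /(IH _ es) h].
by rewrite mem_cat; case: x y xy => -[] // _; rewrite map_f ?orbT.
Qed.

Lemma vfaces_coded (face : pred {set V}) (L : seq bitseq) :
  (forall A, face A -> bits A \in L) -> coded (vfaces_rel face) L submask.
Proof.
move=> h; exists (fun A : vfaces_car face => bits (sval A)); split=> [[A fA]|A B]; first exact: h.
by rewrite -submask_bits.
Qed.

Variables (sigma : V -> V) (p : nat -> nat).
Hypothesis sigmaK : involutive sigma.
Hypothesis sigma_e : forall i, i < n -> sigma (e i) = e (p i) /\ p i < n.

Lemma bits_imset A : bits (sigma @: A) = permute p (bits A).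
Proof.
apply: (@eq_from_nth _ false); rewrite /permute size_map size_iota !size_bits // => i lt.
rewrite nth_bits // (nth_map 0) ?size_iota // nth_iota // add0n.
have [es ltp] := sigma_e lt; rewrite nth_bits // -es.
by rewrite -{1}[e i]sigmaK (mem_imset _ _ (inv_inj sigmaK)).
Qed.

Lemma lexle_total a b : lexle a b || lexle b a.
Proof.
elim: a b => [|x a IH] [|y b] //=; rewrite [y == x]eq_sym.
by case: eqP => // ne; case: x y ne => -[].
Qed.

Lemma imset_sigmaK A : sigma @: (sigma @: A) = A.
Proof.
by rewrite -imset_comp -[RHS]imset_id; apply: eq_imset => v; exact: sigmaK.
Qed.

(** The member of a class with the smaller mask represents it. It may be [sigma @: A], whose mask
    must again belong to [L]; this is tested on the masks, instead of proving [face] stable under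
    [sigma]. *)
Lemma hemi_coded (face : pred {set V}) (L : seq bitseq) :
  (forall A, face A -> bits A \in L) ->
  all (fun m => permute p m \in L) L ->
  coded (hemi_rel face sigma) (hemi_codes p L) (hemi_submask p).
Proof.
move=> hL /allP hp.
have rep (X : hemi_car face sigma) : {A : {set V} |
    bits A \in hemi_codes p L /\ sval X = [set A; sigma @: A]}.
  apply: cid; case: X => X /= /existsP[A /andP[fA /eqP ->]].
  have AL := hL _ fA; have := lexle_total (bits A) (permute p (bits A)).
  case/orP => h; first by exists A; rewrite mem_filter h.
  exists (sigma @: A); rewrite imset_sigmaK setUC mem_filter bits_imset.
  have -> : permute p (permute p (bits A)) = bits A by rewrite -!bits_imset imset_sigmaK.
  by rewrite h (hp _ AL).
exists (fun X : hemi_car face sigma => bits (sval (rep X))); split=> [X|X Y].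
  by case: (rep X) => A [].
case: (rep X) (rep Y) => A [_ eX] [B [_ eY]] /=.
have -> : hemi_rel face sigma X Y =
    [exists A in sval X, exists B in sval Y, A \subset B] by [].
rewrite eX eY.
rewrite /hemi_submask -bits_imset -!submask_bits.
(* Moving [sigma] across an inclusion reduces the four comparisons between two classes to the two in
   [hemi_submask]. *)
have sub_sigma (A' B' : {set V}) : (sigma @: A' \subset B') = (A' \subset sigma @: B').
  by apply/idP/idP => /(imsetS sigma); rewrite imset_sigmaK.
split=> [/exists_inP[A']|].
  rewrite !inE => /orP[] /eqP -> /exists_inP[B']; rewrite !inE => /orP[] /eqP ->;
    rewrite ?sub_sigma ?imset_sigmaK => -> //; exact: orbT.
case/orP=> h; apply/exists_inP; exists A; rewrite ?inE ?eqxx //; apply/exists_inP.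
  by exists B; rewrite ?inE ?eqxx.
by exists (sigma @: B); rewrite ?inE ?eqxx ?orbT.
Qed.

End Masks.

Lemma tet_coded : coded (vfaces_rel tet_face) tet_codes submask.
Proof.
have eP (v : 'I_4) : exists2 i, i < 4 & v = inord i.
  by exists v; rewrite ?inord_val.
apply: (vfaces_coded eP) => A _; rewrite /tet_codes -{2}(size_bits 4 (@inord 3) A).
exact: mem_allmasks.
Qed.

(** Antipodal vertices are numbered [2 i] and [2 i + 1], so that [oct_perm] exchanges neighbouring
    bits. *)
Definition oct_vertex (i : nat) : oct_V := (inord i./2, ~~ odd i).

Lemma oct_vertexP (v : oct_V) : exists2 i, i < 6 & v = oct_vertex i.
Proof.
case: v => i b; exists (~~ b + i.*2).
  by case: i => -[|[|[|]]] // ? /=; case: b.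
by rewrite /oct_vertex half_bit_double inord_val oddD odd_double addbF oddb negbK.
Qed.

Lemma oct_face_mask A : oct_face A -> bits 6 oct_vertex A \in oct_codes.
Proof.
move=> fA; rewrite mem_filter; apply/andP; split; last first.
  by rewrite -{2}(size_bits 6 oct_vertex A) mem_allmasks.
case/orP: fA => [/eqP ->|/forallP h]; first by rewrite bits_setT.
apply/orP; right; apply/allP => i; rewrite mem_iota add0n => /andP[_ lt].
have lt2 : i.*2.+1 < 6 by case: i lt => [|[|[|]]].
rewrite !nth_bits //; last exact: ltnW.
by have := h (inord i); rewrite /oct_vertex /= uphalf_double odd_double doubleK.
Qed.

Lemma oct_antiK : involutive oct_anti.
Proof. by case=> i b; rewrite /oct_anti /= negbK. Qed.

Lemma oct_anti_vertex i : i < 6 ->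
  oct_anti (oct_vertex i) = oct_vertex (oct_perm i) /\ oct_perm i < 6.
Proof. by case: i => [|[|[|[|[|[|]]]]]]. Qed.

Lemma oct_coded : coded (vfaces_rel oct_face) oct_codes submask.
Proof. exact: (vfaces_coded oct_vertexP oct_face_mask). Qed.

Lemma hemi_oct_coded : coded (hemi_rel oct_face oct_anti)
  (hemi_codes oct_perm oct_codes) (hemi_submask oct_perm).
Proof.
apply: (hemi_coded oct_vertexP oct_antiK oct_anti_vertex oct_face_mask).
by vm_compute.
Qed.

Lemma ico_vertexP (v : 'I_12) : exists2 i, i < 12 & v = inord i.
Proof. by exists v; rewrite ?inord_val. Qed.

Lemma bits_ico_tri a b c : a < 12 -> b < 12 -> c < 12 ->
  bits 12 (@inord 11) (ico_tri a b c) = tri_mask a b c.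
Proof.
move=> la lb lc; apply/eq_in_map => i; rewrite mem_iota add0n => /andP[_ li].
by rewrite !inE -!val_eqE /= !inordK // orbA.
Qed.

Lemma bits_ico_tris : [seq bits 12 (@inord 11) t | t <- ico_tris] = ico_masks.
Proof.
rewrite /ico_tris /ico_masks map_flatten -map_comp; congr flatten.
apply/eq_in_map => i; rewrite mem_iota add0n => /andP[_ li] /=.
have lm := ltn_pmod i.+1 (isT : 0 < 5).
have l1 : 1 + i.+1 %% 5 < 12 by apply: leq_trans (_ : 1 + 5 < 12); rewrite // ltnS leq_add2l ltnW.
have l6 : 6 + i.+1 %% 5 < 12 by apply: leq_trans (_ : 6 + 5 < 12); rewrite // ltnS leq_add2l ltnW.
have i1 : 1 + i < 12 by apply: leq_trans (_ : 1 + 5 < 12); rewrite // ltnS leq_add2l ltnW.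
have i6 : 6 + i < 12 by apply: leq_trans (_ : 6 + 5 < 12); rewrite // ltnS leq_add2l ltnW.
by rewrite !bits_ico_tri.
Qed.

Lemma ico_face_mask A : ico_face A -> bits 12 (@inord 11) A \in ico_codes.
Proof.
rewrite mem_undup inE => /orP[/eqP ->|/hasP[t tt At]].
  by rewrite bits_setT eqxx.
apply/orP; right; apply/flattenP; exists (submasks (bits 12 (@inord 11) t)).
  by apply: map_f; rewrite -bits_ico_tris; apply: map_f.
by apply: mem_submasks; rewrite ?size_bits // -submask_bits //; exact: ico_vertexP.
Qed.

Lemma ico_anti_vertex i : i < 12 ->
  ico_anti (inord i) = inord (ico_anti_nat i) /\ ico_anti_nat i < 12.
Proof.
move=> li; rewrite /ico_anti inordK //; split=> //; move: i li.
by do 12 (case=> [//|]).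
Qed.

Lemma ico_antiK : involutive ico_anti.
Proof.
move=> v; have [i li ->] := ico_vertexP v.
have [-> li'] := ico_anti_vertex li; have [-> _] := ico_anti_vertex li'.
by congr inord; move: i li {li' v}; do 12 (case=> [//|]).
Qed.

Lemma ico_coded : coded (vfaces_rel ico_face) ico_codes submask.
Proof. exact: (vfaces_coded ico_vertexP ico_face_mask). Qed.

Lemma hemi_ico_coded : coded (hemi_rel ico_face ico_anti)
  (hemi_codes ico_anti_nat ico_codes) (hemi_submask ico_anti_nat).
Proof.
apply: (hemi_coded ico_vertexP ico_antiK ico_anti_vertex ico_face_mask).
by vm_compute.
Qed.

Lemma order_iso_trans (A B C : Type) (la : A -> A -> Prop) (lb : B -> B -> Prop)
    (lc : C -> C -> Prop) : order_iso la lb -> order_iso lb lc -> order_iso la lc.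
Proof.
move=> [f [bf hf]] [g [bg hg]]; exists (g \o f); split; first exact: bij_comp.
by move=> x y; rewrite hf hg.
Qed.

Lemma projective_coded (A : Type) (la : A -> A -> Prop) : is_projective3 la ->
  exists p q h L R, [/\ List.In (p, q, h) projective_types,
    codes_satisfy L R (petrie_rels p q h) & coded la L R].
Proof.
case=> /coded_iso hc.
- exists 4, 3, 3, (hemi_codes oct_perm oct_codes), (opposite (hemi_submask oct_perm)).
  by split; [left | exact: hemicube_check | apply: hc; exact: coded_dual hemi_oct_coded].
- exists 3, 4, 3, (hemi_codes oct_perm oct_codes), (hemi_submask oct_perm).
  by split; [right; left | exact: hemioct_check | apply: hc; exact: hemi_oct_coded].
- exists 5, 3, 5, (hemi_codes ico_anti_nat ico_codes), (opposite (hemi_submask ico_anti_nat)).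
  by split; [do 2 right; left | exact: hemidod_check | apply: hc; exact: coded_dual hemi_ico_coded].
- exists 3, 5, 5, (hemi_codes ico_anti_nat ico_codes), (hemi_submask ico_anti_nat).
  by split; [do 3 right; left | exact: hemiico_check | apply: hc; exact: hemi_ico_coded].
Qed.

(** A projective model is filed under the type of its spherical cover: for the section on the other
    side from the projective one, only the two face relators are used. *)
Lemma sph_or_proj_coded (A : Type) (la : A -> A -> Prop) : sph_or_proj3 la ->
  (exists p q L R rels, [/\ List.In (p, q) spherical_types,
     List.incl (face_rels p q) rels, codes_satisfy L R rels & coded la L R]) \/
  (exists p, order_iso la (@dih_rel p) \/ order_iso la (dual_rel (@dih_rel p))).
Proof.
case=> [|/projective_coded[p [q [h [L [R [hpq hs hc]]]]]]]; last first.
  left; exists p, q, L, R, (petrie_rels p q h); split=> //; last by move=> u ?; right.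
  by case: hpq => [|[|[|[|//]]]] [<- <- _]; rewrite /=; tauto.
case=> [/coded_iso hc|[/coded_iso hc|[/coded_iso hc|[/coded_iso hc|[/coded_iso hc|]]]]].
- left; exists 3, 3, tet_codes, submask, (face_rels 3 3).
  by split; [left | exact: List.incl_refl | exact: tet_check | apply: hc; exact: tet_coded].
- left; exists 4, 3, oct_codes, (opposite submask), (face_rels 4 3).
  by split; [right; left | exact: List.incl_refl | exact: cube_check
    | apply: hc; exact: coded_dual oct_coded].
- left; exists 3, 4, oct_codes, submask, (face_rels 3 4).
  by split; [do 2 right; left | exact: List.incl_refl | exact: oct_check
    | apply: hc; exact: oct_coded].
- left; exists 5, 3, ico_codes, (opposite submask), (face_rels 5 3).
  by split; [do 3 right; left | exact: List.incl_refl | exact: dod_check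
    | apply: hc; exact: coded_dual ico_coded].
- left; exists 3, 5, ico_codes, submask, (face_rels 3 5).
  by split; [do 4 right; left | exact: List.incl_refl | exact: ico_check
    | apply: hc; exact: ico_coded].
- by case=> p [_ hp]; right; exists p.
Qed.

(** * Dihedra *)

Definition dih_level (p : nat) (x : dih_face p) : nat :=
  match x with DBot => 0 | DV _ => 1 | DE _ => 2 | DF _ => 3 | DTop => 4 end.

Lemma dih_rel_level p (x y : dih_face p) : dih_rel x y -> x = y \/ dih_level x < dih_level y.
Proof. by case: x y => [|i|i|b|] [|j|j|b'|] //= h; auto; left; rewrite h. Qed.

Lemma projective_iso (A B : Type) (la : A -> A -> Prop) (lb : B -> B -> Prop) :
  order_iso la lb -> is_projective3 lb -> is_projective3 la.
Proof.
by move=> e [] h; [constructor 1|constructor 2|constructor 3|constructor 4];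
  exact: order_iso_trans e h.
Qed.

(** * Flags *)

(** The level, that is rank plus one, of the face that [g] exchanges. Levels 0 and 5 are those of
    the least and the greatest face. *)
Definition idx (g : gen) : nat := match g with r0 => 1 | r1 => 2 | r2 => 3 | r3 => 4 end.

Lemma idx_inj : injective idx.
Proof. by case=> -[]. Qed.

Lemma idx_range g : 0 < idx g < 5.
Proof. by case: g. Qed.

Lemma idxP i : 0 < i < 5 -> exists g, i = idx g.
Proof.
by case: i => [|[|[|[|[|]]]]] // _; [exists r0 | exists r1 | exists r2 | exists r3].
Qed.

Section Polytope.
Variables (T : Type) (le : T -> T -> Prop).
Hypothesis polytope : abstract_polytope le 4.

Local Notation lt := (ltp le).

Let le_refl x : le x x.
Proof. by case: polytope => -[h _ _] _ _ _ _; exact: h. Qed.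
Let le_anti x y : le x y -> le y x -> x = y.
Proof. by case: polytope => -[_ h _] _ _ _ _; exact: h. Qed.
Let le_trans y x z : le x y -> le y z -> le x z.
Proof. by case: polytope => -[_ _ h] _ _ _ _; exact: h. Qed.

Let lt_trans y x z : lt x y -> lt y z -> lt x z.
Proof.
move=> [xy ne] [yz _]; split; first exact: le_trans yz.
by move=> e; apply: ne; apply: le_anti => //; rewrite e.
Qed.

Let lt_irr x : ~ lt x x.
Proof. by case. Qed.

Variables bot top : T.
Hypothesis botP : is_least le bot.
Hypothesis topP : is_greatest le top.

Lemma chain_flag (C : T -> Prop) : is_chain le C ->
  exists D, is_flag le D /\ forall x, C x -> D x.
Proof.
(* With [C] adjoined in [P], the empty union, which Zorn's lemma also asks about, satisfies it. *)
move=> hC; pose P (X : T -> Prop) := is_chain le (fun x => X x \/ C x).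
have [A [PA maxA]] : exists A, P A /\ forall B, classical_sets.proper A B -> ~ P B.
  apply: classical_sets.Zorn_bigcup => F hF tot x y [[X FX Xx]|Cx] [[Y FY Yy]|Cy].
  - by case: (tot X Y FX FY) => sub;
      [apply: (hF Y FY); left => //; exact: sub | apply: (hF X FX); left => //; exact: sub].
  - by apply: (hF X FX); [left | right].
  - by apply: (hF Y FY); [right | left].
  - exact: hC.
exists (fun x => A x \/ C x); split; last by right.
split=> // D hD sub x Dx; left.
have PD : P D by move=> y z [Dy|Cy] [Dz|Cz]; apply: hD => //; apply: sub; right.
have [//|nA] := pselect (A x).
by case: (maxA D) => //; split=> [y Ay|sub']; [apply: sub; left | apply: nA; exact: sub'].
Qed.

Definition ext (F : gen -> T) (n : nat) : T :=
  match n with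
  | 0 => bot | 1 => F r0 | 2 => F r1 | 3 => F r2 | 4 => F r3 | _ => top
  end.

Lemma ext_idx F g : ext F (idx g) = F g.
Proof. by case: g. Qed.

Definition increasing (F : gen -> T) := forall i, i < 5 -> lt (ext F i) (ext F i.+1).

Definition faces (F : gen -> T) (x : T) := exists2 i, i < 6 & x = ext F i.

Section Increasing.
Variables (F : gen -> T).
Hypothesis incF : increasing F.

Lemma ext_lt i j : i < j -> j < 6 -> lt (ext F i) (ext F j).
Proof.
elim: j => // j IH; rewrite ltnS leq_eqVlt => /orP[/eqP ->|ij] j5; first exact: incF.
by apply: lt_trans (incF _) => //; apply: IH => //; exact: ltnW.
Qed.

Lemma ext_inj i j : i < 6 -> j < 6 -> ext F i = ext F j -> i = j.
Proof.
move=> i6 j6 e; case: (ltngtP i j) => // lt; [have := ext_lt lt j6 | have := ext_lt lt i6];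
  by rewrite e => /lt_irr.
Qed.

Lemma ext_le i j : i <= j -> j < 6 -> le (ext F i) (ext F j).
Proof.
by rewrite leq_eqVlt => /orP[/eqP -> //|ij j6]; case: (ext_lt ij j6).
Qed.

Lemma faces_chain : is_chain le (faces F).
Proof.
move=> _ _ [i i6 ->] [j j6 ->]; case: (leqP i j) => ij; [left|right]; apply: ext_le => //.
exact: ltnW.
Qed.

Lemma NoDup_ext k n : k + n <= 6 -> List.NoDup (List.map (ext F) (List.seq k n)).
Proof.
elim: n k => [|n IH] k h /=; constructor; last by apply: IH; rewrite addSnnS.
move/List.in_map_iff => [j [e /List.in_seq[/ltP kj /ltP jn]]].
have j6 : j < 6 by apply: leq_trans jn _; rewrite plusE addSnnS.
by have := ext_inj j6 (ltn_trans kj j6) e => ej; rewrite ej ltnn in kj.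
Qed.

(** Any chain containing these six faces extends to a flag. That flag has six elements, so nothing
    has been added. *)
Lemma faces_flag : is_flag le (faces F).
Proof.
have sub D : is_flag le D -> (forall x, faces F x -> D x) -> forall x, D x -> faces F x.
  move=> fD FD; have [s [nd [len hs]]] : has_card D 6.
    by case: polytope => _ _ h _ _; exact: h.
  have := List.NoDup_length_incl (NoDup_ext (k := 0) (n := 6) isT).
  move/(_ s); rewrite List.length_map List.length_seq len => /(_ (le_n _)) h x /hs.
  have {}h : List.incl s (List.map (ext F) (List.seq 0 6)).
    apply: h => y /List.in_map_iff [i [<- /List.in_seq[_ /ltP i6]]].
    by apply/hs/FD; exists i.
  by move/h/List.in_map_iff => [i [<- /List.in_seq[_ /ltP i6]]]; exists i.
split; first exact: faces_chain.
move=> D hD FD x Dx; have [E [fE DE]] := chain_flag hD.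
by apply: (sub E) => // [y /FD/DE|]; last exact: DE.
Qed.

Lemma ext_level i : i < 6 -> has_level le (ext F i) i.
Proof.
move=> i6; exists (faces F); split; [exact: faces_flag | by exists i |].
exists (List.map (ext F) (List.seq 0 i)); split; first by apply: NoDup_ext; exact: ltnW.
split; first by rewrite List.length_map List.length_seq.
move=> x; split=> [[[j j6 ->] ltj]|/List.in_map_iff[j [<- /List.in_seq[_ /ltP ji]]]].
  apply/List.in_map; apply/List.in_seq; split; first exact/leP.
  apply/ltP; rewrite plusE add0n ltnNge; apply/negP => ij.
  by case: ltj => l ne; case: ne; apply: le_anti l (ext_le ij j6).
split; last exact: ext_lt.
by exists j => //; exact: ltn_trans i6.
Qed.

End Increasing.

Lemma sorted_insert a (s : list T) : Sorted.StronglySorted lt s ->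
  (forall x, List.In x s -> lt a x \/ lt x a) ->
  exists s', [/\ size s' = (size s).+1, forall x, List.In x s' <-> a = x \/ List.In x s
    & Sorted.StronglySorted lt s'].
Proof.
elim: s => [|b s IH] so h.
  by exists [:: a]; split=> //; repeat constructor.
have [so' /List.Forall_forall hb] := Sorted.StronglySorted_inv so.
case: (h b (or_introl erefl)) => [ab|ba].
  exists (a :: b :: s); split=> //; constructor=> //; constructor=> //.
  by apply/List.Forall_forall => x /hb; exact: lt_trans.
have [|s' [sz in' so'']] := IH so'; first by move=> x xs; apply: h; right.
exists (b :: s'); split=> [|x|]; first by rewrite /= sz.
  by rewrite /= in'; tauto.
by constructor=> //; apply/List.Forall_forall => x /in' [<-|/hb].
Qed.

(** Insertion sort as an existence statement, [le] being only a proposition. *)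
Lemma chain_sort (s : list T) : List.NoDup s ->
  (forall x y, List.In x s -> List.In y s -> le x y \/ le y x) ->
  exists s', [/\ size s' = size s, forall x, List.In x s' <-> List.In x s
    & Sorted.StronglySorted lt s'].
Proof.
elim: s => [|a s IH] nd hs; first by exists [::]; split=> //; constructor.
have [nas {}nd] := proj1 (List.NoDup_cons_iff _ _) nd.
have [|s1 [sz in1 so1]] := IH nd; first by move=> x y xs ys; apply: hs; right.
have [|s2 [sz2 in2 so2]] := sorted_insert (a := a) so1.
  move=> x /in1 xs; have ne : a <> x by move=> e; apply: nas; rewrite e.
  case: (hs a x (or_introl erefl) (or_intror xs)) => l; [left | right]; split=> //.
  exact: nesym.
exists s2; split=> //=; first by rewrite sz2 sz.
by move=> x; rewrite in2 in1.
Qed.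

Lemma sorted_nth x0 (s : list T) i j : Sorted.StronglySorted lt s ->
  i < j -> j < size s -> lt (nth x0 s i) (nth x0 s j).
Proof.
have nth_In k (u : list T) : k < size u -> List.In (nth x0 u k) u.
  by elim: u k => [|y u IH] [|k] //= lk; [left | right; exact: IH].
elim: s i j => [|y s IH] [|i] [|j] // so ij js;
  have [so' /List.Forall_forall h] := Sorted.StronglySorted_inv so.
  by apply: h; exact: (nth_In j s js).
exact: IH.
Qed.

Lemma flag_mem_extreme (C : T -> Prop) x : is_flag le C ->
  (forall y, le x y \/ le y x) -> C x.
Proof.
case=> hC mC hx; apply: (mC (fun y => y = x \/ C y)); [|by right|by left].
move=> y z [->|Cy] [->|Cz]; [by left | exact: hx | | exact: hC].
by case: (hx y); [right|left].
Qed.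

(** The six elements of a flag are sorted. The least and the greatest face belong to every flag and
    so occupy positions 0 and 5; the four in between are indexed by the generators. *)
Lemma flag_faces (C : T -> Prop) : is_flag le C ->
  exists2 F, increasing F & forall x, C x <-> faces F x.
Proof.
move=> fC; have [s [nd [len hs]]] : has_card C 6.
  by case: polytope => _ _ h _ _; exact: h.
have Cbot : C bot by apply: flag_mem_extreme => // y; left; exact: botP.
have Ctop : C top by apply: flag_mem_extreme => // y; right; exact: topP.
have [|s' [sz in' so]] := @chain_sort s nd.
  by move=> x y /hs Cx /hs Cy; case: fC => + _; apply.
have {len}sz : size s' = 6 by rewrite sz -len.
have {in'}hs x : C x <-> exists2 i, i < 6 & x = nth bot s' i.
  rewrite hs -in' -sz; elim: (s') => [|y u IH] /=; first by split=> // -[].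
  rewrite IH; split=> [[<-|[i lt ->]]|[[|i] lt ->]]; [by exists 0|by exists i.+1|by left|].
  by right; exists i.
have lt_nth i j : i < j -> j < 6 -> lt (nth bot s' i) (nth bot s' j).
  by move=> ij j6; apply: sorted_nth; rewrite ?sz.
have e0 : nth bot s' 0 = bot.
  have [[|i] i6 e] := proj1 (hs bot) Cbot => //.
  by have [l ne] := lt_nth 0 i.+1 isT i6; case: ne; rewrite -e in l *; apply: le_anti (botP _).
have e5 : nth bot s' 5 = top.
  have [i i6 e] := proj1 (hs top) Ctop; move: i6; rewrite ltnS leq_eqVlt.
  case/orP => [/eqP i5|i5]; first by rewrite e i5.
  have [l ne] := lt_nth i 5 i5 isT; rewrite -e in l ne.
  by case: ne; apply: le_anti l (topP _).
pose F g := nth bot s' (idx g).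
have eF i : i < 6 -> ext F i = nth bot s' i.
  by case: i => [|[|[|[|[|[|]]]]]].
exists F => [i i5|x]; first by rewrite !eF //; [apply: lt_nth | exact: ltnW].
by rewrite hs; split=> -[i i6 ->]; exists i; rewrite ?eF.
Qed.

Definition set_face (F : gen -> T) (g : gen) (y : T) : gen -> T :=
  fun h => if idx h == idx g then y else F h.

Lemma set_face_same F g y : set_face F g y g = y.
Proof. by rewrite /set_face eqxx. Qed.

Lemma set_face_other F g y h : h <> g -> set_face F g y h = F h.
Proof. by rewrite /set_face; case: eqP => // /idx_inj. Qed.

Lemma ext_set_face F g y i : ext (set_face F g y) i = if i == idx g then y else ext F i.
Proof. by case: i => [|[|[|[|[|i]]]]] //; case: g. Qed.

Definition below F g := ext F (idx g).-1.
Definition above F g := ext F (idx g).+1.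

Lemma set_face_increasing F g y : increasing F -> lt (below F g) y -> lt y (above F g) ->
  increasing (set_face F g y).
Proof.
move=> incF by_ ya i i5; rewrite !ext_set_face.
case: eqP => [ei|ni]; case: eqP => [ei'|ni'].
- by move: ei'; rewrite ei => /esym/n_Sn.
- by move: ya; rewrite /above -ei.
- by move: by_; rewrite /below -ei'.
- exact: incF.
Qed.

Lemma increasing_between F g : increasing F -> lt (below F g) (F g) /\ lt (F g) (above F g).
Proof.
move=> incF; have /andP[g0 g5] := idx_range g; rewrite -(ext_idx F g); split.
  by rewrite /below -{2}(prednK g0); apply: incF; apply: leq_ltn_trans (leq_pred _) g5.
exact: incF.
Qed.

Lemma diamond F g : increasing F -> exists y,
  [/\ y <> F g, lt (below F g) y, lt y (above F g) &
      forall z, lt (below F g) z -> lt z (above F g) -> z = F g \/ z = y].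
Proof.
move=> incF; have [h1 h2] := increasing_between g incF.
have [s [nd [len hs]]] : has_card (fun H => lt (below F g) H /\ lt H (above F g)) 2.
  case: polytope => _ _ _ _ h; apply: (h _ _ (idx g).-1).
  - by apply: ext_level => //; case: (g).
  - by rewrite -(_ : (idx g).+1 = (idx g).-1.+2); [apply: ext_level => //; case: (g) | case: (g)].
  - exact: lt_trans h2.
case: s nd len hs => [|a [|b [|]]] // nd _ hs.
have ab : a <> b by move=> e; move: nd; rewrite e => /List.NoDup_cons_iff[+ _]; apply; left.
have [ha1 ha2] := proj2 (hs a) (or_introl erefl).
have [hb1 hb2] := proj2 (hs b) (or_intror (or_introl erefl)).
case: (proj1 (hs (F g)) (conj h1 h2)) => [e|[e|//]].
  exists b; rewrite -e; split=> // [/esym //|z z1 z2].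
  by case: (proj1 (hs z) (conj z1 z2)) => [->|[->|//]]; [left|right].
exists a; rewrite -e; split=> // z z1 z2.
by case: (proj1 (hs z) (conj z1 z2)) => [->|[->|//]]; [right|left].
Qed.

(** * Exchanging one face of a flag *)

Definition flag := {F : gen -> T | increasing F}.

Lemma flag_inj (F G : flag) : (forall g, sval F g = sval G g) -> F = G.
Proof.
case: F G => [F hF] [G hG] /= e; have e' : F = G by apply: funext.
by subst; rewrite (Prop_irrelevance hF hG).
Qed.

Definition flip (g : gen) (F : flag) : flag :=
  let: exist y hy := cid (diamond g (svalP F)) in
  exist _ (set_face (sval F) g y)
    (let: And4 _ h1 h2 _ := hy in set_face_increasing (svalP F) h1 h2).

Lemma flip_other g F h : h <> g -> sval (flip g F) h = sval F h.
Proof. by rewrite /flip; case: cid => y hy /= ?; rewrite set_face_other. Qed.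

Lemma flip_same g F : sval (flip g F) g <> sval F g.
Proof. by rewrite /flip; case: cid => y [? ? ? ?] /=; rewrite set_face_same. Qed.

Lemma ext_flip g F i : i <> idx g -> ext (sval (flip g F)) i = ext (sval F) i.
Proof.
by move=> ne; rewrite /flip; case: cid => y hy /=; rewrite ext_set_face; case: eqP.
Qed.

Lemma below_eq (F G : gen -> T) g : (forall h, h <> g -> G h = F h) -> below G g = below F g.
Proof. by case: g => h; rewrite /below /= ?h. Qed.

Lemma above_eq (F G : gen -> T) g : (forall h, h <> g -> G h = F h) -> above G g = above F g.
Proof. by case: g => h; rewrite /above /= ?h. Qed.

Lemma flip_unique g (F G : flag) : (forall h, h <> g -> sval G h = sval F h) ->
  sval G g <> sval F g -> G = flip g F.
Proof.
move=> hG nG; apply: flag_inj => h; have [->|ne] := pselect (h = g); last first.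
  by rewrite flip_other // hG.
have [b1 b2] := increasing_between g (svalP G).
rewrite (below_eq hG) in b1; rewrite (above_eq hG) in b2.
rewrite /flip; case: cid => y [? ? ? hy] /=; rewrite set_face_same.
by case: (hy _ b1 b2).
Qed.

Lemma flipK g : involutive (flip g).
Proof.
move=> F; apply/esym/flip_unique => [h ne|]; first by rewrite flip_other.
exact/nesym/flip_same.
Qed.

(** If replacing both faces at once yields a flag, then [flip_unique] identifies it with either
    composite. This serves for distant ranks and, in dihedra, for consecutive ones. *)
Lemma flip_comm g h F : g <> h ->
  increasing (set_face (set_face (sval F) g (sval (flip g F) g)) h (sval (flip h F) h)) ->
  flip g (flip h F) = flip h (flip g F).
Proof.
move=> gh inc; pose D : flag := exist _ _ inc.
have Dh : sval D h = sval (flip h F) h by rewrite /= set_face_same.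
have Dg : sval D g = sval (flip g F) g by rewrite /= set_face_other // set_face_same.
have Do k : k <> g -> k <> h -> sval D k = sval F k.
  by move=> kg kh; rewrite /= !set_face_other.
have <- : D = flip g (flip h F).
  apply: flip_unique => [k kg|]; last by rewrite Dg (flip_other _ gh); exact: flip_same.
  have [->|kh] := pselect (k = h); first by rewrite Dh.
  by rewrite Do // flip_other.
apply: flip_unique => [k kh|]; last first.
  by rewrite Dh (flip_other _ (nesym gh)); exact: flip_same.
have [->|kg] := pselect (k = g); first by rewrite Dg.
by rewrite Do // flip_other.
Qed.

Lemma flip_between g F : lt (below (sval F) g) (sval (flip g F) g) /\
  lt (sval (flip g F) g) (above (sval F) g).
Proof.
have [b1 b2] := increasing_between g (svalP (flip g F)).
have h k : k <> g -> sval (flip g F) k = sval F k by exact: flip_other.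
by rewrite (below_eq h) in b1; rewrite (above_eq h) in b2.
Qed.

(** For non-consecutive ranks the [g]-face is not a neighbour of the [h]-face, so its exchange does
    not disturb the bounds between which the new [h]-face lies. *)
Lemma flip_comm_far g h F : (idx g).+1 < idx h -> flip g (flip h F) = flip h (flip g F).
Proof.
move=> gh; apply: flip_comm; first by move=> e; move: gh; rewrite e ltnNge ltnW.
have [g1 g2] := flip_between g F; have [h1 h2] := flip_between h F.
apply: set_face_increasing => //; first exact: set_face_increasing (svalP F) g1 g2.
  rewrite /below ext_set_face; case: eqP => // e.
  by move: gh; rewrite -e; case: (h).
rewrite /above ext_set_face; case: eqP => // e.
by move: gh; rewrite -e ltnNge ltnW // ltnW.
Qed.

Lemma flip_relators : satisfies flip [:: (wd "13", 2); (wd "03", 2); (wd "02", 2)].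
Proof.
have far g h F : (idx g).+1 < idx h -> flip h (flip g (flip h (flip g F))) = F.
  by move=> gh; rewrite (flip_comm_far (flip g F) gh) !flipK.
by move=> u [<-|[<-|[<-|//]]] F; exact: far.
Qed.

(** Adjacency only says that one element is replaced; the point is that the new element has the same
    rank as the old one. *)
Lemma adjacent_flip (F : flag) D : is_flag le D -> adjacent_flags (faces (sval F)) D ->
  exists g, D = faces (sval (flip g F)).
Proof.
move=> fD [x [y [Fx nDx Dy nFy hz]]]; have [hD mD] := fD; have incF := svalP F.
case: Fx hz nDx => i i6 -> hz nDx.
have Dbot : D bot by apply: flag_mem_extreme => // z; left; exact: botP.
have Dtop : D top by apply: flag_mem_extreme => // z; right; exact: topP.
(* The lost face is proper, because the least and the greatest face also lie in [D]. *)
have [g eg] : exists g, i = idx g.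
  apply: idxP; case: i i6 nDx {hz} => [|[|[|[|[|[|]]]]]] //.
subst i; exists g; rewrite ext_idx in nDx hz.
have Dext j : j < 6 -> j <> idx g -> D (ext (sval F) j).
  move=> j6 ne; apply/hz; last by exists j.
    by rewrite -(ext_idx (sval F)) => /(ext_inj incF j6 i6).
  by move=> e; apply: nFy; exists j.
have nxy : y <> sval F g by move=> e; apply: nFy; exists (idx g); rewrite ?ext_idx.
have [bx xa] := increasing_between g incF.
(* If the two faces were comparable, the lost one could be added to [D], against maximality. Being
   incomparable, the new face can lie neither below the lower neighbour nor above the upper one,
   hence lies between them. *)
have nD' : ~ (le y (sval F g) \/ le (sval F g) y).
  move=> cy; apply: (nDx); apply: (mD (fun z => z = sval F g \/ D z)); [|by right|by left].
  have cmp z : D z -> le (sval F g) z \/ le z (sval F g).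
    move=> Dz; have [->|zy] := pselect (z = y); first by tauto.
    have zx : z <> sval F g by move=> e; apply: nDx; rewrite -e.
    apply: (faces_chain incF); first by exists (idx g); rewrite ?ext_idx.
    exact/(hz z zx zy).
  move=> a b [->|Da] [->|Db]; [by left | exact: cmp | | exact: hD].
  by case: (cmp a Da); [right | left].
have Dbelow : D (below (sval F) g) by apply: Dext; case: (g).
have Dabove : D (above (sval F) g) by apply: Dext; case: (g).
have by_ : lt (below (sval F) g) y.
  split; last by move=> e; apply: nFy; exists (idx g).-1 => //; case: (g).
  by case: (hD _ _ Dbelow Dy) => // l; case: nD'; left; apply: le_trans l (proj1 bx).
have ya : lt y (above (sval F) g).
  split; last by move=> e; apply: nFy; exists (idx g).+1 => //; case: (g).
  by case: (hD _ _ Dabove Dy) => // l; case: nD'; right; apply: le_trans (proj1 xa) l.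
pose G : flag := exist _ _ (set_face_increasing incF by_ ya).
have <- : G = flip g F.
  apply: flip_unique => [h ne|]; first by rewrite /= set_face_other.
  by rewrite /= set_face_same.
apply: funext => z; apply: propext; split=> [Dz|[j j6 ->]].
  have [->|zy] := pselect (z = y).
    by exists (idx g) => //; rewrite ext_set_face eqxx.
  have zx : z <> sval F g by move=> e; apply: nDx; rewrite -e.
  have [j j6 ej] := proj2 (hz z zx zy) Dz; exists j => //=; rewrite ext_set_face.
  by case: eqP => // e; case: zx; rewrite ej e ext_idx.
by rewrite /= ext_set_face; case: eqP => // ne; exact: Dext.
Qed.

Lemma flags_connected (F : flag) C : is_flag le C ->
  exists w, C = faces (sval (wact flip w F)).
Proof.
move=> fC; have [k [Ph [h0 hk hadj hflag]]] : exists k Ph,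
    [/\ forall x, Ph 0 x <-> faces (sval F) x, forall x, Ph k x <-> C x,
        forall i, i < k -> adjacent_flags (Ph i) (Ph i.+1)
    & forall i, i <= k -> is_flag le (Ph i) /\ forall x, faces (sval F) x -> C x -> Ph i x].
  by case: polytope => _ _ _ h _; apply: h => //; exact: faces_flag (svalP F).
have <- : Ph k = C by apply: funext => x; apply: propext.
suff H i : i <= k -> exists w, Ph i = faces (sval (wact flip w F)) by exact: H.
elim: i => [_|i IH lt_ik].
  by exists [::]; apply: funext => x; apply: propext.
have [w e] := IH (ltnW lt_ik); have := hadj _ lt_ik; rewrite e => adj.
have [g eg] := adjacent_flip (proj1 (hflag _ lt_ik)) adj.
by exists (rcons w g); rewrite eg -cats1 wact_cat.
Qed.

Lemma flag_exists : exists F : flag, True.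
Proof.
have [|D [fD _]] := @chain_flag (fun _ => False); first by move=> x y [].
by have [F incF _] := flag_faces fD; exists (exist _ F incF).
Qed.

(** Every face lies in some flag, every flag is reached from [F], and a flag has six faces. *)
Lemma finite_of_flags F : finite_orbit flip F predT -> finite_type T.
Proof.
move=> [l hl]; exists (List.flat_map (fun G : flag => List.map (ext (sval G)) (List.seq 0 6)) l).
move=> t; have [D [fD Dt]] : exists D, is_flag le D /\ forall x, x = t -> D x.
  by apply: chain_flag => x y -> ->; left.
have [w eD] := flags_connected F fD; have := Dt t erefl; rewrite eD => -[i i6 ->].
apply/List.in_flat_map; exists (wact flip w F); split; first by apply: hl; exact: all_predT.
by apply: List.in_map; apply/List.in_seq; split; [exact/leP | exact/ltP].
Qed.

(** * Facets and vertex figures *)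

(* The Boolean b selects the rank 3 section under study: the facet F_3/F_{-1}
   of a flag if it is false, the vertex figure F_4/F_0 if it is true. *)
Definition shift (b : bool) (g : gen) : gen :=
  if b then match g with r0 => r1 | r1 => r2 | _ => r3 end else g.
(** The Boolean is read as a number: the section runs from level [b] to level [4 + b]. *)
Definition lo (b : bool) (F : flag) : T := ext (sval F) b.
Definition hi (b : bool) (F : flag) : T := ext (sval F) (4 + b).

Definition section_of (b : bool) (F : flag) := section_rel le (hi b F) (lo b F).
Arguments section_of : clear implicits.

Lemma lo_hi b F : le (lo b F) (hi b F).
Proof. by apply: ext_le; [exact: svalP | case: b | case: b]. Qed.

Lemma section_iso b F G : section_regular le -> order_iso (section_of b F) (section_of b G).
Proof.
move=> sr; apply: (sr _ _ _ _ (4 + b) b); try exact: lo_hi;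
  by apply: ext_level; [exact: svalP | case: b].
Qed.

Section InSection.
Variables (b : bool) (F0 : flag).

(** The flags of the section itself: those with the same facet as [F0], or with the same vertex.
    They differ in three faces only. *)
Definition parallel (F : flag) := lo b F = lo b F0 /\ hi b F = hi b F0.

Lemma parallel_flip F g : g <> r3 -> parallel F -> parallel (flip (shift b g) F).
Proof.
move=> g3 [l h]; rewrite /parallel -l -h /lo /hi.
by split; apply: ext_flip; case: (b); case: g g3.
Qed.

Lemma parallel_chain F : parallel F ->
  [/\ lt (lo b F0) (sval F (shift b r0)), lt (sval F (shift b r0)) (sval F (shift b r1)),
      lt (sval F (shift b r1)) (sval F (shift b r2)) & lt (sval F (shift b r2)) (hi b F0)].
Proof.
by case=> <- <-; have inc := svalP F; rewrite /lo /hi; case: b; split;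
  [exact: (inc 1)|exact: (inc 2)|exact: (inc 3)|exact: (inc 4)
  |exact: (inc 0)|exact: (inc 1)|exact: (inc 2)|exact: (inc 3)].
Qed.

Lemma parallel_eq F G : parallel F -> parallel G ->
  sval F (shift b r0) = sval G (shift b r0) -> sval F (shift b r1) = sval G (shift b r1) ->
  sval F (shift b r2) = sval G (shift b r2) -> F = G.
Proof.
move=> [l1 h1] [l2 h2]; rewrite -l2 in l1; rewrite -h2 in h1; move: l1 h1 {l2 h2}.
by rewrite /lo /hi; case: b => /= e1 e2 e3 e4 e5; apply: flag_inj => -[].
Qed.

Definition inside x := le (lo b F0) x /\ le x (hi b F0).

Lemma parallel_inside F g : parallel F -> g <> r3 -> inside (sval F (shift b g)).
Proof.
move=> /parallel_chain[[h0 _] [h1 _] [h2 _] [h3 _]].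
have h02 := le_trans h1 h2; have h13 := le_trans h2 h3; have h01 := le_trans h0 h1.
by case: g => // _; split=> //; [exact: le_trans h02 h3 | exact: le_trans h0 h02].
Qed.

Lemma section_code L R : coded (section_of b F0) L R ->
  exists cod : T -> bitseq, (forall x, inside x -> cod x \in L) /\
    forall x y, inside x -> inside y -> (le x y <-> R (cod x) (cod y)).
Proof.
move=> [code [hL hR]].
exists (fun x => if pselect (inside x) is left h then code (exist _ x h) else [::]).
split=> [x hx|x y hx hy]; first by case: pselect.
by case: pselect => // hx'; case: pselect => // hy'; rewrite -hR.
Qed.

(** The codes of the three varying faces follow the flips: each flip is one of the moves in
    [code_steps]. The check brings the triple back to its start up to [mutual], and antisymmetry of
    [le] turns this into equality of faces, hence of flags. *)
Lemma coded_relation L R rels u : coded (section_of b F0) L R ->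
  codes_satisfy L R rels -> List.In u rels -> all (fun g => if g is r3 then false else true) u.1 ->
  forall F, parallel F -> wact flip (map (shift b) (relword u)) F = F.
Proof.
move=> /section_code[cod [hL hR]] hsat hu hu3 F pF.
have ltP x y : inside x -> inside y -> (lt x y <-> strict R (cod x) (cod y)).
  move=> ix iy; split=> [[l ne]|/andP[/(hR _ _ ix iy) l /negP n]].
    apply/andP; split; first exact/hR.
    by apply/negP => /(hR _ _ iy ix) l'; apply: ne; exact: le_anti.
  by split=> // e; apply: n; apply/(hR _ _ iy ix); rewrite e.
have eqP_ x y : inside x -> inside y -> mutual R (cod x) (cod y) -> x = y.
  by move=> ix iy /andP[/(hR _ _ ix iy) l /(hR _ _ iy ix)]; exact: le_anti.
set P := proper_codes L R.
have ilo : inside (lo b F0) by split=> //; exact: lo_hi.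
have ihi : inside (hi b F0) by split=> //; exact: lo_hi.
have properP x : lt (lo b F0) x -> lt x (hi b F0) -> cod x \in P.
  move=> lx xh; have ix : inside x by split; [case: lx | case: xh].
  rewrite mem_filter hL // andbT; apply/andP; split; apply/hasP.
    by exists (cod (lo b F0)); [exact: hL | exact/ltP].
  by exists (cod (hi b F0)); [exact: hL | exact/ltP].
have memP G g : parallel G -> g <> r3 -> cod (sval G (shift b g)) \in P.
  move=> pG g3; have [h0 h1 h2 h3] := parallel_chain pG.
  have h02 := lt_trans h1 h2; have h13 := lt_trans h2 h3; have h01 := lt_trans h0 h1.
  by apply: properP; case: g g3 => // _ //; [exact: lt_trans h0 h02 | exact: lt_trans h02 h3].
pose tri (G : flag) := (cod (sval G (shift b r0)), cod (sval G (shift b r1)),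
  cod (sval G (shift b r2))).
have step G g : parallel G -> g <> r3 -> tri (flip (shift b g) G) \in code_steps R P g (tri G).
  move=> pG g3; have pG' := parallel_flip g3 pG; set G' := flip _ _ in pG' *.
  have [h0 h1 h2 h3] := parallel_chain pG'.
  have oth h : h <> r3 -> h <> g -> sval G' (shift b h) = sval G (shift b h).
    by move=> h3' ne; apply: flip_other; case: b g h {G' pG' h0 h1 h2 h3} g3 h3' ne => -[] [].
  have dif : ~~ mutual R (cod (sval G' (shift b g))) (cod (sval G (shift b g))).
    apply/negP => /eqP_ e; apply: (@flip_same (shift b g) G); apply: e; exact: parallel_inside.
  have str h k : h <> r3 -> k <> r3 -> lt (sval G' (shift b h)) (sval G' (shift b k)) ->
      strict R (cod (sval G' (shift b h))) (cod (sval G' (shift b k))).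
    by move=> h3' k3' l; apply/ltP => //; exact: parallel_inside.
  have s01 : strict R (cod (sval G' (shift b r0))) (cod (sval G' (shift b r1))) by exact: str.
  have s12 : strict R (cod (sval G' (shift b r1))) (cod (sval G' (shift b r2))) by exact: str.
  rewrite /tri; case: g g3 @G' pG' oth dif {h0 h1 h2 h3 str} s01 s12
    => // g3 G' pG' oth dif s01 s12.
  - rewrite -(oth r1) // -(oth r2) //=; apply/mapP.
    by exists (cod (sval G' (shift b r0))); rewrite // mem_filter s01 dif memP.
  - rewrite -(oth r0) // -(oth r2) //=; apply/mapP.
    by exists (cod (sval G' (shift b r1))); rewrite // mem_filter s01 s12 dif memP.
  - rewrite -(oth r0) // -(oth r1) //=; apply/mapP.
    by exists (cod (sval G' (shift b r2))); rewrite // mem_filter s12 dif memP.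
(* A path of flips stays in the section, and its end is among the ends of the candidate paths. *)
have ends w G ts : parallel G -> all (fun g => if g is r3 then false else true) w -> tri G \in ts ->
    parallel (wact flip (map (shift b) w) G) /\
    tri (wact flip (map (shift b) w) G) \in
      foldl (fun ts g => flatten [seq code_steps R P g t | t <- ts]) ts w.
  elim: w G ts => // g w IH G ts pG /andP[g3 w3] hts; have {}g3 : g <> r3 by case: g g3.
  apply: IH => //; first exact: parallel_flip.
  by apply/flattenP; exists (code_steps R P g (tri G)); [apply: map_f | exact: step].
have w3 : all (fun g => if g is r3 then false else true) (relword u).
  by rewrite /relword /power; elim: (u.2) => //= k IH; rewrite all_cat hu3.
have [pE hE] := ends (relword u) F [:: tri F] pF w3 (mem_head _ _).
have [_ h1 h2 _] := parallel_chain pF.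
have [n0 n1 n2] : [/\ r0 <> r3, r1 <> r3 & r2 <> r3] by [].
have [[i0 i1] i2] := (parallel_inside pF n0, parallel_inside pF n1, parallel_inside pF n2).
have m0 := memP F r0 pF n0.
have m1 : cod (sval F (shift b r1)) \in [seq y <- P | strict R (cod (sval F (shift b r0))) y].
  by rewrite mem_filter memP // andbT; exact/ltP.
have m2 : cod (sval F (shift b r2)) \in [seq y <- P | strict R (cod (sval F (shift b r1))) y].
  by rewrite mem_filter memP // andbT; exact/ltP.
have := all_In (allP (allP (allP hsat _ m0) _ m1) _ m2) hu.
move/allP => /(_ _ hE) /and3P[e0 e1 e2].
by apply/esym/parallel_eq => //; apply: eqP_ => //; exact: parallel_inside.
Qed.

(* In a (dual) dihedron all faces of two consecutive ranks are incident, which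
   makes the corresponding flips commute. *)
Lemma graded_flip_comm (lv : T -> nat) g h :
  (forall x y, inside x -> inside y -> lt x y -> lv x < lv y) ->
  (forall x, inside x -> lv x <= 4) ->
  h <> r3 -> idx h = (idx g).+1 ->
  (forall x y, inside x -> inside y -> lv x = idx g -> lv y = idx h -> le x y) ->
  forall F, parallel F ->
    flip (shift b g) (flip (shift b h) F) = flip (shift b h) (flip (shift b g) F).
Proof.
move=> lv_lt lv4 h3 ih lv_le F pF.
have g3 : g <> r3 by case: g h h3 ih {lv_le} => -[].
(* Levels increase strictly along the five faces from [lo] to [hi] and are at most 4, so they must
   be 0, 1, 2, 3, 4. *)
have lvE G k : parallel G -> k <> r3 -> lv (sval G (shift b k)) = idx k.
  move=> pG k3; have [l0 l1 l2 l3] := parallel_chain pG.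
  have i0 := parallel_inside pG (g := r0) ltac:(by []).
  have i1 := parallel_inside pG (g := r1) ltac:(by []).
  have i2 := parallel_inside pG (g := r2) ltac:(by []).
  have ilo : inside (lo b F0) by split=> //; exact: lo_hi.
  have ihi : inside (hi b F0) by split=> //; exact: lo_hi.
  have := lv4 _ ihi; move: (lv_lt _ _ ilo i0 l0) (lv_lt _ _ i0 i1 l1) (lv_lt _ _ i1 i2 l2)
    (lv_lt _ _ i2 ihi l3); case: k k3 => //= _ {lv_le lv_lt lv4}; lia.
set g' := shift b g; set h' := shift b h.
have ih' : idx h' = (idx g').+1 by rewrite /g' /h'; case: (b) g h h3 ih {lv_le g' h' g3} => -[] [].
have pg := parallel_flip g3 pF; have ph := parallel_flip h3 pF.
apply: flip_comm => [e|]; first by have := n_Sn (idx g'); rewrite -ih' e.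
have [g1 g2] := flip_between g' F; have [h1 h2] := flip_between h' F.
apply: set_face_increasing; first exact: set_face_increasing (svalP F) g1 g2.
  (* The two new faces still have levels [idx g] and [idx h], so they are incident by assumption and
     can be inserted together. *)
  rewrite /below ext_set_face ih' eqxx; split.
    apply: lv_le; [exact: parallel_inside pg g3 | exact: parallel_inside ph h3
      | exact: lvE pg g3 | exact: lvE ph h3].
  move=> /(congr1 lv); rewrite (lvE _ _ pg g3) (lvE _ _ ph h3) ih; exact: n_Sn.
rewrite /above ext_set_face; case: eqP => // e.
by have := ltnSn (idx g'); rewrite -{1}e ih' ltnNge ltnW.
Qed.

Lemma dih_flip_comm p : order_iso (section_of b F0) (@dih_rel p) ->
  forall F, parallel F ->
    flip (shift b r1) (flip (shift b r2) F) = flip (shift b r2) (flip (shift b r1) F).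
Proof.
move=> [f [/bij_inj f_inj hf]].
pose lv x := if pselect (inside x) is left h then dih_level (f (exist _ x h)) else 0.
apply: (graded_flip_comm (lv := lv)) => //.
- move=> x y ix iy [l ne]; rewrite /lv; case: pselect => // hx; case: pselect => // hy.
  have /dih_rel_level[/f_inj[]//|//] : dih_rel (f (exist _ x hx)) (f (exist _ y hy)) by apply/hf.
- by move=> x ix; rewrite /lv; case: pselect => // hx; case: (f _).
- move=> x y ix iy; rewrite /lv; case: pselect => // hx; case: pselect => // hy lx ly.
  apply: (proj2 (hf (exist _ x hx) (exist _ y hy))).
  by case: (f _) lx => //= i _; case: (f _) ly.
Qed.

Lemma dual_dih_flip_comm p : order_iso (section_of b F0) (dual_rel (@dih_rel p)) ->
  forall F, parallel F ->
    flip (shift b r0) (flip (shift b r1) F) = flip (shift b r1) (flip (shift b r0) F).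
Proof.
move=> [f [/bij_inj f_inj hf]].
(* Duality reverses the levels 0 to 4: the fully incident pair of levels 2 and 3 becomes 1 and 2,
   which concerns [r0] and [r1]. *)
pose lv x := if pselect (inside x) is left h then 4 - dih_level (f (exist _ x h)) else 0.
apply: (graded_flip_comm (lv := lv)) => //.
- move=> x y ix iy [l ne]; rewrite /lv; case: pselect => // hx; case: pselect => // hy.
  have /dih_rel_level[/f_inj[]/esym//|lt4] :
      dih_rel (f (exist _ y hy)) (f (exist _ x hx)) by apply/hf.
  have : dih_level (f (exist _ x hx)) <= 4 by case: (f _).
  by move: lt4; lia.
- by move=> x ix; rewrite /lv; case: pselect => // hx; exact: leq_subr.
- move=> x y ix iy; rewrite /lv; case: pselect => // hx; case: pselect => // hy lx ly.
  apply: (proj2 (hf (exist _ x hx) (exist _ y hy))); rewrite /dual_rel.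
  by case: (f _) lx => //= i _; case: (f _) ly.
Qed.

End InSection.

(** * From one section to relations on all flags *)

Lemma section_holds b F0 L R rels u : section_regular le -> coded (section_of b F0) L R ->
  codes_satisfy L R rels -> List.In u rels ->
  all (fun g => if g is r3 then false else true) u.1 ->
  holds flip (map (shift b) (relword u)).
Proof.
(* Each flag serves as its own base flag: the section through it is isomorphic to that of [F0] and
   inherits its codes. *)
move=> sr hc hs hu u3 F; apply: (coded_relation (F0 := F) _ hs hu u3) => //.
exact: coded_iso (section_iso b F F0 sr) hc.
Qed.

Lemma section_projective b F0 : section_regular le -> is_projective3 (section_of b F0) ->
  exists p q h, List.In (p, q, h) projective_types /\
    forall u, List.In u (petrie_rels p q h) -> holds flip (map (shift b) (relword u)).
Proof.
move=> sr /projective_coded[p [q [h [L [R [ht hs hc]]]]]]; exists p, q, h; split=> // u hu.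
by apply: (section_holds sr hc hs hu); case: hu => [<-|[<-|[<-|//]]].
Qed.

Lemma section_spherical b F0 : section_regular le -> sph_or_proj3 (section_of b F0) ->
  [\/ exists p q, List.In (p, q) spherical_types /\
        forall u, List.In u (face_rels p q) -> holds flip (map (shift b) (relword u)),
      holds flip (map (shift b) (relword (wd "12", 2))) |
      holds flip (map (shift b) (relword (wd "01", 2)))].
Proof.
move=> sr /sph_or_proj_coded[[p [q [L [R [rels [ht sub hs hc]]]]]]|[p [hp|hp]]].
- constructor 1; exists p, q; split=> // u hu.
  by apply: (section_holds sr hc hs (sub u hu)); case: hu => [<-|[<-|//]].
- have comm F : flip (shift b r1) (flip (shift b r2) F) = flip (shift b r2) (flip (shift b r1) F).
    by apply: (@dih_flip_comm b F p) => //; exact: order_iso_trans (section_iso b F F0 sr) hp.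
  by constructor 2 => F; rewrite /= comm !flipK.
- have comm F : flip (shift b r0) (flip (shift b r1) F) = flip (shift b r1) (flip (shift b r0) F).
    by apply: (@dual_dih_flip_comm b F p) => //; exact: order_iso_trans (section_iso b F F0 sr) hp.
  by constructor 3 => F; rewrite /= comm !flipK.
Qed.

Lemma flip_free g F : flip g F <> F.
Proof. by move/(congr1 (fun G : flag => sval G g)); exact: flip_same. Qed.

Lemma flip_neq g h F : g <> h -> flip g F <> flip h F.
Proof.
move=> gh /(congr1 (fun G : flag => sval G g)); rewrite (flip_other _ gh); exact: flip_same.
Qed.

Lemma facet_spherical F : section_regular le -> sph_or_proj3 (section_of false F) ->
  spherical_facet flip.
Proof.
move=> sr /(section_spherical sr)[[p [q [ht h]]]|h|h].
- constructor 1; exists p, q; split=> // u hu.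
  by rewrite -[relword u]map_id; apply: h; move: hu => /=; tauto.
- by constructor 2; rewrite -[relword _]map_id.
- by constructor 3; rewrite -[relword _]map_id.
Qed.

(** The generators of a vertex figure are shifted by one, so the [p] and [q] of the section become
    the second and third entries of the rank 4 symbol. *)
Lemma vertex_projective F : section_regular le -> is_projective3 (section_of true F) ->
  projective_vertex_figure flip.
Proof.
move=> sr /(section_projective sr)[p [q [h [ht hr]]]]; exists p, q, h; split=> // u.
have rel w k : List.In (w, k) (petrie_rels p q h) -> holds flip (relword (map (shift true) w, k)).
  by move/hr; rewrite map_relword.
by case=> [<-|[<-|[<-|//]]]; [apply: (rel (wd "12")) | apply: (rel (wd "01"))
  | apply: (rel (wd "012"))]; rewrite /=; tauto.
Qed.

Local Notation flip' := (fun g => flip (mirror g)).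

(** A vertex figure {p,q} is, up to duality, a facet {q,p}. The list of spherical types is closed
    under this exchange, and the two degenerate cases are swapped. *)
Lemma vertex_spherical_mirror F : section_regular le -> sph_or_proj3 (section_of true F) ->
  spherical_facet flip'.
Proof.
move=> sr /(section_spherical sr)[[p [q [ht h]]]|h|h].
- constructor 1; exists q, p; split.
    by case: ht => [|[|[|[|[|//]]]]] [<- <-]; rewrite /=; tauto.
  have rel w k : List.In (w, k) (face_rels p q) ->
      holds flip' (relword (rev (map mirror (map (shift true) w)), k)).
    by move/h; rewrite map_relword => /(holds_mirror flipK).
  by move=> u [<-|[<-|//]]; [apply: (rel (wd "01")) | apply: (rel (wd "12"))];
    rewrite /=; tauto.
- by constructor 3; move: h; rewrite map_relword => /(holds_mirror flipK).
- by constructor 2; move: h; rewrite map_relword => /(holds_mirror flipK).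
Qed.

Lemma facet_projective_mirror F : section_regular le -> is_projective3 (section_of false F) ->
  projective_vertex_figure flip'.
Proof.
move=> sr /(section_projective sr)[p [q [h [ht hr]]]]; exists q, p, h; split.
  by case: ht => [|[|[|[|//]]]] [<- <- <-]; rewrite /=; tauto.
have rel w k : List.In (w, k) (petrie_rels p q h) ->
    holds flip' (relword (rev (map mirror (map (shift false) w)), k)).
  by move/hr; rewrite map_relword => /(holds_mirror flipK).
by move=> u [<-|[<-|[<-|//]]]; [apply: (rel (wd "01")) | apply: (rel (wd "12"))
  | apply: (rel (wd "012"))]; rewrite /=; tauto.
Qed.

(** The enumerations assume projective vertex figures. If it is the facets that are given as
    projective, the mirrored generators, which describe the dual polytope, take the place of the
    flips. *)
Lemma finite_of_projective_section F : section_regular le ->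
  sph_or_proj3 (section_of false F) -> sph_or_proj3 (section_of true F) ->
  is_projective3 (section_of false F) \/ is_projective3 (section_of true F) ->
  finite_type T.
Proof.
move=> sr sf sv hp; apply: (finite_of_flags (F := F)).
case: hp => [pf|pv]; last first.
  apply: (locproj_finite flipK) => //.
  - by move=> G; exact: flip_free.
  - by move=> G; exact: flip_neq.
  - exact: flip_relators.
  - exact: facet_spherical sf.
  - exact: vertex_projective pv.
apply: finite_orbit_mirror; apply: locproj_finite => //.
- by move=> g; exact: flipK.
- by move=> G; exact: flip_free.
- by move=> G; exact: flip_neq.
- move=> u hu; have rel w : List.In (w, 2) [:: (wd "13", 2); (wd "03", 2); (wd "02", 2)] ->
      holds flip' (relword (rev (map mirror w), 2)).
    by move/flip_relators/(holds_mirror flipK).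
  by case: hu => [<-|[<-|[<-|//]]]; [apply: (rel (wd "02")) | apply: (rel (wd "03"))
    | apply: (rel (wd "13"))]; rewrite /=; tauto.
- exact: vertex_spherical_mirror sv.
- exact: facet_projective_mirror pf.
Qed.

End Polytope.

Unset Implicit Arguments.

Theorem theorem4p1 (T : Type) (le : T -> T -> Prop) :
  abstract_polytope le 4 -> locally_projective4 le -> finite_type T.
Proof.
move=> hP [sr hl]; have [_ [[bot hb] [top ht]] _ _ _] := hP.
have {hl}[hfac hver hproj] := hl bot top hb ht.
have [F _] := flag_exists hP hb ht.
have level i : i < 6 -> has_level le (ext bot top (sval F) i) i.
  by move=> i6; apply: (ext_level hP (svalP F) i6).
apply: (@finite_of_projective_section T le hP bot top hb ht F sr).
- exact: hfac (level 4 isT).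
- exact: hver (level 1 isT).
(* Section regularity carries the projective section that is given to the corresponding section
   through the chosen flag [F]. *)
case: hproj => [[G [l4 pG]]|[v [l1 pv]]]; [left|right]; apply: projective_iso.
- by apply: (sr _ _ _ _ 4 0 _ (hb G) (level 4 isT) l4 (level 0 isT) (level 0 isT)); exact: hb.
- exact: pG.
- by apply: (sr _ _ _ _ 5 1 _ (ht v) (level 5 isT) (level 5 isT) (level 1 isT) l1); exact: ht.
- exact: pv.
Qed.
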